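(* For every $0<t<1$ there exist a two-dimensional Riemannian manifold $M$ and a Bowen homeomorphism $f$ of $M$, with associated saddles $x_1,x_2$ and associated open set $V$, such that $$\mathcal O_{f|\overline V}=\{t\,\delta_{x_1}+(1-t)\,\delta_{x_2}\}.$$
   Context: A Bowen homeomorphism is a homeomorphism $f$ of a two-dimensional manifold $M$ which is non-singular (i.e. $m(f^{-1}(B))=0$ if and only if $m(B)=0$, where $m$ is the Lebesgue measure) and satisfies: (i) $f$ has three fixed points $x_1,x_2,x_3$. (ii) Restricted to the union of three small compact pairwise disjoint neighbourhoods $U_1,U_2,U_3$ of $x_1,x_2,x_3$ respectively, $f$ is a diffeomorphism onto $f(U_1\cup U_2\cup U_3)$; the fixed points $x_1,x_2$ are hyperbolic saddles and $x_3$ is a hyperbolic source. (iii) $W^s_1\setminus\{x_1\}=W^u_2\setminus\{x_2\}$ and $W^u_1\setminus\{x_1\}=W^s_2\setminus\{x_2\}$, where $W^{s}_{i},W^{u}_{i}$ denote half-branches of the global one-dimensional stable and unstable manifolds of $x_i$, $i=1,2$. They are embedded topological arcs, of $C^1$ type in a neighbourhood of the saddles. Thus $W^s_1\cup W^s_2$ is a compact, simple, closed arc, which is the boundary of an open set $V$ homeomorphic to a 2-ball. (iv) $x_3\in V$, and every orbit in $V\setminus\{x_3\}$ includes $x_1$ and $x_2$ in its $\omega$-limit set and has $\{x_3\}$ as $\alpha$-limit set. For $x\in M$, let $\nu_n(x)=\frac1n\sum_{j=0}^{n-1}\delta_{f^j(x)}$ and let $\mathcal L^*(x)$ be the set of all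 weak$^*$-limits of convergent subsequences of $\{\nu_n(x)\}_{n\ge1}$. Fix a metric $\mathrm{dist}^*$ inducing the weak$^*$ topology on Borel probability measures. For a forward invariant set $B$ ($B\subset f^{-1}(B)$) of positive Lebesgue measure, $\mathcal O_{f|B}$ denotes the set of all SRB-like measures for $f|_B$: probability measures $\mu$ such that for all $\epsilon>0$ the set $\{x\in B:\ \mathrm{dist}^*(\mathcal L^*(x),\mu)<\epsilon\}$ has positive Lebesgue measure. Here $\mathrm{dist}^*(\mathcal L^*(x),\mu)$ is the distance from $\mu$ to the set $\mathcal L^*(x)$. *)

(* Defs.v *)
From HB Require Import structures.
From mathcomp Require Import all_boot all_order all_algebra.
From mathcomp Require Import complex.
From mathcomp Require Import all_classical all_reals all_analysis.
Set Implicit Arguments.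
Unset Strict Implicit.
Unset Printing Implicit Defensive.
Import Order.TTheory GRing.Theory Num.Theory.
Import numFieldNormedType.Exports.
Local Open Scope classical_set_scope.
Local Open Scope ring_scope.

Definition homeomorphic (X Y : topologicalType) (A : set X) (B : set Y) : Prop :=
  exists (f : X -> Y) (g : Y -> X),
    [/\ {within A, continuous f}, {within B, continuous g},
        f @` A = B, g @` B = A & forall x, A x -> g (f x) = x].

Section plane.
Variable R : realType.
Implicit Types (p : R * R) (f : R * R -> R) (F : R * R -> R * R).

Definition coord (a : 'I_2) p : R := if a == 0 then p.1 else p.2.

Definition basis_vector (b : 'I_2) : R * R := if b == 0 then (1, 0) else (0, 1).

Definition partial (b : 'I_2) f p : R := 'D_(basis_vector b) f p.

(* Used only for open D, where it is the usual notion of a C^k function. *)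
Fixpoint Ck (k : nat) (D : set (R * R)) f : Prop :=
  (forall p, D p -> {for p, continuous f}) /\
  (if k is k'.+1 then
     forall b, (forall p, D p -> derivable f p (basis_vector b)) /\
               Ck k' D (partial b f)
   else True).

Definition Ck_map (k : nat) (D : set (R * R)) F : Prop :=
  forall a, Ck k D (coord a \o F).

Definition jacobian2 F p : 'M[R]_2 :=
  \matrix_(a, b) partial b (coord a \o F) p.

Definition open_disc : set (R * R) := [set p | p.1 ^+ 2 + p.2 ^+ 2 < 1].

Definition unit_circle : set (R * R) := [set p | p.1 ^+ 2 + p.2 ^+ 2 = 1].

Definition eigenvalueC (A : 'M[R]_2) (z : R[i]) : bool :=
  eigenvalue (map_mx (real_complex R) A) z.

Definition hyperbolic_saddle (A : 'M[R]_2) : Prop :=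
  [/\ forall z, eigenvalueC A z -> `|z| != 1,
      exists2 z, eigenvalueC A z & `|z| < 1
    & exists2 z, eigenvalueC A z & 1 < `|z| ].

Definition hyperbolic_source (A : 'M[R]_2) : Prop :=
  forall z, eigenvalueC A z -> 1 < `|z|.

End plane.

Definition borel (T : ptopologicalType) := g_sigma_algebraType (@open T).

(* A smooth Riemannian surface without boundary: smooth atlas, metric tensor
   in coordinates, and Riemannian volume on the Borel sets.  The axiom volE
   determines vol, because the charts cover a second countable space.  The base
   point carried by ptopologicalType (needed by the library to form the Borel
   sigma-algebra) only says that the surface is nonempty. *)
Record riemannian_surface (R : realType) := RiemannianSurface {
  carrier :> ptopologicalType ;
  carrier_hausdorff : hausdorff_space carrier ;
  carrier_second_countable : @second_countable carrier ;
  index : Type ;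
  dom : index -> set carrier ;
  chart : index -> carrier -> R * R ;
  param : index -> R * R -> carrier ;
  dom_open : forall i, open (dom i) ;
  dom_cover : forall x, exists i, dom i x ;
  chart_open : forall i, open (chart i @` dom i) ;
  chartK : forall i x, dom i x -> param i (chart i x) = x ;
  chart_continuous : forall i, {within dom i, continuous (chart i)} ;
  param_continuous : forall i, {within chart i @` dom i, continuous (param i)} ;
  transition_smooth : forall i j k,
    Ck_map k (chart i @` (dom i `&` dom j)) (chart j \o param i) ;
  metric : index -> R * R -> 'M[R]_2 ;
  metric_smooth : forall i k a b,
    Ck k (chart i @` dom i) (fun p => metric i p a b) ;
  metric_sym : forall i p, (chart i @` dom i) p -> (metric i p)^T = metric i p ;
  metric_pos : forall i p (v : 'rV[R]_2), (chart i @` dom i) p -> v != 0 ->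
    0 < (v *m metric i p *m v^T) 0 0 ;
  metric_transition : forall i j p, (chart i @` (dom i `&` dom j)) p ->
    let J := jacobian2 (chart j \o param i) p in
    metric i p = J^T *m metric j (chart j (param i p)) *m J ;
  vol : {measure set (borel carrier) -> \bar R} ;
  volE : forall i (B : set (borel carrier)), measurable B -> B `<=` dom i ->
    vol B = (\int[lebesgue_measure \x lebesgue_measure]_(p in chart i @` B)
               (Num.sqrt (\det (metric i p)))%:E)%E
}.

Section surface.
Variables (R : realType) (M : riemannian_surface R).
Implicit Types (f g : M -> M) (x : M) (B O U V W : set M).

Definition homeomorphism_pair f g : Prop :=
  [/\ continuous f, continuous g, cancel f g & cancel g f].

Definition nonsingular f : Prop :=
  forall B : set (borel M), measurable B ->
    (vol M (f @^-1` B) = 0%E <-> vol M B = 0%E).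

Definition local_expr f (i j : index M) : R * R -> R * R :=
  chart j \o f \o param i.

Definition C1_on O f : Prop := forall i j : index M,
  Ck_map 1 (chart i @` (dom i `&` O `&` f @^-1` dom j)) (local_expr f i j).

(* f, with inverse g, restricts to a diffeomorphism of A onto f(A): both maps
   are C^1 on open neighbourhoods of A and of f(A). *)
Definition diffeomorphism_on f g (A : set M) : Prop :=
  (exists O, [/\ open O, A `<=` O & C1_on O f]) /\
  (exists O, [/\ open O, f @` A `<=` O & C1_on O g]).

Definition saddle_at f x : Prop := forall i : index M, dom i x ->
  hyperbolic_saddle (jacobian2 (local_expr f i i) (chart i x)).

Definition source_at f x : Prop := forall i : index M, dom i x ->
  hyperbolic_source (jacobian2 (local_expr f i i) (chart i x)).

Definition stable_set f x : set M :=
  [set y | iter n f y @[n --> \oo] --> x].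

Definition C1_curve_near0 (c : R -> M) : Prop :=
  forall i : index M, dom i (c 0) -> exists2 e : R, 0 < e &
    forall s, `|s| < e ->
      [/\ dom i (c s),
          forall a : 'I_2, derivable (coord a \o chart i \o c) s 1,
          forall a : 'I_2, {for s, continuous (derive1 (coord a \o chart i \o c))}
        & exists a : 'I_2, derive1 (coord a \o chart i \o c) s != 0].

(* W is a half-branch, containing x, of the global stable manifold of the
   saddle x.  The line c parametrizes the whole manifold; the locally uniform
   convergence of the iterates says that c is continuous for the topology of
   the immersed manifold, i.e. every compact piece of c is mapped by some
   iterate into the local stable manifold.  Half-branches of the unstable
   manifold are obtained by applying this to the inverse of f. *)
Definition stable_half_branch f x W : Prop :=
  exists c : R -> M,
    [/\ c 0 = x /\ continuous c, injective c /\ range c = stable_set f x,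
        forall N r, nbhs x N ->
          \forall n \near \oo, forall s, `|s| <= r -> N (iter n f (c s)),
        C1_curve_near0 c
      & W = c @` [set s | 0 <= s]].

Definition embedded_arc W : Prop := homeomorphic [set s : R | 0 <= s] W.

Definition omega_limit f x : set M := cluster (iter n f x @[n --> \oo]).

Definition bowen_homeomorphism f (x1 x2 x3 : M) V : Prop :=
  exists (g : M -> M) (U1 U2 U3 Ws1 Wu1 Ws2 Wu2 : set M),
  [/\ homeomorphism_pair f g /\ nonsingular f,
      [/\ f x1 = x1, f x2 = x2, f x3 = x3 & [/\ x1 <> x2, x1 <> x3 & x2 <> x3]],
      [/\ [/\ compact U1, compact U2 & compact U3],
          [/\ nbhs x1 U1, nbhs x2 U2 & nbhs x3 U3],
          [/\ U1 `&` U2 = set0, U1 `&` U3 = set0 & U2 `&` U3 = set0],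
          diffeomorphism_on f g (U1 `|` U2 `|` U3)
        & [/\ saddle_at f x1, saddle_at f x2 & source_at f x3]],
      [/\ [/\ stable_half_branch f x1 Ws1, stable_half_branch g x1 Wu1,
              stable_half_branch f x2 Ws2 & stable_half_branch g x2 Wu2],
          [/\ embedded_arc Ws1, embedded_arc Wu1,
              embedded_arc Ws2 & embedded_arc Wu2],
          Ws1 `\ x1 = Wu2 `\ x2 /\ Wu1 `\ x1 = Ws2 `\ x2,
          compact (Ws1 `|` Ws2) /\ homeomorphic (@unit_circle R) (Ws1 `|` Ws2)
        & [/\ open V, homeomorphic (@open_disc R) V
            & closure V `\` interior V = Ws1 `|` Ws2]]
    & V x3 /\
      forall y, V y -> y <> x3 ->
        [/\ omega_limit f y x1, omega_limit f y x2
          & omega_limit g y = [set x3]]].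

Local Notation P := (probability (borel M) R).

Definition empirical f x (n : nat) : {measure set (borel M) -> \bar R} :=
  mscale (n%:R^-1)%:nng (msum (fun j => \d_(iter j f x : borel M)) n).

(* Test functions: the bounded continuous ones; boundedness is automatic when
   the surface is compact. *)
Definition test_function (phi : M -> R) : Prop :=
  continuous phi /\ exists C, forall x, `|phi x| <= C.

Definition weak_star_cvg (nu : nat -> {measure set (borel M) -> \bar R}) (mu : P)
    : Prop :=
  forall phi, test_function phi ->
    \int[nu n]_x phi x @[n --> \oo] --> \int[mu]_x phi x.

Definition weak_star_nbhs (mu : P) (N : set P) : Prop :=
  exists (n : nat) (phi : 'I_n -> M -> R) (e : R),
    [/\ 0 < e, forall k, test_function (phi k)
      & forall nu : P,
          (forall k, `| \int[nu]_x phi k x - \int[mu]_x phi k x | < e) -> N nu].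

(* Measures of the library are functions on all subsets, with arbitrary values
   outside the sigma-algebra: equality of measures is equality on it. *)
Definition eq_on_borel (mu nu : set (borel M) -> \bar R) : Prop :=
  forall A : set (borel M), measurable A -> mu A = nu A.

Definition weak_star_metric (dist : P -> P -> R) : Prop :=
  [/\ forall mu nu, 0 <= dist mu nu,
      forall mu nu, dist mu nu = 0 <-> eq_on_borel mu nu,
      forall mu nu, dist mu nu = dist nu mu,
      forall mu nu rho, dist mu rho <= dist mu nu + dist nu rho
    & forall mu N, (exists2 e, 0 < e & [set nu | dist mu nu < e] `<=` N) <->
                   weak_star_nbhs mu N].

Definition limit_measures f x : set P :=
  [set mu | exists s : nat -> nat, {homo s : m n / (m < n)%N} /\
              weak_star_cvg (fun k => empirical f x (s k)) mu].

Definition dist_to_set (dist : P -> P -> R) (K : set P) (mu : P) : \bar R :=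
  ereal_inf [set (dist nu mu)%:E | nu in K].

Definition forward_invariant f B : Prop := B `<=` f @^-1` B.

Definition positive_volume B : Prop := ~ (vol M).-negligible B.

Definition SRB_like (dist : P -> P -> R) f B : set P :=
  [set mu | forall e : R, 0 < e ->
     positive_volume
       [set x | B x /\ (dist_to_set dist (limit_measures f x) mu < e%:E)%E]].

Definition two_atoms (t : R) (x1 x2 : M) (A : set (borel M)) : \bar R :=
  (t%:E * \d_(x1 : borel M) A + (1 - t)%:E * \d_(x2 : borel M) A)%E.

End surface.

(* Main.v *)
Require Import Defs.
From HB Require Import structures.
From mathcomp Require Import all_boot all_order all_algebra.
From mathcomp Require Import complex.
From mathcomp Require Import all_classical all_reals all_analysis.
From mathcomp Require Import measurable_realfun.
From mathcomp Require Import ring lra.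
Set Implicit Arguments.
Unset Strict Implicit.
Unset Printing Implicit Defensive.
Import Order.TTheory GRing.Theory Num.Theory.
Import numFieldNormedType.Exports.
Local Open Scope classical_set_scope.
Local Open Scope ring_scope.

(** On the plane, al = 1 - depth - y and be = 1 - depth + y are coordinates on
    each of the half planes x <= 0 and x >= 0, and V = {al, be > 0} has the
    corners (-1, 0) and (1, 0).  The homeomorphism is a composition
    [step \o push].  [step] preserves theta = al * be; near the boundary of V it
    is (al, be) -> (al / L, L be) on the left and (al, be) -> (K al, be / K) on
    the right, so that its orbits circulate in V, and it is the identity near
    the origin.  [push] expands radially; it doubles near the origin and is the
    identity near the saddles and outside V.  In V it makes theta a strict
    Lyapunov function away from the origin, so that forward orbits accumulate
    on the boundary and backward orbits converge to the origin.

    With t ln L = 1 and (1 - t) ln K = 1, a passage at level theta lasts about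
    t |ln theta| steps on the left and (1 - t) |ln theta| on the right.  More
    precisely, t (1 - t) ln be is a coboundary whose increments are 1 - t on the
    left and - t on the right, up to an error on the steps spent far from the
    saddles, which have density zero.  Hence the empirical measures of every
    orbit of V other than the source converge to
    t delta_(-1, 0) + (1 - t) delta_(1, 0), and the rest of the closure of V is
    null.  Null sets are preserved because the map and its inverse are piecewise
    restrictions of locally Lipschitz maps. *)

(** * Coordinates *)

(** When the saddles of a Bowen map contract area, successive passages lengthen geometrically and
    time averages oscillate. Here each saddle has eigenvalues J and 1 / J, so [step] conserves theta
    and only [push], which acts away from the saddles, lowers it. Then |ln theta| grows sublinearly
    in time and the averages converge. In exchange, attraction to the boundary is not hyperbolic: it
    has to come from LaSalle's principle.

    This puts opposite demands on [push]: it must fix neighbourhoods of both saddles, yet move some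
    point of every orbit of V except the source. Its fixed points in V, other than the source,
    therefore lie so close to the x-axis that no orbit can change half plane among them. It also at
    most halves al and be, a loss of ln 2 < 1 per step that cannot cancel the unit progress of a
    passage.

    Piecewise formulas make the map exactly affine near its fixed points. Two symmetries replace
    half of the computations: [rot] exchanges the saddles together with L and K, and [refl]
    conjugates [step] to its inverse. *)

Section coordinates.
Variable R : realType.
Implicit Types (p q : R * R) (a b : R).

(** The maximum does two things. Near (-1, 0) and (1, 0) depth is |x|, so al and be are affine
    there. And max(al, be) = 1 exactly on the y-axis, so each closed half plane becomes the quadrant
    al <= 1, be <= 1, with the y-axis as the section between passages. *)
Definition depth p : R := Num.max `|p.1| (`|p.1| / 2 + `|p.2|).
Definition al p : R := 1 - depth p - p.2.
Definition be p : R := 1 - depth p + p.2.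
Definition gauge p : R := depth p + `|p.2|.
Definition theta p : R := al p * be p.

(* The point of coordinates (a, b) in the right half plane if [r], else in the
   left one. *)
Definition pt (r : bool) a b : R * R :=
  ((if r then 1 else -1) * Num.min (1 - (a + b) / 2) (2 * (1 - Num.max a b)),
   (b - a) / 2).

Definition rot p : R * R := (- p.1, - p.2).
Definition refl p : R * R := (p.1, - p.2).

Lemma al_le1 p : al p <= 1.
Proof.
rewrite /al /depth; case: (leP `|p.1|); case: (ger0P p.1); case: (ger0P p.2); lra.
Qed.

Lemma be_le1 p : be p <= 1.
Proof.
rewrite /be /depth; case: (leP `|p.1|); case: (ger0P p.1); case: (ger0P p.2); lra.
Qed.

Lemma depth_pt r a b : a <= 1 -> b <= 1 -> depth (pt r a b) = 1 - (a + b) / 2.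
Proof.
move=> a1 b1; rewrite /depth /pt /= normrM.
have -> : `|(if r then 1 else -1 : R)| = 1 by case: r; rewrite ?normrN normr1.
rewrite mul1r; case: (leP a b) => ab.
- rewrite (ger0_norm (x := (b - a) / 2)); last lra.
  by case: (leP (1 - (a + b) / 2)) => h; rewrite ger0_norm; try lra;
    case: leP; lra.
- rewrite (ler0_norm (x := (b - a) / 2)); last lra.
  by case: (leP (1 - (a + b) / 2)) => h; rewrite ger0_norm; try lra;
    case: leP; lra.
Qed.

Lemma al_pt r a b : a <= 1 -> b <= 1 -> al (pt r a b) = a.
Proof. by move=> a1 b1; rewrite /al depth_pt //= ; lra. Qed.

Lemma be_pt r a b : a <= 1 -> b <= 1 -> be (pt r a b) = b.
Proof. by move=> a1 b1; rewrite /be depth_pt //= ; lra. Qed.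

Lemma pt_coord (r : bool) p : (if r then 0 <= p.1 else p.1 <= 0) ->
  pt r (al p) (be p) = p.
Proof.
case: p => x y; rewrite /pt /al /be /depth /= => h; congr pair; last lra.
have {h} [e ->] : (if r then 1 else -1 : R) * `|x| = x /\
  Num.min (1 - (1 - Num.max `|x| (`|x| / 2 + `|y|) - y +
  (1 - Num.max `|x| (`|x| / 2 + `|y|) + y)) / 2)
  (2 * (1 - Num.max (1 - Num.max `|x| (`|x| / 2 + `|y|) - y)
     (1 - Num.max `|x| (`|x| / 2 + `|y|) + y))) = `|x|; last by [].
split; first by case: r h => h; [rewrite ger0_norm ?mul1r|rewrite ler0_norm ?mulN1r ?opprK].
have := normr_ge0 x.
case: (ger0P y) => y0; case: (leP `|x|) => h2 x0.
- rewrite max_r; last lra. case: (leP (1 - _ / 2)) => ?; lra.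
- rewrite max_r; last lra. case: (leP (1 - _ / 2)) => ?; lra.
- rewrite max_l; last lra. case: (leP (1 - _ / 2)) => ?; lra.
- rewrite max_l; last lra. case: (leP (1 - _ / 2)) => ?; lra.
Qed.

Lemma pt_fst_ge0 a b : a <= 1 -> b <= 1 ->
  0 <= Num.min (1 - (a + b) / 2) (2 * (1 - Num.max a b)).
Proof.
move=> a1 b1; case: (leP a b) => ?; case: (leP (1 - (a + b) / 2)) => ?; lra.
Qed.

(** The hypothesis is the equation of the y-axis; every gluing of a left formula with a right one
    rests on this. *)
Lemma pt_glue a b : Num.max a b = 1 -> pt true a b = pt false a b.
Proof.
rewrite /pt => ab; have [a1 b1] : a <= 1 /\ b <= 1.
  by rewrite -ab !le_max !lexx orbT.
rewrite ab; congr pair.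
by case: (leP (1 - (a + b) / 2)) => ?; lra.
Qed.

Lemma pt_false_fst a b : a <= 1 -> b <= 1 -> (pt false a b).1 <= 0.
Proof. by move=> a1 b1; have := pt_fst_ge0 a1 b1; rewrite /pt /=; lra. Qed.

Lemma pt_true_fst a b : a < 1 -> b < 1 -> 0 < (pt true a b).1.
Proof.
rewrite /pt /= => a1 b1.
case: (leP a b) => ?; case: (leP (1 - (a + b) / 2)) => ?; lra.
Qed.

Lemma rotK : involutive rot.
Proof. by case=> x y; rewrite /rot /= !opprK. Qed.

Lemma reflK : involutive refl.
Proof. by case=> x y; rewrite /refl /= opprK. Qed.

Lemma depth_rot p : depth (rot p) = depth p.
Proof. by rewrite /depth /= !normrN. Qed.

Lemma depth_refl p : depth (refl p) = depth p.
Proof. by rewrite /depth /= !normrN. Qed.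

Lemma al_rot p : al (rot p) = be p.
Proof. by rewrite /al depth_rot /= opprK. Qed.
Lemma be_rot p : be (rot p) = al p.
Proof. by rewrite /be depth_rot. Qed.
Lemma al_refl p : al (refl p) = be p.
Proof. by rewrite /al depth_refl /= opprK. Qed.
Lemma be_refl p : be (refl p) = al p.
Proof. by rewrite /be depth_refl. Qed.

Lemma refl_rot p : refl (rot p) = rot (refl p).
Proof. by []. Qed.

Lemma rot_pt r a b : rot (pt r a b) = pt (~~ r) b a.
Proof.
rewrite /rot /pt /= (addrC a) (maxC a); congr pair; last lra.
by case: r; rewrite /= ?mul1r ?mulN1r ?opprK.
Qed.

Lemma refl_pt r a b : refl (pt r a b) = pt r b a.
Proof. by rewrite /refl /pt /= (addrC a) (maxC a); congr pair; lra. Qed.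

Lemma theta_rot p : theta (rot p) = theta p.
Proof. by rewrite /theta al_rot be_rot mulrC. Qed.
Lemma theta_refl p : theta (refl p) = theta p.
Proof. by rewrite /theta al_refl be_refl mulrC. Qed.

(** Hence V, where al and be are positive, is the open unit ball of the homogeneous function
    [gauge], which is what makes a radial push possible. *)
Lemma gauge_al_be p : gauge p = 1 - Num.min (al p) (be p).
Proof.
by rewrite /gauge /al /be; case: (ger0P p.2) => ?; case: leP; lra.
Qed.

Lemma gauge_ge0 p : 0 <= gauge p.
Proof. by rewrite addr_ge0 // le_max normr_ge0. Qed.

Lemma theta_le1 p : gauge p <= 1 -> theta p <= 1.
Proof.
rewrite gauge_al_be /theta; have := al_le1 p; have := be_le1 p.
by case: (leP (al p) (be p)) => h b1 a1 g; rewrite mulr_ile1 //; lra.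
Qed.

End coordinates.

(** * Continuity of functions defined by cases *)

Section continuity.
Variable R : realType.

Lemma continuous_if_le (T U : topologicalType) (h : T -> R) (F G : T -> U) :
  continuous h -> continuous F -> continuous G ->
  (forall p, h p = 0 -> F p = G p) ->
  continuous (fun p => if h p <= 0 then F p else G p).
Proof.
move=> ch cF cG FG p; case: (ltgtP (h p) 0) => hp A /=.
- rewrite (ltW hp) => nA.
  have near_lt := @cvgr_lt _ _ (nbhs p) (nbhs_filter p) h (h p) (ch p) 0 hp.
  rewrite /nbhs /=; apply: filterS2 near_lt (cF p A nA) => q hq Fq.
  by rewrite /= (ltW hq).
- rewrite leNgt hp /= => nA.
  have near_gt := @cvgr_gt _ _ (nbhs p) (nbhs_filter p) h (h p) (ch p) 0 hp.
  rewrite /nbhs /=; apply: filterS2 near_gt (cG p A nA) => q hq Fq.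
  by rewrite /= leNgt hq.
- rewrite hp lexx => nA.
  have nF : nbhs p (F @^-1` A) := cF p A nA.
  have nG : nbhs p (G @^-1` A) by apply: cG; rewrite -FG.
  by apply: (filterS2 _ _ nF nG) => q /= Fq Gq; case: ifP.
Qed.

Lemma cont_pair (T U V : topologicalType) (F : T -> U) (G : T -> V) :
  continuous F -> continuous G -> continuous (fun p => (F p, G p)).
Proof. by move=> cF cG p; apply: cvg_pair; [exact: cF | exact: cG]. Qed.

Lemma cont_fst (T U : topologicalType) : continuous (@fst T U).
Proof. by move=> p; exact: cvg_fst. Qed.

Lemma cont_snd (T U : topologicalType) : continuous (@snd T U).
Proof. by move=> p; exact: cvg_snd. Qed.

Variable T : topologicalType.
Implicit Types F G : T -> R.

Lemma cont_add F G : continuous F -> continuous G ->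
  continuous (fun p => F p + G p).
Proof. by move=> cF cG p; apply: cvgD; [exact: cF | exact: cG]. Qed.

Lemma cont_mul F G : continuous F -> continuous G ->
  continuous (fun p => F p * G p).
Proof. by move=> cF cG p; apply: cvgM; [exact: cF | exact: cG]. Qed.

Lemma cont_opp F : continuous F -> continuous (fun p => - F p).
Proof. by move=> cF p; apply: cvgN; exact: cF. Qed.

Lemma cont_norm F : continuous F -> continuous (fun p => `|F p|).
Proof. by move=> cF p; apply: cvg_norm; exact: cF. Qed.

Lemma cont_inv F : (forall p, F p != 0) -> continuous F ->
  continuous (fun p => (F p)^-1).
Proof. by move=> F0 cF p; apply: cvgV => //; exact: cF. Qed.

Lemma cont_cst (c : R) : continuous (fun _ : T => c).
Proof. by move=> p; exact: cvg_cst. Qed.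

Lemma cont_max F G : continuous F -> continuous G ->
  continuous (fun p => Num.max (F p) (G p)).
Proof. by move=> cF cG p; apply: continuous_max; [exact: cF | exact: cG]. Qed.

Lemma cont_min F G : continuous F -> continuous G ->
  continuous (fun p => Num.min (F p) (G p)).
Proof. by move=> cF cG p; apply: continuous_min; [exact: cF | exact: cG]. Qed.

End continuity.

Ltac cont := lazymatch goal with
  | |- forall _, continuous_at _ (fun _ => ?c) => exact: (@cont_cst _ _ c)
  | |- forall _, continuous_at _ (fun p => (@?F p, @?G p)) =>
      apply: (@cont_pair _ _ _ F G); cont
  | |- forall _, continuous_at _ (fun p => @?F p + @?G p) =>
      apply: (@cont_add _ _ F G); cont
  | |- forall _, continuous_at _ (fun p => - @?F p) =>
      apply: (@cont_opp _ _ F); cont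
  | |- forall _, continuous_at _ (fun p => @?F p * @?G p) =>
      apply: (@cont_mul _ _ F G); cont
  | |- forall _, continuous_at _ (fun p => Num.max (@?F p) (@?G p)) =>
      apply: (@cont_max _ _ F G); cont
  | |- forall _, continuous_at _ (fun p => Num.min (@?F p) (@?G p)) =>
      apply: (@cont_min _ _ F G); cont
  | |- forall _, continuous_at _ (fun p => Num.norm (@?F p)) =>
      apply: (@cont_norm _ _ F); cont
  | |- forall _, continuous_at _ (fun p => p.1) => exact: cont_fst
  | |- forall _, continuous_at _ (fun p => p.2) => exact: cont_snd
  | |- _ => try assumption
  end.

Section coordinates_continuous.
Variable R : realType.

Lemma depth_continuous : continuous (@depth R).
Proof. by rewrite /depth; cont. Qed.
Lemma al_continuous : continuous (@al R).
Proof. by have h := depth_continuous; rewrite /al; cont. Qed.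
Lemma be_continuous : continuous (@be R).
Proof. by have h := depth_continuous; rewrite /be; cont. Qed.
Lemma gauge_continuous : continuous (@gauge R).
Proof. by have h := depth_continuous; rewrite /gauge; cont. Qed.
Lemma theta_continuous : continuous (@theta R).
Proof.
by have h := al_continuous; have h' := be_continuous; rewrite /theta; cont.
Qed.
Lemma rot_continuous : continuous (@rot R).
Proof. by rewrite /rot; cont. Qed.
Lemma refl_continuous : continuous (@refl R).
Proof. by rewrite /refl; cont. Qed.
End coordinates_continuous.
(** * The map step *)

Section half_step.
Variables (R : realType) (kap L K : R).
Hypotheses (L1 : 1 < L) (K1 : 1 < K) (LK : L * K = kap).
Implicit Types (p q : R * R) (z b x : R).

(** The transition takes place for theta between 1 / (2 kap^2) and 1 / kap^2. A speed above 1 thus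
    forces theta < 1 / kap^2, so that theta times any factor up to kap stays below 1. *)
Definition rate z : R := Num.min 1 (Num.max 0 (2 - 2 * kap ^+ 2 * z)).
(* [J] near the boundary of V, 1 near the origin. *)
Definition speed (J : R) z : R := 1 + (J - 1) * rate z.
(* The overshoot x of be beyond the section be = 1, which ranges over
   [1, speed J z], is sent affinely onto [1 / speed J' z, 1], the values that be
   takes in the other half plane just after the section. *)
Definition land (J J' : R) z x : R :=
  1 - (x - 1) * ((J' - 1) / (J - 1)) / speed J' z.
(** This is 1 as long as speed * be <= 1, since [land] sends 1 to 1. Truncating the overshoot from
    below lets one formula cover both staying and crossing. *)
Definition stretch (J J' : R) z b : R :=
  Num.max 1 (speed J z * b) / land J J' z (Num.max 1 (speed J z * b)).
Definition half (J J' : R) p : R * R :=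
  pt (1 < speed J (theta p) * be p)
     (al p * stretch J J' (theta p) (be p) / speed J (theta p))
     (be p * speed J (theta p) / stretch J J' (theta p) (be p)).
Definition step (J J' : R) p : R * R :=
  if p.1 <= 0 then half J J' p else rot (half J' J (rot p)).

Lemma kap_gt1 : 1 < kap.
Proof. by rewrite -LK; move: L1 K1; nra. Qed.

Lemma rate_ge0 z : 0 <= rate z.
Proof. by rewrite /rate le_min ler01 le_max lexx. Qed.

Lemma rate_le1 z : rate z <= 1.
Proof. by rewrite /rate ge_min lexx. Qed.

Lemma rate1 z : 2 * kap ^+ 2 * z <= 1 -> rate z = 1.
Proof. by move=> h; rewrite /rate max_r ?min_l //; lra. Qed.

Lemma rate0 z : 1 <= kap ^+ 2 * z -> rate z = 0.
Proof. by move=> h; rewrite /rate max_l ?min_r ?ler01 //; lra. Qed.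

Lemma speed_ge1 J z : 1 < J -> 1 <= speed J z.
Proof. by move=> J1; have := rate_ge0 z; rewrite /speed; nra. Qed.

Lemma speed_le J z : 1 < J -> speed J z <= J.
Proof. by move=> J1; have := rate_le1 z; rewrite /speed; nra. Qed.

Lemma speedE J z : 2 * kap ^+ 2 * z <= 1 -> speed J z = J.
Proof. by move=> h; rewrite /speed rate1 //; ring. Qed.

Lemma speed_theta J z : 1 < J -> J <= kap -> z <= 1 -> 1 < speed J z ->
  z * speed J z < 1.
Proof.
move=> J1 Jk z1 s1; have k1 := kap_gt1.
case: (leP z 0) => z0; first by have := speed_ge1 z J1; nra.
have hz : kap ^+ 2 * z < 1.
  by rewrite ltNge; apply/negP => h; move: s1; rewrite /speed rate0 //; lra.
have := speed_le z J1; have : 0 < kap * z by nra.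
rewrite expr2 in hz; move=> h1 h2; have : z * speed J z <= z * kap by nra.
nra.
Qed.

Lemma L_le_kap : L <= kap.
Proof. by rewrite -LK; move: L1 K1; nra. Qed.
Lemma K_le_kap : K <= kap.
Proof. by rewrite -LK; move: L1 K1; nra. Qed.

Lemma speed_mul_le1 J z : 1 < J -> J <= kap -> z <= 1 -> z * speed J z <= 1.
Proof.
move=> J1 Jk z1; case: (ltP 1 (speed J z)) => s1; first exact/ltW/speed_theta.
have e : speed J z = 1 by apply: le_anti; rewrite s1 speed_ge1.
by rewrite e mulr1.
Qed.

(** The excesses of both speeds over 1 are multiples of the same rate, which cancels in the slope of
    [land]: nothing degenerates where the rate vanishes. In this form the identity also shows that
    landing back from the other side recovers the overshoot, which inverts a crossing. *)
Lemma landK z x : speed K z * land L K z x - 1 =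
  (K - 1) / (L - 1) * (speed L z - x).
Proof.
rewrite /land; have := speed_ge1 z K1 => s1.
have s0 : speed K z != 0 by lra.
have l0 : L - 1 != 0 by move: L1; lra.
rewrite mulrBr mulr1 mulrC divfK // /speed.
by field.
Qed.

Lemma land_ge z x : x <= speed L z -> (speed K z)^-1 <= land L K z x.
Proof.
move=> xs; have := speed_ge1 z K1 => s1.
rewrite -div1r ler_pdivrMr; last lra.
rewrite mulrC -subr_ge0 landK mulr_ge0 ?subr_ge0 // divr_ge0 //;
  move: L1 K1; lra.
Qed.

Lemma land_gt0 z x : x <= speed L z -> 0 < land L K z x.
Proof.
by move=> /land_ge; apply: lt_le_trans; rewrite invr_gt0;
  have := speed_ge1 z K1; lra.
Qed.

Lemma land_lt1 z x : 1 < x -> land L K z x < 1.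
Proof.
move=> x1; rewrite /land ltrBlDr ltrDl divr_gt0 //; last first.
  by have := speed_ge1 z K1; lra.
by rewrite mulr_gt0 ?subr_gt0 // divr_gt0 ?subr_gt0.
Qed.

Lemma half_stay p : speed L (theta p) * be p <= 1 ->
  half L K p = pt false (al p / speed L (theta p)) (be p * speed L (theta p)).
Proof.
move=> h; rewrite /half /stretch max_l // ltNge h /= /land subrr !mul0r subr0.
by rewrite divr1 mulr1 divr1.
Qed.

Lemma half_cross p (j := land L K (theta p) (speed L (theta p) * be p)) :
  1 < speed L (theta p) * be p -> half L K p = pt true (theta p / j) j.
Proof.
move=> h; rewrite /half /stretch h max_r ?ltW // -/j.
have s0 : speed L (theta p) != 0.
  by have := speed_ge1 (theta p) L1; lra.
have j0 : j != 0.
  rewrite gt_eqF // /j land_gt0 // ler_piMr ?be_le1 //.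
  by have := speed_ge1 (theta p) L1; lra.
have b0 : be p != 0 by apply/eqP => b0; move: h; rewrite b0; lra.
by congr pt; rewrite /theta in s0 *; field; rewrite ?s0 ?j0 ?b0.
Qed.

Lemma theta_ub p : theta p <= 1 \/ (al p < 0) && (be p < 0).
Proof.
have := al_le1 p; have := be_le1 p; rewrite /theta => b1 a1.
case: (ltP (al p) 0) => a0; case: (ltP (be p) 0) => b0 /=; [by right|left..].
- by nra.
- by nra.
- by rewrite mulr_ile1.
Qed.

(** A crossing lands with be >= 1 / speed K, so the new al is at most theta * speed K, which
    [speed_theta] keeps below 1. The speed on the other side does exceed 1, because a crossing
    forces a positive rate. *)
Lemma cross_al p (j := land L K (theta p) (speed L (theta p) * be p)) :
  1 < speed L (theta p) * be p -> theta p / j < 1.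
Proof.
move=> h; have s1 := speed_ge1 (theta p) L1.
have xs : speed L (theta p) * be p <= speed L (theta p).
  by rewrite ler_piMr ?be_le1 //; lra.
have j0 := land_gt0 xs; rewrite ltr_pdivrMr // mul1r.
case: (leP (theta p) 0) => z0; first exact: le_lt_trans z0 j0.
have z1 : theta p <= 1.
  by case: (theta_ub p) => // /andP[_ b0]; move: h; nra.
have sK1 : 1 < speed K (theta p).
  have b1 := be_le1 p; have : 1 < speed L (theta p) by nra.
  rewrite /speed; have := rate_ge0 (theta p); move: L1 K1; nra.
have := speed_theta K1 K_le_kap z1 sK1; have := land_ge xs.
rewrite -/j; set s := speed K _ in sK1 *.
rewrite -div1r ler_pdivrMr; last lra.
by move: z0 sK1; set z := theta p; nra.
Qed.

Lemma stay_al p : al p / speed L (theta p) <= 1.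
Proof.
have s1 := speed_ge1 (theta p) L1; rewrite ler_pdivrMr; last lra.
by rewrite mul1r (le_trans (al_le1 p)).
Qed.

Lemma half_le1 p : al p * stretch L K (theta p) (be p) / speed L (theta p) <= 1
  /\ be p * speed L (theta p) / stretch L K (theta p) (be p) <= 1.
Proof.
have s1 := speed_ge1 (theta p) L1.
case: (leP (speed L (theta p) * be p) 1) => h.
- rewrite /stretch max_l // /land subrr !mul0r subr0 divr1 mulr1 divr1.
  by rewrite stay_al mulrC.
- have := half_cross h; rewrite /half h.
  set a := _ / _; set b := _ / stretch _ _ _ _; set j := land _ _ _ _.
  have xs : speed L (theta p) * be p <= speed L (theta p).
    by rewrite ler_piMr ?be_le1 //; lra.
  have j0 := land_gt0 xs; have b0 : be p != 0.
    by apply/eqP => b0; move: h; rewrite b0; lra.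
  have s0 : speed L (theta p) != 0 by lra.
  have -> : a = theta p / j.
    rewrite /a /stretch max_r ?ltW // -/j /theta; field.
    by rewrite s0 gt_eqF.
  have -> : b = j.
    rewrite /b /stretch max_r ?ltW // -/j; field.
    by rewrite s0 gt_eqF //= b0.
  by move=> _; rewrite !ltW // ?land_lt1 // cross_al.
Qed.

Lemma theta_half p : theta (half L K p) = theta p.
Proof.
have [a1 b1] := half_le1 p; rewrite {1}/theta /half al_pt // be_pt //.
have s1 := speed_ge1 (theta p) L1.
have s0 : speed L (theta p) != 0 by lra.
have M0 : stretch L K (theta p) (be p) != 0.
  rewrite gt_eqF // divr_gt0 //; first by rewrite lt_max ltr01.
  by rewrite land_gt0 // ge_max s1 ler_piMr ?be_le1 //; lra.
rewrite [RHS]/theta; set s := speed _ _ in s0 *; set M := stretch _ _ _ _ in M0 *.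
by field; rewrite s0 M0.
Qed.

End half_step.

Section step_map.
Variables (R : realType) (kap L K : R).
Hypotheses (L1 : 1 < L) (K1 : 1 < K) (LK : L * K = kap).
Implicit Types (p q : R * R).
Let KL : K * L = kap. Proof. by rewrite mulrC. Qed.

Lemma theta_step p : theta (step kap L K p) = theta p.
Proof.
rewrite /step; case: ifP => _; first exact: (theta_half L1 K1 LK).
by rewrite theta_rot (theta_half K1 L1 KL) theta_rot.
Qed.

Lemma axis_max p : p.1 = 0 -> Num.max (al p) (be p) = 1.
Proof.
case: p => x y /= ->; rewrite /al /be /depth /= normr0 mul0r add0r.
by rewrite [Num.max 0 _]max_r //; case: (ger0P y) => y0; case: leP => h; lra.
Qed.

(** On the upper half of the y-axis the overshoot is maximal and lands at be = 1 / speed K', which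
    is also what one step of the right-hand dynamics makes of be = 1. *)
Lemma half_glue_be (L' K' : R) p : 1 < L' -> 1 < K' -> L' * K' = kap ->
  p.1 = 0 -> be p = 1 ->
  half kap L' K' p = rot (half kap K' L' (rot p)).
Proof.
move=> L1' K1' LK' p0 b1; have z : theta p = al p by rewrite /theta b1 mulr1.
have KL' : K' * L' = kap by rewrite mulrC.
have sK : speed kap K' (theta (rot p)) * be (rot p) <= 1.
  rewrite theta_rot be_rot -z mulrC.
  by rewrite (speed_mul_le1 L1' K1' LK') // ?z ?al_le1 // (K_le_kap L1' K1' LK').
rewrite (half_stay L' sK) theta_rot al_rot be_rot rot_pt /= b1.
have sK1 := speed_ge1 kap (theta p) K1'.
case: (leP (speed kap L' (theta p) * be p) 1) => h.
- rewrite half_stay // b1.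
  move: h; rewrite b1 mulr1 => h.
  (* Not overshooting from be = 1 means that the speed is 1; both formulas then fix p. *)
  have r0 : rate kap (theta p) = 0.
    by have := rate_ge0 kap (theta p); move: h; rewrite /speed; nra.
  rewrite /speed r0 !mulr0 !addr0 divr1 !mulr1.
  have e : Num.max (al p) 1 = 1 by rewrite max_r ?al_le1.
  by rewrite divr1 (pt_glue e).
- rewrite (half_cross L1' K1') //.
  set j := land _ _ _ _ _; have -> : j = (speed kap K' (theta p))^-1.
    have := landK kap L1' K1' (theta p) (speed kap L' (theta p) * be p).
    rewrite b1 mulr1 subrr mulr0 -/j => h2.
    have s0 : speed kap K' (theta p) != 0 by lra.
    apply: (mulfI s0); rewrite mulfV // /j b1 mulr1; lra.
  by rewrite invrK div1r {1}z.
Qed.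

Lemma half_glue p : p.1 = 0 ->
  half kap L K p = rot (half kap K L (rot p)).
Proof.
move=> p0; have := axis_max p0; case: (leP (al p) (be p)) => _ h.
  exact: half_glue_be.
have q0 : (rot p).1 = 0 by rewrite /= p0 oppr0.
by rewrite (half_glue_be (p := rot p) K1 L1) // ?be_rot // !rotK.
Qed.

Lemma step_right p : 0 <= p.1 -> step kap L K p = rot (half kap K L (rot p)).
Proof.
rewrite le_eqVlt => /orP[/eqP/esym p0|p0]; last by rewrite /step leNgt p0.
by rewrite /step p0 lexx half_glue.
Qed.

Lemma half_continuous : continuous (half kap L K).
Proof.
have cth := @theta_continuous R; have cbe := @be_continuous R.
have cal := @al_continuous R.
have crate : continuous (fun p : R * R => rate kap (theta p)).
  by rewrite /rate; cont.
have cspeed J : continuous (fun p : R * R => speed kap J (theta p)).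
  by rewrite /speed; cont.
have s0 J p : 1 < J -> speed kap J (theta p) != 0.
  by move=> J1; have := speed_ge1 kap (theta p) J1; lra.
have cL := cspeed L; have cK := cspeed K.
have cKi : continuous (fun p : R * R => (speed kap K (theta p))^-1).
  by apply: cont_inv => // p; exact: s0.
have cLi : continuous (fun p : R * R => (speed kap L (theta p))^-1).
  by apply: cont_inv => // p; exact: s0.
pose mx p := Num.max 1 (speed kap L (theta p) * be p).
have cmx : continuous mx by rewrite /mx; cont.
have cland : continuous (fun p => land kap L K (theta p) (mx p)).
  by rewrite /land; cont.
have land0 p : land kap L K (theta p) (mx p) != 0.
  have := speed_ge1 kap (theta p) L1 => s1.
  by rewrite gt_eqF // (land_gt0 L1 K1) // ge_max s1 ler_piMr ?be_le1 //; lra.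
have clandi : continuous (fun p => (land kap L K (theta p) (mx p))^-1).
  exact: cont_inv.
have cst : continuous (fun p => stretch kap L K (theta p) (be p)).
  by rewrite /stretch; cont.
have csti : continuous (fun p => (stretch kap L K (theta p) (be p))^-1).
  apply: cont_inv => // p; rewrite /stretch mulf_neq0 ?invr_eq0 ?land0 //.
  by rewrite gt_eqF // lt_max ltr01.
pose A p := al p * stretch kap L K (theta p) (be p) / speed kap L (theta p).
pose B p := be p * speed kap L (theta p) / stretch kap L K (theta p) (be p).
have cA : continuous A by rewrite /A; cont.
have cB : continuous B by rewrite /B; cont.
have -> : half kap L K = fun p => if speed kap L (theta p) * be p - 1 <= 0
    then pt false (A p) (B p) else pt true (A p) (B p).
  apply/funext => p; rewrite /half -/(A p) -/(B p) subr_le0.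
  by case: leP.
apply: continuous_if_le; rewrite /pt; cont.
move=> p /eqP; rewrite subr_eq0 => /eqP e; apply/esym/pt_glue.
have [A1 B1] := half_le1 L1 K1 LK p; rewrite -/(A p) -/(B p) in A1 B1.
suff e1 : B p = 1 by rewrite e1 max_r.
by rewrite /B /stretch e maxxx /land subrr !mul0r subr0 divr1 divr1 mulrC.
Qed.

Lemma step_continuous_gen : continuous (half kap K L) ->
  continuous (step kap L K).
Proof.
move=> cH; rewrite /step; apply: continuous_if_le.
- exact: cont_fst.
- exact: half_continuous.
- move=> p; apply: (@continuous_comp _ _ _ (fun q => half kap K L (rot q))).
    by apply: continuous_comp; [exact: rot_continuous | exact: cH].
  exact: rot_continuous.
- exact: half_glue.
Qed.

(** Time reversal: [refl] exchanges al and be, so dividing one and multiplying the other is undone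
    by the same operation on the reflected point. After a crossing, the way back is a step from the
    right half plane, evaluated through [landK]. *)
Lemma step_refl_left p : p.1 <= 0 ->
  refl (step kap L K (refl (step kap L K p))) = p.
Proof.
move=> p0; rewrite [step _ _ _ p]/step p0.
have s1 := speed_ge1 kap (theta p) L1.
have s0 : speed kap L (theta p) != 0 by lra.
case: (leP (speed kap L (theta p) * be p) 1) => h.
- have a1 := stay_al kap L1 p; have b1 := h; rewrite mulrC in b1.
  rewrite half_stay //; set q := pt _ _ _.
  have q0 : (refl q).1 <= 0 by rewrite pt_false_fst.
  have zq : theta q = theta p by rewrite /theta al_pt // be_pt //; field.
  have hq : speed kap L (theta (refl q)) * be (refl q) <= 1.
    by rewrite theta_refl zq be_refl al_pt // mulrC divfK ?al_le1.
  rewrite /step q0 half_stay // theta_refl al_refl be_refl zq al_pt // be_pt //.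
  by rewrite refl_pt mulfK // divfK //; exact: pt_coord.
- have b0 : be p != 0 by apply/eqP => b0; move: h; rewrite b0; lra.
  have a1 := cross_al L1 K1 LK h; have b1 := land_lt1 kap L1 K1 (theta p) h.
  have xs : speed kap L (theta p) * be p <= speed kap L (theta p).
    by rewrite ler_piMr ?be_le1 //; lra.
  have jge := land_ge L1 K1 xs; have := land_gt0 L1 K1 xs.
  rewrite (half_cross L1 K1) //; move: a1 b1 jge; set j := land _ _ _ _ _.
  move=> a1 b1 jge j0; set q := pt _ _ _.
  have q0 : 0 <= (refl q).1 by rewrite ltW // pt_true_fst.
  have zq : theta q = theta p.
    by rewrite [LHS]/theta al_pt ?be_pt ?ltW // divfK ?gt_eqF.
  have sK1 := speed_ge1 kap (theta p) K1.
  have sK0 : speed kap K (theta p) != 0 by lra.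
  rewrite step_right //.
  have alE : al (rot (refl q)) = theta p / j.
    by rewrite al_rot be_refl al_pt ?ltW.
  have beE : be (rot (refl q)) = j.
    by rewrite be_rot al_refl be_pt ?ltW.
  have zE : theta (rot (refl q)) = theta p by rewrite theta_rot theta_refl.
  have hK := landK kap L1 K1 (theta p) (speed kap L (theta p) * be p).
  rewrite -/j in hK.
  (* The way back fails to overshoot only when p lies on the y-axis, with be p = 1. *)
  case: (leP (speed kap K (theta p) * j) 1) => hj.
  + have ej : speed kap K (theta p) * j = 1.
      apply: le_anti; rewrite hj /= mulrC -ler_pdivrMr ?div1r //; lra.
    have bE : be p = 1.
      move: hK; rewrite ej subrr => /esym/eqP; rewrite mulf_eq0.
      rewrite gt_eqF ?divr_gt0 ?subr_gt0 //= subr_eq0 -{1}(mulr1 (speed _ _ _)).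
      by move=> /eqP /(mulfI s0).
    rewrite half_stay zE beE // alE refl_rot refl_pt rot_pt /=.
    have -> : j * speed kap K (theta p) = 1 by rewrite mulrC.
    have -> : theta p / j / speed kap K (theta p) = al p.
      rewrite -mulrA -invfM (mulrC j) ej invr1 mulr1 /theta bE mulr1 //.
    have e : Num.max (al p) 1 = 1 by rewrite max_r ?al_le1.
    by rewrite (pt_glue e) -{1}bE; exact: pt_coord.
  + rewrite (half_cross K1 L1) zE beE //.
    have -> : land kap K L (theta p) (speed kap K (theta p) * j) = be p.
      have l0 : L - 1 != 0 by move: L1; lra.
      have k0 : K - 1 != 0 by move: K1; lra.
      by rewrite {1}/land hK; field; rewrite s0 l0 k0.
    have -> : theta p / be p = al p by rewrite /theta mulfK.
    by rewrite rot_pt /= refl_pt pt_coord.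
Qed.

End step_map.

Section step_homeo.
Variables (R : realType) (kap L K : R).
Hypotheses (L1 : 1 < L) (K1 : 1 < K) (LK : L * K = kap).
Let KL : K * L = kap. Proof. by rewrite mulrC. Qed.
Implicit Types (p q : R * R).

Lemma step_rot p : step kap K L (rot p) = rot (step kap L K p).
Proof.
case: (leP p.1 0) => p0.
- rewrite (step_right K1 L1 KL) /=; last lra.
  by rewrite /step p0 rotK.
- rewrite {1}/step /= (_ : - p.1 <= 0); last lra.
  by rewrite (step_right L1 K1 LK (ltW p0)) rotK.
Qed.

Definition back p : R * R := refl (step kap L K (refl p)).

Lemma step_continuous : continuous (step kap L K).
Proof. by apply: step_continuous_gen => //; exact: (half_continuous K1 L1 KL). Qed.

Lemma back_continuous : continuous back.
Proof.
move=> p; apply: (@continuous_comp _ _ _ (fun q => step kap L K (refl q))).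
  by apply: continuous_comp; [exact: refl_continuous | exact: step_continuous].
exact: refl_continuous.
Qed.

Lemma stepK : cancel (step kap L K) back.
Proof.
move=> p; rewrite /back; case: (leP p.1 0) => p0.
  exact: (step_refl_left L1 K1 LK).
have q0 : (rot p).1 <= 0 by rewrite /=; lra.
have := step_refl_left K1 L1 KL q0.
rewrite step_rot refl_rot step_rot refl_rot => /(congr1 (@rot R)).
by rewrite !rotK.
Qed.

Lemma backK : cancel back (step kap L K).
Proof. by move=> p; have := stepK (refl p); rewrite /back => /(canRL (@reflK R)); rewrite reflK. Qed.

End step_homeo.

(** * The map push *)

Section scale.
Variable R : realType.
Implicit Types (c : R) (p : R * R).

Definition scale c p : R * R := (c * p.1, c * p.2).

Lemma scaleM c d p : scale c (scale d p) = scale (c * d) p.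
Proof. by rewrite /scale /= !mulrA. Qed.

Lemma scale1 p : scale 1 p = p.
Proof. by case: p => x y; rewrite /scale !mul1r. Qed.

Lemma depth_scale c p : 0 <= c -> depth (scale c p) = c * depth p.
Proof.
move=> c0; rewrite /depth /scale /= !normrM (ger0_norm c0) -mulrA -mulrDr.
by rewrite maxr_pMr.
Qed.

Lemma gauge_scale c p : 0 <= c -> gauge (scale c p) = c * gauge p.
Proof.
move=> c0; rewrite /gauge depth_scale // /scale /= normrM (ger0_norm c0).
by rewrite mulrDr.
Qed.

Lemma al_scale c p : 0 <= c -> al (scale c p) = 1 - c * (1 - al p).
Proof. by move=> c0; rewrite /al depth_scale //= ; ring. Qed.

Lemma be_scale c p : 0 <= c -> be (scale c p) = 1 - c * (1 - be p).
Proof. by move=> c0; rewrite /be depth_scale //= ; ring. Qed.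

Lemma al_gauge p : 1 - al p <= gauge p.
Proof. by rewrite /al /gauge; have := ler_norm p.2; lra. Qed.

Lemma be_gauge p : 1 - be p <= gauge p.
Proof. by rewrite /be /gauge; have := ler_norm (- p.2); rewrite normrN; lra. Qed.

Lemma gauge_eq0 p : gauge p = 0 -> p = (0, 0).
Proof.
case: p => x y; rewrite /gauge /depth /=; have := normr_ge0 x.
have := normr_ge0 y; case: (leP `|x|) => h y0 x0 e.
  have /eqP : `|x| = 0 by lra.
  have /eqP : `|y| = 0 by lra.
  by rewrite !normr_eq0 => /eqP -> /eqP ->.
have /eqP : `|x| = 0 by lra.
have /eqP : `|y| = 0 by lra.
by rewrite !normr_eq0 => /eqP -> /eqP ->.
Qed.

End scale.

Section radial_push.
Variables (R : realType) (kap : R).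
Hypothesis k1 : 1 < kap.
Implicit Types (c : R) (p q : R * R).

(* [push] moves p half way to the level [bound p] of the gauge, which is below 1
   only near the x-axis: this makes it the identity near the saddles.  The
   constant 1 / 8 makes it a dilation by 2 near the origin. *)
Definition gauge' p : R := Num.max (gauge p) (1 / 8).
(** Constant along rays away from the origin. The notch has depth 1 / (2 kap^2), which forces theta
    <= 1 / (2 kap^2), hence full speed, at the points of V other than the source that [push] fixes.
    Its width forces |y| < 1 / (4 kap) there. Both facts serve to exclude orbits that [push] never
    moves. *)
Definition bound p : R :=
  1 - (2 * kap ^+ 2)^-1 * Num.max 0 (1 - 4 * kap * `|p.2| / gauge' p).
(** On a ray with gauge r >= 1 / 8 and bound b, the push is r -> max(r, min(2 r, (r + b) / 2)); its
    inverse is r -> min(r, max(r / 2, 2 r - b)). *)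
Definition pushf p : R := Num.max 1 (Num.min 2 ((1 + bound p / gauge' p) / 2)).
Definition pullf p : R := Num.min 1 (Num.max (1 / 2) (2 - bound p / gauge' p)).
Definition push p : R * R := scale (pushf p) p.
Definition pull p : R * R := scale (pullf p) p.

Lemma gauge'_ge p : 1 / 8 <= gauge' p.
Proof. by rewrite /gauge' le_max lexx orbT. Qed.

Lemma gauge'_gt0 p : 0 < gauge' p.
Proof. by have := gauge'_ge p; lra. Qed.

Lemma kap2_inv : 0 < (2 * kap ^+ 2)^-1 < 1 / 2.
Proof.
have k2 : 1 < kap ^+ 2 by rewrite exprn_egt1.
apply/andP; split; first by rewrite invr_gt0; lra.
by rewrite div1r ltf_pV2 ?posrE; lra.
Qed.

Lemma bound_le1 p : bound p <= 1.
Proof.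
rewrite /bound gerBl mulr_ge0 // ?le_max ?lexx //.
by have /andP[] := kap2_inv; lra.
Qed.

Lemma bound_ge p : 1 - (2 * kap ^+ 2)^-1 <= bound p.
Proof.
rewrite /bound lerB // ler_piMr //; first by have /andP[] := kap2_inv; lra.
rewrite ge_max ler01 /= gerBl divr_ge0 //; last exact: ltW (gauge'_gt0 p).
by rewrite mulr_ge0 //; move: k1; lra.
Qed.

Lemma bound_ge2 p : 1 / 2 <= bound p.
Proof. by have := bound_ge p; have /andP[] := kap2_inv; lra. Qed.

Lemma gauge'_continuous : continuous gauge'.
Proof. by have h := @gauge_continuous R; rewrite /gauge'; cont. Qed.

Lemma gauge'_inv_continuous : continuous (fun p => (gauge' p)^-1).
Proof.
apply: cont_inv; last exact: gauge'_continuous.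
by move=> p; rewrite gt_eqF // gauge'_gt0.
Qed.

Lemma bound_continuous : continuous bound.
Proof. by have h := gauge'_inv_continuous; rewrite /bound; cont. Qed.

Lemma push_continuous : continuous push.
Proof.
have h := gauge'_inv_continuous; have h' := bound_continuous.
by rewrite /push /scale /pushf; cont.
Qed.

Lemma pull_continuous : continuous pull.
Proof.
have h := gauge'_inv_continuous; have h' := bound_continuous.
by rewrite /pull /scale /pullf; cont.
Qed.

Lemma bound_scale c p : 0 < c -> 1 / 8 <= gauge p -> 1 / 8 <= c * gauge p ->
  bound (scale c p) = bound p.
Proof.
move=> c0 h1 h2; rewrite /bound /gauge' gauge_scale ?ltW //.
rewrite (max_l h1) (max_l h2) /= normrM (gtr0_norm c0).
congr (1 - _ * Num.max 0 (1 - _)); field; apply/andP; split; lra.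
Qed.

Lemma pushf_small p : gauge p <= 1 / 8 -> pushf p = 2.
Proof.
move=> h; have := bound_ge2 p; rewrite /pushf /gauge' (max_r h) => b.
by rewrite min_l ?max_r //; lra.
Qed.

Lemma pullf_small p : gauge p <= 1 / 4 -> pullf p = 1 / 2.
Proof.
move=> h; have b := bound_ge2 p; have g0 := gauge'_gt0 p.
have g : gauge' p <= 1 / 4 by rewrite ge_max h /=; lra.
have : 2 <= bound p / gauge' p by rewrite ler_pdivlMr //; lra.
by rewrite /pullf => h2; rewrite max_l ?min_r //; lra.
Qed.

Lemma pushf_ge1 p : 1 <= pushf p.
Proof. by rewrite le_max lexx. Qed.

Lemma pullf_gt0 p : 0 < pullf p.
Proof. by rewrite lt_min ltr01 lt_max /= divr_gt0. Qed.

Variant pushf_spec (r b f : R) : Prop :=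
  | PushfDouble of f = 2 & 3 * r <= b
  | PushfMid of f * r = (r + b) / 2 & r <= b & b < 3 * r
  | PushfOne of f = 1 & b < r.

Lemma pushfP p : 1 / 8 <= gauge p -> pushf_spec (gauge p) (bound p) (pushf p).
Proof.
move=> h; rewrite /pushf /gauge' (max_l h); set b := bound p.
move: h; set r := gauge p => h; have hb : b / r * r = b by rewrite divfK //; lra.
case: (leP 2 ((1 + b / r) / 2)) => h2.
  apply: PushfDouble; first by rewrite max_r //; lra.
  by rewrite -hb ler_pM2r; lra.
case: (leP 1 ((1 + b / r) / 2)) => h3; last first.
  apply: PushfOne => //.
  have : (b / r) * r < 1 * r by rewrite ltr_pM2r; lra.
  lra.
apply: PushfMid; first by field; lra.
  by rewrite -hb -{1}(mul1r r) ler_pM2r; lra.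
by rewrite -hb ltr_pM2r; lra.
Qed.

Variant pullf_spec (r b f : R) : Prop :=
  | PullfHalf of f = 1 / 2 & 3 * r <= 2 * b
  | PullfMid of f * r = 2 * r - b & r <= b & 2 * b <= 3 * r
  | PullfOne of f = 1 & b <= r.

Lemma pullfP p : 1 / 8 <= gauge p -> pullf_spec (gauge p) (bound p) (pullf p).
Proof.
move=> h; rewrite /pullf /gauge' (max_l h); set b := bound p.
move: h; set r := gauge p => h; have hb : b / r * r = b by rewrite divfK //; lra.
case: (leP (1 / 2) (2 - b / r)) => h2; last first.
  apply: PullfHalf; first by rewrite min_r //; lra.
  have : 3 / 2 * r <= b / r * r by rewrite ler_pM2r; lra.
  lra.
case: (leP 1 (2 - b / r)) => h3; last first.
  apply: PullfMid; first by field; lra.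
    have : 1 * r <= b / r * r by rewrite ler_pM2r; lra.
    lra.
  have : b / r * r <= 3 / 2 * r by rewrite ler_pM2r; lra.
  lra.
have : b / r * r <= 1 * r by rewrite ler_pM2r; lra.
rewrite hb mul1r => hbr; apply: PullfOne => //.
Qed.

Lemma pushK : cancel push pull.
Proof.
move=> p; have f1 := pushf_ge1 p; rewrite /pull scaleM.
rewrite -[RHS]scale1; congr scale.
case: (leP (gauge p) (1 / 8)) => h.
  have e := pushf_small h.
  have -> : pullf (scale (pushf p) p) = 1 / 2.
    by rewrite pullf_small // gauge_scale e //; lra.
  by rewrite e; lra.
have hq : 1 / 8 < pushf p * gauge p by nra.
have hq' : 1 / 8 <= gauge (push p) by rewrite gauge_scale ?ltW //; lra.
have e : bound (push p) = bound p by rewrite bound_scale ?ltW //; lra.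
have := pullfP hq'; rewrite e gauge_scale; last lra.
have g0 : gauge p != 0 by lra.
rewrite -/(push p); case: (pushfP (ltW h)) => [-> h1 | f2 h1 h2 | -> h1] [].
- by move=> -> _; lra.
- by move=> f3 h2 h3; apply: (mulIf g0); rewrite -mulrA; lra.
- by move=> *; lra.
- by rewrite f2 => *; lra.
- by rewrite f2 => f3 _ _; apply: (mulIf g0); rewrite -mulrA f2 f3; lra.
- by rewrite f2 => -> h3; apply: (mulIf g0); rewrite mul1r f2; lra.
- by move=> *; lra.
- by move=> *; lra.
- by move=> ->; rewrite mulr1.
Qed.

Lemma pullK : cancel pull push.
Proof.
move=> p; have f0 := pullf_gt0 p; rewrite /push scaleM.
rewrite -[RHS]scale1; congr scale.
case: (leP (gauge p) (1 / 4)) => h.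
  have e := pullf_small h.
  have -> : pushf (scale (pullf p) p) = 2.
    by rewrite pushf_small // gauge_scale e //; lra.
  by rewrite e; lra.
have h8 : 1 / 8 <= gauge p by lra.
have b2 := bound_ge2 p; have g0 : gauge p != 0 by lra.
have hq' : 1 / 8 <= gauge (pull p).
  rewrite gauge_scale ?ltW //.
  by case: (pullfP h8) => [-> | -> | ->] *; lra.
have e : bound (pull p) = bound p.
  by rewrite bound_scale // -gauge_scale // ltW.
have := pushfP hq'; rewrite e gauge_scale; last lra.
rewrite -/(pull p); case: (pullfP h8) => [-> h1 | f2 h1 h2 | -> h1] [].
- by move=> -> _; lra.
- by move=> *; lra.
- by move=> *; lra.
- by rewrite f2 => -> h3; apply: (mulIf g0); rewrite -mulrA f2; lra.
- by rewrite f2 => f3 _ _; apply: (mulIf g0); rewrite -mulrA f2 f3; lra.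
- by rewrite f2 => *; lra.
- by move=> *; lra.
- by move=> f3 h2 h3; apply: (mulIf g0); rewrite mulr1; lra.
- by move=> ->; rewrite mulr1.
Qed.

Lemma pushf_gauge p : gauge p <= 1 -> pushf p * gauge p <= (1 + gauge p) / 2.
Proof.
move=> g1; have g0 := gauge_ge0 p; case: (leP (gauge p) (1 / 8)) => h.
  by rewrite pushf_small //; lra.
have b1 := bound_le1 p; case: (pushfP (ltW h)) => [-> | -> | ->] *; lra.
Qed.

(** A push keeps at least half of the gap 1 - gauge; as (1 + c) / c decreases in c, the bound on the
    factor extends to every c below the gauge. With c = 1 - al and c = 1 - be, it shows that al and
    be are at most halved. *)
Lemma pushf_sub c p : gauge p <= 1 -> 0 <= c <= gauge p ->
  pushf p * c <= (1 + c) / 2.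
Proof.
move=> g1 /andP[c0 cg]; have := pushf_gauge g1.
have := gauge_ge0 p; rewrite le_eqVlt => /orP[/eqP g0|g0 h].
  have c00 : c = 0 by lra.
  by rewrite c00 mulr0; lra.
have : (pushf p * c) * gauge p <= ((1 + c) / 2) * gauge p by nra.
by rewrite ler_pM2r.
Qed.

Lemma push_al_ge p : gauge p <= 1 -> al p / 2 <= al (push p).
Proof.
move=> g1; have f1 := pushf_ge1 p; rewrite al_scale; last lra.
have := @pushf_sub (1 - al p) p g1; rewrite al_gauge subr_ge0 al_le1.
by move=> /(_ isT); lra.
Qed.

Lemma push_be_ge p : gauge p <= 1 -> be p / 2 <= be (push p).
Proof.
move=> g1; have f1 := pushf_ge1 p; rewrite be_scale; last lra.
have := @pushf_sub (1 - be p) p g1; rewrite be_gauge subr_ge0 be_le1.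
by move=> /(_ isT); lra.
Qed.

Lemma push_al_le p : al (push p) <= al p.
Proof.
have f1 := pushf_ge1 p; rewrite al_scale; last lra.
by have := al_le1 p; nra.
Qed.

Lemma push_be_le p : be (push p) <= be p.
Proof.
have f1 := pushf_ge1 p; rewrite be_scale; last lra.
by have := be_le1 p; nra.
Qed.

Lemma pushf1_push p : pushf p = 1 -> push p = p.
Proof. by rewrite /push => ->; rewrite scale1. Qed.

Lemma push_id p : bound p <= gauge p -> push p = p.
Proof.
move=> h; have b2 := bound_ge2 p; apply: pushf1_push.
have h8 : 1 / 8 <= gauge p by lra.
by case: (pushfP h8) => // [|f1 h1 _]; [lra|]; apply: (@mulIf _ (gauge p)); lra.
Qed.

Lemma push_out p : 1 <= gauge p -> push p = p.
Proof. by move=> h; apply: push_id; apply: le_trans h; exact: bound_le1. Qed.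

Lemma push_fix p : push p = p -> p = (0, 0) \/ bound p <= gauge p.
Proof.
move=> e; have := congr1 (@gauge R) e; have f1 := pushf_ge1 p.
rewrite gauge_scale; last lra.
case: (leP (gauge p) (1 / 8)) => h.
  by rewrite pushf_small // => e2; left; apply: gauge_eq0; lra.
move=> e2; right; move: e2; case: (pushfP (ltW h)) => [->|->|_] *; lra.
Qed.

Lemma push_theta_le p : gauge p <= 1 -> theta (push p) <= theta p.
Proof.
move=> g1; have := push_al_le p; have := push_be_le p.
have := push_al_ge g1; have := push_be_ge g1; move: g1.
rewrite gauge_al_be /theta; case: (leP (al p) (be p)) => h; nra.
Qed.

Lemma push_theta_lt p : gauge p < 1 -> push p != p -> theta (push p) < theta p.
Proof.
move=> g1 np; have f1 : 1 < pushf p.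
  rewrite lt_neqAle pushf_ge1 andbT; apply/eqP => /esym/pushf1_push e.
  by rewrite e eqxx in np.
have p0 : 0 < depth p.
  rewrite lt_neqAle /depth le_max normr_ge0 /= andbT; apply/eqP => e.
  have : gauge p = 0.
    move: e; rewrite /gauge /depth; have := normr_ge0 p.1.
    by have := normr_ge0 p.2; case: (leP `|p.1|); lra.
  by move=> /gauge_eq0 e2; move: np; rewrite /push /scale e2 /= !mulr0 eqxx.
have := push_al_ge (ltW g1); have := push_be_ge (ltW g1); move: g1.
have f0 : 0 <= pushf p by lra.
have : al p + be p < 2 by rewrite /al /be; lra.
rewrite gauge_al_be /theta !al_scale ?be_scale //.
have := al_le1 p; have := be_le1 p; set a := al p; set b := be p.
move: f1; set f := pushf p => f1 b1 a1 ab h hb ha.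
have [a0 b0] : 0 < a /\ 0 < b by move: h; case: (leP a b); lra.
(* This expression is exactly the drop of theta, that is, a b - (1 - f (1 - a)) (1 - f (1 - b)). *)
have : 0 < (f - 1) * ((1 - a) * b + (1 - b) * (1 - f * (1 - a))).
  rewrite mulr_gt0 ?subr_gt0 //.
  case: (ltP a 1) => ha1.
    apply: ltr_pwDl; first by rewrite mulr_gt0 ?subr_gt0.
    by rewrite mulr_ge0 ?subr_ge0 //; lra.
  have -> : a = 1 by lra.
  rewrite subrr mul0r add0r mulr0 subr0 mulr1; lra.
nra.
Qed.

End radial_push.

(** * Asymptotics of the orbits *)

Section bowen_map.
Variables (R : realType) (kap L K : R).
Hypotheses (L1 : 1 < L) (K1 : 1 < K) (LK : L * K = kap).
Implicit Types (p q : R * R).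
Let k1 : 1 < kap. Proof. exact: (kap_gt1 L1 K1 LK). Qed.

Definition bowen p : R * R := step kap L K (push kap p).
Definition bowen_inv p : R * R := pull kap (back kap L K p).

Lemma bowenK : cancel bowen bowen_inv.
Proof.
by move=> p; rewrite /bowen /bowen_inv (stepK L1 K1 LK) pushK.
Qed.

Lemma bowen_invK : cancel bowen_inv bowen.
Proof.
by move=> p; rewrite /bowen /bowen_inv pullK // (backK L1 K1 LK).
Qed.

Lemma bowen_continuous : continuous bowen.
Proof.
move=> p; apply: (@continuous_comp _ _ _ (push kap) (step kap L K)).
  exact: push_continuous.
exact: (step_continuous L1 K1 LK).
Qed.

Lemma bowen_inv_continuous : continuous bowen_inv.
Proof.
move=> p; apply: (@continuous_comp _ _ _ (back kap L K) (pull kap)).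
  exact: (back_continuous L1 K1 LK).
exact: pull_continuous.
Qed.

Lemma half_coord (J J' : R) p : 1 < J -> 1 < J' -> J * J' = kap ->
  exists2 c, 0 < c & al (half kap J J' p) = al p * c /\
                     be (half kap J J' p) = be p / c.
Proof.
move=> J1 J1' JJ; have [a1 b1] := half_le1 J1 J1' JJ p.
have s1 := speed_ge1 kap (theta p) J1.
exists (stretch kap J J' (theta p) (be p) / speed kap J (theta p)).
  rewrite divr_gt0 //; last lra.
  rewrite /stretch divr_gt0 ?lt_max ?ltr01 // (land_gt0 J1 J1') //.
  by rewrite ge_max s1 ler_piMr ?be_le1 //; lra.
rewrite /half al_pt // be_pt //; move: (stretch _ _ _ _ _) => M.
split; first by rewrite mulrA.
by rewrite invf_div mulrA.
Qed.

(** A positive factor preserves the signs of al and be, hence V, its closure and their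
    complements. *)
Lemma step_coord p : exists2 c, 0 < c & al (step kap L K p) = al p * c /\
                     be (step kap L K p) = be p / c.
Proof.
rewrite /step; case: ifP => _; first exact: half_coord.
have KL : K * L = kap by rewrite mulrC.
have [c c0 [e1 e2]] := half_coord (rot p) K1 L1 KL.
exists c^-1; first by rewrite invr_gt0.
by rewrite al_rot be_rot e1 e2 al_rot be_rot invrK.
Qed.

Lemma gauge_lt1 p : (gauge p < 1) = (0 < al p) && (0 < be p).
Proof. by rewrite gauge_al_be gtrBl lt_min. Qed.

Lemma gauge_le1 p : (gauge p <= 1) = (0 <= al p) && (0 <= be p).
Proof. by rewrite gauge_al_be gerBl le_min. Qed.

Lemma step_gauge_lt1 p : (gauge (step kap L K p) < 1) = (gauge p < 1).
Proof.
have [c c0 [e1 e2]] := step_coord p.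
by rewrite !gauge_lt1 e1 e2 pmulr_lgt0 // pmulr_lgt0 // invr_gt0.
Qed.

Lemma step_gauge_le1 p : (gauge (step kap L K p) <= 1) = (gauge p <= 1).
Proof.
have [c c0 [e1 e2]] := step_coord p.
by rewrite !gauge_le1 e1 e2 pmulr_lge0 // pmulr_lge0 // invr_gt0.
Qed.

Lemma push_gauge_lt1 p : gauge p < 1 -> gauge (push kap p) < 1.
Proof.
move=> h; have := push_al_ge k1 (ltW h); have := push_be_ge k1 (ltW h).
by move: h; rewrite !gauge_lt1 => /andP[? ?] ? ?; apply/andP; split; lra.
Qed.

Lemma push_gauge_le1 p : gauge p <= 1 -> gauge (push kap p) <= 1.
Proof.
move=> h; have := push_al_ge k1 h; have := push_be_ge k1 h.
by move: h; rewrite !gauge_le1 => /andP[? ?] ? ?; apply/andP; split; lra.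
Qed.

Lemma bowen_gauge_lt1 p : gauge p < 1 -> gauge (bowen p) < 1.
Proof. by move=> h; rewrite step_gauge_lt1 push_gauge_lt1. Qed.

Lemma bowen_gauge_le1 p : gauge p <= 1 -> gauge (bowen p) <= 1.
Proof. by move=> h; rewrite step_gauge_le1 push_gauge_le1. Qed.

Lemma bowen_theta p : theta (bowen p) = theta (push kap p).
Proof. exact: (theta_step L1 K1 LK). Qed.

Lemma bowen_theta_le p : gauge p <= 1 -> theta (bowen p) <= theta p.
Proof. by move=> h; rewrite bowen_theta push_theta_le. Qed.

Lemma bowen0 : bowen (0, 0) = (0, 0).
Proof.
rewrite /bowen; have -> : push kap (0, 0) = (0, 0).
  by rewrite /push /scale /= !mulr0.
have a0 : al ((0, 0) : R * R) = 1.
  by rewrite /al /depth /= normr0 mul0r add0r maxxx !subr0.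
have b0 : be ((0, 0) : R * R) = 1.
  by rewrite /be /depth /= normr0 mul0r add0r maxxx subr0 addr0.
have z0 : theta ((0, 0) : R * R) = 1 by rewrite /theta a0 b0 mulr1.
have s0 : speed kap L 1 = 1.
  by rewrite /speed rate0 ?mulr0 ?addr0 // mulr1 exprn_ege1 // ltW.
rewrite /step lexx half_stay z0 s0 ?mul1r ?be_le1 // a0 b0 divr1 mulr1.
rewrite /pt maxxx; congr pair; last by lra.
by case: leP => _; lra.
Qed.

Lemma iter_bowen_neq0 n p : p <> (0, 0) -> iter n bowen p <> (0, 0).
Proof.
move=> p0; elim: n => //= n IH e; apply: IH.
by rewrite -(bowenK (iter n bowen p)) e -{1}bowen0 bowenK.
Qed.

Lemma iter_bowen_gauge n p : gauge p < 1 -> gauge (iter n bowen p) < 1.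
Proof. by move=> h; elim: n => //= n /bowen_gauge_lt1. Qed.

Lemma theta_lt1 p : gauge p < 1 -> p <> (0, 0) -> theta p < 1.
Proof.
move=> g1 p0; have := al_le1 p; have := be_le1 p.
have : al p + be p < 2.
  suff : 0 < depth p by rewrite /al /be; lra.
  rewrite lt_neqAle /depth le_max normr_ge0 /= andbT; apply/eqP => e.
  apply: p0; apply: gauge_eq0; move: e; rewrite /gauge /depth.
  have := normr_ge0 p.1; have := normr_ge0 p.2.
  by case: (leP `|p.1|); lra.
by move: g1; rewrite gauge_lt1 /theta => /andP[]; nra.
Qed.

Lemma theta_gt0 p : gauge p < 1 -> 0 < theta p.
Proof. by rewrite gauge_lt1 => /andP[a b]; rewrite mulr_gt0. Qed.

Lemma theta_gauge p : gauge p <= 1 -> theta p <= 1 - gauge p.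
Proof.
have := al_le1 p; have := be_le1 p.
by rewrite gauge_al_be /theta; case: (leP (al p) (be p)); nra.
Qed.

Lemma fix_small p : gauge p < 1 -> bound kap p <= gauge p ->
  2 * kap ^+ 2 * theta p <= 1 /\ 4 * kap * `|p.2| < 1.
Proof.
move=> g1 bg; have b := bound_ge k1 p; have b2 := bound_ge2 k1 p.
have k0 : 0 < kap by move: k1; lra.
have k2 : 0 < kap ^+ 2 by rewrite exprn_gt0.
split.
  have : theta p <= (2 * kap ^+ 2)^-1 by have := theta_gauge (ltW g1); lra.
  by rewrite -div1r ler_pdivlMr ?mulr_gt0 //; lra.
rewrite ltNge; apply/negP => h; have g0 : gauge' p = gauge p.
  by rewrite /gauge' max_l //; lra.
suff : bound kap p = 1 by lra.
rewrite /bound max_l ?mulr0 ?subr0 // g0 subr_le0 ler_pdivlMr; last lra.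
by rewrite mul1r (le_trans (ltW g1)).
Qed.

End bowen_map.

Lemma exprn_unbounded (R : realType) (L x : R) : 1 < L -> exists n, x < L ^+ n.
Proof.
move=> L1; have l0 : 0 < L - 1 by lra.
exists (Num.bound (`|x| / (L - 1))).
have : `|x| / (L - 1) < (Num.bound (`|x| / (L - 1)))%:R.
  by apply: archi_boundP; rewrite divr_ge0 // ltW.
set n := Num.bound _; rewrite ltr_pdivrMr // => h.
apply: (le_lt_trans (ler_norm x)); apply: (lt_le_trans h).
elim: (n) => [|k IH]; first by rewrite mul0r expr0.
suff bern : forall k, 1 + k%:R * (L - 1) <= L ^+ k.
  by have := bern k.+1; lra.
elim=> [|j IHj]; first by rewrite mul0r addr0 expr0.
have j0 : 0 <= j%:R :> R by [].
have h1 : L * (1 + j%:R * (L - 1)) <= L * L ^+ j by rewrite ler_pM2l //; lra.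
have : 0 <= j%:R * (L - 1) * (L - 1) by rewrite !mulr_ge0 // ltW.
by rewrite exprS -natr1; lra.
Qed.

(** * Strict decrease of theta along orbits of V *)

Section increase.
Variables (R : realType) (kap : R).
Implicit Types (p q : R * R) (L K : R).

Lemma bowen_rot L K p : 1 < L -> 1 < K -> L * K = kap ->
  bowen kap K L (rot p) = rot (bowen kap L K p).
Proof.
move=> L1 K1 LK; rewrite /bowen -(step_rot L1 K1 LK); congr step.
rewrite /push /scale /pushf /bound /gauge' /gauge depth_rot /rot /= normrN.
by rewrite !mulrN.
Qed.

(** While [push] fixes the orbit, theta is constant and the speed is L. A crossing is impossible: L
    be > 1 gives kap be > 1, so kap al < 1 / 2 because theta is small, and be - al = 2 y exceeds 1 /
    (2 kap), against the bound on |y|. So be is multiplied by L forever, although it is at most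
    1. *)
Lemma no_eternal_fix L K p : 1 < L -> 1 < K -> L * K = kap ->
  gauge p < 1 -> p.1 <= 0 ->
  ~ (forall n, push kap (iter n (bowen kap L K) p) = iter n (bowen kap L K) p
     /\ bound kap (iter n (bowen kap L K) p) <= gauge (iter n (bowen kap L K) p)).
Proof.
move=> L1 K1 LK g1 p0 fixn; set f := bowen kap L K in fixn.
have k1 : 1 < kap by exact: (kap_gt1 L1 K1 LK).
have gn n : gauge (iter n f p) < 1 by exact: iter_bowen_gauge.
have zn n : theta (iter n f p) = theta p.
  elim: n => //= n <-; rewrite (bowen_theta L1 K1 LK).
  by have [-> _] := fixn n.
have small n : 2 * kap ^+ 2 * theta p <= 1 /\ 4 * kap * `|(iter n f p).2| < 1.
  by rewrite -(zn n); apply: (fix_small L1 K1 LK) => //; have [] := fixn n.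
have [z1 _] := small 0%N.
have sp : speed kap L (theta p) = L by exact: speedE.
have stay n : (iter n f p).1 <= 0 -> L * be (iter n f p) <= 1.
  move=> n0; have [_ y1] := small n; rewrite leNgt; apply/negP => h.
  have kL := L_le_kap L1 K1 LK.
  have := zn n; rewrite /theta in z1 *; move: z1; rewrite -/(theta p) => z1.
  set a := al _; set b := be _ in h *; move=> ab.
  have hba : b - a <= 2 * `|(iter n f p).2|.
    by rewrite /a /b /al /be; have := ler_norm (iter n f p).2; lra.
  have kab : 2 * kap ^+ 2 * (a * b) <= 1 by rewrite ab.
  have a0 : 0 < a by have := gn n; rewrite gauge_lt1 => /andP[].
  have b0 : 0 < b by have := gn n; rewrite gauge_lt1 => /andP[].
  have h1 : 2 * kap * a < 1.
    have : 2 * kap * a * (kap * b) <= 1 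
      by have <- : 2 * kap ^+ 2 * (a * b) = 2 * kap * a * (kap * b) by ring.
    have : 1 < kap * b by nra.
    have : 0 < 2 * kap * a by rewrite !mulr_gt0 //; lra.
    nra.
  have h2 : 2 * kap * (b - a) < 1.
    have : 2 * kap * (b - a) <= 2 * kap * (2 * `|(iter n f p).2|).
      by rewrite ler_pM2l // mulr_gt0 //; lra.
    lra.
  have : 2 * (kap * b) < 2 by lra.
  have : L * b <= kap * b by rewrite ler_wpM2r // ltW.
  lra.
have left n : (iter n f p).1 <= 0 /\ be (iter n f p) = L ^+ n * be p.
  elim: n => [|n [IH1 IH2]]; first by rewrite expr0 mul1r.
  have h := stay n IH1; have [fx _] := fixn n.
  have e : iter n.+1 f p = pt false (al (iter n f p) / L) (be (iter n f p) * L).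
    rewrite iterS /f /bowen fx /step IH1 half_stay zn sp //.
  have a1 : al (iter n f p) / L <= 1.
    by rewrite ler_pdivrMr ?(le_trans (al_le1 _)) //; lra.
  have b1 : be (iter n f p) * L <= 1 by rewrite mulrC.
  by rewrite e pt_false_fst // be_pt // IH2 exprS mulrC -mulrA.
have b0 : 0 < be p by have := g1; rewrite gauge_lt1 => /andP[].
have bound n : L ^+ n <= (be p)^-1.
  have [_ e] := left n; have := be_le1 (iter n f p).
  by rewrite e -ler_pdivlMr // div1r.
have [n hn] := exprn_unbounded (be p)^-1 L1.
by have := bound n; rewrite leNgt hn.
Qed.

(** If theta never dropped, strictness of [push_theta_lt] would make every iterate a fixed point of
    [push]. On the right half plane the contradiction is transported by [rot]. *)
Lemma theta_decreases L K p : 1 < L -> 1 < K -> L * K = kap ->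
  gauge p < 1 -> p <> (0, 0) ->
  exists n, theta (iter n (bowen kap L K) p) < theta p.
Proof.
move=> L1 K1 LK g1 p0; have k1 : 1 < kap by exact: (kap_gt1 L1 K1 LK).
apply: contrapT => no_n; set f := bowen kap L K in no_n.
have gn n : gauge (iter n f p) < 1 by exact: iter_bowen_gauge.
have fixn n : push kap (iter n f p) = iter n f p /\
    bound kap (iter n f p) <= gauge (iter n f p).
  have e : push kap (iter n f p) = iter n f p.
    apply: contrapT => /eqP ne; apply: no_n; exists n.+1.
    rewrite iterS (bowen_theta L1 K1 LK).
    apply: (lt_le_trans (push_theta_lt k1 (gn n) ne)).
    elim: {ne} n => //= n; apply: le_trans.
    by rewrite (bowen_theta_le L1 K1 LK) // ltW.
  split=> //; case: (push_fix k1 e) => // e0.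
  by have := iter_bowen_neq0 L1 K1 LK (n := n) p0.
case: (leP p.1 0) => px; first exact: (no_eternal_fix L1 K1 LK g1 px).
have KL : K * L = kap by rewrite mulrC.
have qx : (rot p).1 <= 0 by rewrite /=; lra.
have gr q : gauge (rot q) = gauge q by rewrite /gauge depth_rot /= normrN.
have gq : gauge (rot p) < 1 by rewrite gr.
apply: (no_eternal_fix K1 L1 KL gq qx) => n.
have -> : iter n (bowen kap K L) (rot p) = rot (iter n f p).
  by elim: n => //= n ->; rewrite (bowen_rot _ L1 K1 LK).
have [e1 e2] := fixn n; rewrite gr; split.
  rewrite -[X in _ = rot X]e1 /push /scale /pushf /bound /gauge' gr /rot /=.
  by rewrite normrN !mulrN.
by move: e2; rewrite /bound /gauge' gr /= normrN.
Qed.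

End increase.

(** * Limits of forward and backward orbits *)

Section lasalle.
Variable R : realType.

Lemma cluster_value (T : topologicalType) (u : nat -> T) (h : T -> R)
    (q : T) (c : R) :
  continuous h -> h (u n) @[n --> \oo] --> c ->
  cluster (u n @[n --> \oo]) q -> h q = c.
Proof.
move=> ch cu clq; apply: contrapT => /eqP ne.
have e0 : 0 < `|h q - c| / 2 by rewrite divr_gt0 // normr_gt0 subr_eq0.
have [x []] := clq [set x | `|c - h x| < `|h q - c| / 2]
  [set x | `|h q - h x| < `|h q - c| / 2]
  (@cvgr_dist_lt _ _ _ _ _ _ _ cu _ e0) (@cvgr_dist_lt _ _ _ _ _ _ _ (ch q) _ e0).
move=> /= h1 h2; have := ler_distD (h x) (h q) c; rewrite (distrC (h x) c); lra.
Qed.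

Lemma closed_ge (T : topologicalType) (h : T -> R) (c : R) :
  continuous h -> closed [set p | c <= h p].
Proof.
move=> ch; have -> : [set p | c <= h p] = h @^-1` [set x | c <= x] by [].
by apply: closed_comp => [x _|]; [exact: ch | exact: closed_ge].
Qed.

Lemma closed_le (T : topologicalType) (h : T -> R) (c : R) :
  continuous h -> closed [set p | h p <= c].
Proof.
move=> ch; have -> : [set p | h p <= c] = h @^-1` [set x | x <= c] by [].
by apply: closed_comp => [x _|]; [exact: ch | exact: closed_le].
Qed.

Lemma fst_gauge (p : R * R) : `|p.1| <= gauge p.
Proof.
by rewrite (@le_trans _ _ (depth p)) ?lerDl // le_max lexx.
Qed.

Lemma snd_gauge (p : R * R) : `|p.2| <= gauge p.
Proof. by rewrite /gauge /depth lerDr le_max normr_ge0. Qed.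

Lemma compact_gauge_theta (l : R) :
  compact [set p : R * R | gauge p <= 1 /\ l <= theta p].
Proof.
have -> : [set p : R * R | gauge p <= 1 /\ l <= theta p] =
    ([set` `[(-1 : R), 1]] `*` [set` `[(-1 : R), 1]]) `&`
    ([set p | gauge p <= 1] `&` [set p | l <= theta p]).
  apply/seteqP; split=> [p [/= g z]|p [/= _ [g z]]] //.
  split=> //=; rewrite !in_itv /= -!ler_norml.
  by split; [exact: le_trans (fst_gauge p) g | exact: le_trans (snd_gauge p) g].
apply: compact_closedI.
  by apply: compact_setX; exact: segment_compact.
apply: closedI; [apply: closed_le | apply: closed_ge].
  exact: gauge_continuous.
exact: theta_continuous.
Qed.

Variables (kap L K : R).
Hypotheses (L1 : 1 < L) (K1 : 1 < K) (LK : L * K = kap).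
Local Notation f := (bowen kap L K).
Local Notation g := (bowen_inv kap L K).

(* LaSalle's invariance principle for the Lyapunov function theta: along a
   cluster point theta is constant, which only the source allows. *)
Lemma cluster_source (u : nat -> R * R) (q : R * R) (l : R) :
  (forall k, theta (iter k f (u n)) @[n --> \oo] --> l) ->
  gauge q < 1 -> cluster (u n @[n --> \oo]) q -> q = (0, 0).
Proof.
move=> cu gq clq; apply: contrapT => q0.
have e k : theta (iter k f q) = l.
  apply: (@cluster_value _ u (fun x => theta (iter k f x)) q l) => //.
  move=> x; apply: (@continuous_comp _ _ _ (iter k f) (@theta R)); last first.
    exact: theta_continuous.
  elim: k x => [|k IH] x; first exact: cvg_id.
  by apply: continuous_comp; [exact: IH | exact: (bowen_continuous L1 K1 LK)].
have [n] := theta_decreases L1 K1 LK gq q0.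
by rewrite e -(e 0%N) ltxx.
Qed.

(** With a positive limit l, the orbit would stay in the compact part theta >= l of V and accumulate
    at the source. But theta is 1 at the source and already less than 1 at y. *)
Lemma theta_cvg0 y : gauge y < 1 -> y <> (0, 0) ->
  theta (iter n f y) @[n --> \oo] --> 0.
Proof.
move=> gy y0; have gn n : gauge (iter n f y) < 1 by exact: iter_bowen_gauge.
have dec : nonincreasing_seq (fun n => theta (iter n f y)).
  apply/nonincreasing_seqP => n /=.
  by apply: (bowen_theta_le L1 K1 LK); exact: ltW.
have lb : has_lbound (range (fun n => theta (iter n f y))).
  by exists 0 => _ [n _ <-]; exact/ltW/theta_gt0.
have cv := nonincreasing_cvgn dec lb.
set l := inf _ in cv.
have ln n : l <= theta (iter n f y).
  by apply: ge_inf => //; exists n.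
have l0 : 0 <= l by apply: lb_le_inf; [exists (theta y); exists 0%N | case: lb
  => _ _ _ [n _ <-]; exact/ltW/theta_gt0].
suff <- : l = 0 by [].
apply: le_anti; rewrite l0 andbT leNgt; apply/negP => lpos.
have [q [[gq zq] clq]] : [set p : R * R | gauge p <= 1 /\ l <= theta p] `&`
    cluster (iter n f y @[n --> \oo]) !=set0.
  apply: compact_gauge_theta.
  have : \forall n \near \oo, gauge (iter n f y) <= 1 /\ l <= theta (iter n f y).
    by near=> n; split; [exact: (ltW (gn n)) | exact: ln].
  by [].
have gq1 : gauge q < 1.
  move: gq; rewrite gauge_le1 gauge_lt1 => /andP[a0 b0].
  have : 0 < theta q by apply: lt_le_trans zq.
  rewrite /theta; move: a0; rewrite le_eqVlt => /orP[/eqP <-|a0].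
    by rewrite mul0r ltxx.
  by rewrite a0 /= pmulr_rgt0.
have q0 : q = (0, 0).
  apply: (@cluster_source (fun n => iter n f y) q l) => // k.
  have -> : (fun n => theta (iter k f (iter n f y))) =
      (fun n => theta (iter (n + k) f y)).
    by apply/funext => n; rewrite addnC iterD.
  by rewrite (cvg_shiftn k (fun n => theta (iter n f y))).
have : theta q <= theta y.
  have -> : theta q = l.
    apply: (@cluster_value _ (fun n => iter n f y) (@theta R)) => //.
    exact: theta_continuous.
  exact: ln 0%N.
have := theta_lt1 gy y0; rewrite q0 /theta /al /be /depth /=.
rewrite normr0 mul0r add0r maxxx; lra.
Unshelve. all: by end_near. Qed.

Lemma bowen_inv_gauge_lt1 y : gauge y < 1 -> gauge (g y) < 1.
Proof.
have k1 : 1 < kap by exact: (kap_gt1 L1 K1 LK).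
have gr q : gauge (refl q) = gauge q by rewrite /gauge depth_refl /= normrN.
move=> gy; rewrite /bowen_inv /pull gauge_scale; last first.
  exact/ltW/pullf_gt0.
have : gauge (back kap L K y) < 1.
  by rewrite /back gr (step_gauge_lt1 L1 K1 LK) gr.
apply: le_lt_trans; rewrite ler_piMl ?gauge_ge0 //.
by rewrite /pullf ge_min lexx.
Qed.

Lemma iter_bowen_inv_gauge n y : gauge y < 1 -> gauge (iter n g y) < 1.
Proof. by move=> gy; elim: n => //= n /bowen_inv_gauge_lt1. Qed.

Lemma iter_bowenK k n y : iter k f (iter (n + k) g y) = iter n g y.
Proof.
elim: k => [|k IH]; first by rewrite addn0.
by rewrite iterSr addnS iterS (bowen_invK L1 K1 LK).
Qed.

(** Backward in time theta increases to a positive limit, which keeps the cluster points off the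
    boundary of V; [cluster_source] then leaves only the source, and compactness provides a cluster
    point. *)
Lemma cluster_bowen_inv y : gauge y < 1 ->
  cluster (iter n g y @[n --> \oo]) = [set (0, 0)].
Proof.
move=> gy; have gn n : gauge (iter n g y) < 1 by exact: iter_bowen_inv_gauge.
have inc : nondecreasing_seq (fun n => theta (iter n g y)).
  apply/nondecreasing_seqP => n /=.
  rewrite -[in X in X <= _](bowen_invK L1 K1 LK (iter n g y)).
  by apply: (bowen_theta_le L1 K1 LK); exact: (ltW (gn n.+1)).
have ub : has_ubound (range (fun n => theta (iter n g y))).
  by exists 1 => _ [n _ <-]; apply: theta_le1; exact: ltW.
have cv := nondecreasing_cvgn inc ub.
set l := sup _ in cv.
have cl0 q : gauge q < 1 -> cluster (iter n g y @[n --> \oo]) q -> q = (0, 0).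
  apply: (@cluster_source (fun n => iter n g y) q l) => // k.
  rewrite -(cvg_shiftn k).
  have -> : (fun n => theta (iter k f (iter (n + k) g y))) =
      (fun n => theta (iter n g y)).
    by apply/funext => n; rewrite iter_bowenK.
  exact: cv.
have in_ball q : cluster (iter n g y @[n --> \oo]) q -> gauge q < 1.
  move=> clq; have zl : theta q = l.
    apply: (@cluster_value _ (fun n => iter n g y) (@theta R)) => //.
    exact: theta_continuous.
  have z0 : 0 < theta q.
    rewrite zl; apply: (lt_le_trans (theta_gt0 gy)).
    by apply: ub_le_sup => //; exists 0%N.
  have [al0 be0] : 0 <= al q /\ 0 <= be q.
    have clge (h : R * R -> R) : continuous h ->
        (forall n, 0 <= h (iter n g y)) -> 0 <= h q.
      move=> ch hn; rewrite leNgt; apply/negP => hq.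
      have n0 : 0 < - h q by rewrite oppr_gt0.
      have Fr : \forall n \near \oo, range (fun n => iter n g y) (iter n g y).
        by near=> n; exists n.
      have [x [[n _ <-] /= B]] := clq (range (fun n => iter n g y))
        [set x | `|h q - h x| < - h q]
        Fr
        (@cvgr_dist_lt _ _ _ _ _ _ _ (ch q) _ n0).
      move: B; rewrite ltr_norml => /andP[B _]; have := hn n; lra.
    split; apply: clge => [|n]; try exact: al_continuous;
      try exact: be_continuous; have := gn n; rewrite gauge_lt1 => /andP[a b];
      exact: ltW.
  rewrite gauge_lt1; move: z0; rewrite /theta.
  move: al0; rewrite le_eqVlt => /orP[/eqP <-|a0].
    by rewrite mul0r ltxx.
  by rewrite a0 /= pmulr_rgt0.
apply/seteqP; split=> [q clq | _ ->] /=; first exact: cl0 (in_ball _ clq) clq.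
have [q [_ clq]] : [set p : R * R | gauge p <= 1 /\ 0 <= theta p] `&`
    cluster (iter n g y @[n --> \oo]) !=set0.
  apply: compact_gauge_theta.
  have : \forall n \near \oo, gauge (iter n g y) <= 1 /\ 0 <= theta (iter n g y).
    by near=> n; split; [exact: (ltW (gn n)) | exact/ltW/theta_gt0].
  by [].
by rewrite -(cl0 _ (in_ball _ clq) clq).
Unshelve. all: by end_near. Qed.

End lasalle.

(** * Time averages *)

Section averages.
Variable R : realType.
Implicit Types (a b W : nat -> R) (S C : nat -> bool).

Definition eventually_nat (P : nat -> Prop) : Prop :=
  exists n0, forall n, (n0 <= n)%N -> P n.

(** Convergence of the Cesaro means to 0, cleared of the division by n. *)
Definition null_mean a : Prop := forall e : R, 0 < e ->
  eventually_nat (fun n => `|\sum_(j < n) a j| <= e * n%:R).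

Lemma eventually_and (P Q : nat -> Prop) : eventually_nat P ->
  eventually_nat Q -> eventually_nat (fun n => P n /\ Q n).
Proof.
move=> [n hn] [m hm]; exists (maxn n m) => k; rewrite geq_max => /andP[nk mk].
by split; [exact: hn | exact: hm].
Qed.

Lemma eventually_impl (P Q : nat -> Prop) : (forall n, P n -> Q n) ->
  eventually_nat P -> eventually_nat Q.
Proof. by move=> PQ [n hn]; exists n => m /hn /PQ. Qed.

Lemma eventually_ge (x : R) : eventually_nat (fun n => x <= n%:R).
Proof.
exists (Num.bound `|x|) => n hn; apply: (le_trans (ler_norm x)).
apply: (le_trans (ltW (archi_boundP (normr_ge0 x)))).
by rewrite ler_nat.
Qed.

Lemma sum_le_drift a W n0 : (forall n, (n0 <= n)%N -> a n <= W n.+1 - W n) ->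
  forall n, (n0 <= n)%N ->
  \sum_(j < n) a j - \sum_(j < n0) a j <= W n - W n0.
Proof.
move=> h; elim=> [|n IH].
  by rewrite leqn0 => /eqP ->; rewrite !subrr.
rewrite leq_eqVlt => /orP[/eqP <-|]; first by rewrite !subrr.
rewrite ltnS => le_n0; have := IH le_n0; have := h n le_n0.
by rewrite big_ord_recr /=; lra.
Qed.

(* A bounded error on finitely many terms is absorbed by e * n. *)
Lemma null_mean_bound a (b : R -> nat -> R) :
  (forall e, 0 < e -> null_mean (b e)) ->
  (forall e, 0 < e -> eventually_nat (fun n => `|a n| <= e + b e n)) ->
  null_mean a.
Proof.
move=> nb ab e0 e0_gt0.
have [e e3 ->] : exists2 e, 0 < e & e0 = 3 * e by exists (e0 / 3); lra.
have [n0 h0] := ab _ e3; have [n1 h1] := nb _ e3 _ e3.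
pose c := `|\sum_(j < n0) (`|a j|) | + `|\sum_(j < n0) (e + b e j)|.
have [n2 h2] := eventually_ge (c / e).
exists (maxn n0 (maxn n1 n2)) => n; rewrite !geq_max => /and3P[l0 l1 l2].
have step m : (n0 <= m)%N -> `|a m| <= \sum_(j < m.+1) (e + b e j) -
    \sum_(j < m) (e + b e j).
  by move=> /h0; rewrite big_ord_recr /= addrAC subrr add0r.
have := @sum_le_drift (fun j => `|a j|)
  (fun n => \sum_(j < n) (e + b e j)) n0 step _ l0.
rewrite {1}big_split /= sumr_const card_ord -mulr_natr => acc.
have := h1 n l1; have := h2 n l2; rewrite ler_pdivrMr // => hc hb.
have := ler_norm (\sum_(j < n) b e j).
have := ler_norm (\sum_(j < n0) `|a j|).
have := ler_norm (- \sum_(j < n0) (e + b e j)); rewrite normrN.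
have : `|\sum_(j < n) a j| <= \sum_(j < n) `|a j| by exact: ler_norm_sum.
move: acc hc; rewrite /c; lra.
Qed.

Lemma null_mean_le a b : null_mean b ->
  eventually_nat (fun n => `|a n| <= b n) -> null_mean a.
Proof.
move=> nb ab; apply: (@null_mean_bound a (fun _ => b)) => // e e0.
by apply: eventually_impl ab => n /= h; lra.
Qed.

Lemma null_meanD a b : null_mean a -> null_mean b ->
  null_mean (fun n => a n + b n).
Proof.
move=> na nb e e0; have e2 : 0 < e / 2 by lra.
apply: eventually_impl (eventually_and (na _ e2) (nb _ e2)) => n [h1 h2].
rewrite big_split /=; apply: (le_trans (ler_normD _ _)); lra.
Qed.

Lemma null_meanZ a (c : R) : null_mean a -> null_mean (fun n => c * a n).
Proof.
move=> na e e0; have e2 : 0 < e / (`|c| + 1).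
  by rewrite divr_gt0 // ltr_wpDl.
apply: eventually_impl (na _ e2) => n h1.
rewrite -mulr_sumr normrM.
have c0 := normr_ge0 c.
apply: (@le_trans _ _ (`|c| * (e / (`|c| + 1) * n%:R))).
  by rewrite ler_wpM2l.
rewrite mulrA ler_wpM2r // mulrCA ler_piMr ?(ltW e0) //.
by rewrite ler_pdivrMr ?ltr_wpDl // mul1r lerDl.
Qed.

Definition sublinear W : Prop := forall e : R, 0 < e ->
  eventually_nat (fun n => `|W n| <= e * n%:R).

Lemma null_mean_telescope W : sublinear W ->
  null_mean (fun n => W n.+1 - W n).
Proof.
move=> sW e e0; have e2 : 0 < e / 2 by lra.
have [n0 h0] := sW _ e2; have [n1 h1] := eventually_ge (`|W 0%N| / (e / 2)).
exists (maxn n0 n1) => n; rewrite geq_max => /andP[l0 l1].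
have -> : \sum_(j < n) (W j.+1 - W j) = W n - W 0%N.
  by rewrite -(telescope_sumr (n := 0%N) (m := n) W) // big_mkord.
have := h0 n l0; have := h1 n l1; rewrite ler_pdivrMr //.
by have := ler_normB (W n) (W 0%N); lra.
Qed.

Lemma sublinear_drift W a : (forall n, 0 <= W n) -> null_mean a ->
  eventually_nat (fun n => W n.+1 - W n <= a n) -> sublinear W.
Proof.
move=> W0 na [n0 h] e e0; have e2 : 0 < e / 2 by lra.
have [n1 h1] := na _ e2.
pose c := `|W n0| + `|\sum_(j < n0) a j|.
have [n2 h2] := eventually_ge (c / (e / 2)).
exists (maxn n0 (maxn n1 n2)) => n; rewrite !geq_max => /and3P[l0 l1 l2].
have step m : (n0 <= m)%N -> - a m <= - W m.+1 - - W m by move=> /h; lra.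
have := @sum_le_drift (fun j => - a j) (fun n => - W n) n0 step _ l0.
rewrite !sumrN => acc; rewrite ger0_norm //.
have := h1 n l1; have := h2 n l2; rewrite ler_pdivrMr // /c.
have := ler_norm (\sum_(j < n) a j); have := ler_norm (W n0).
have := ler_norm (- \sum_(j < n0) a j); rewrite normrN; lra.
Qed.

Definition null_density S : Prop := null_mean (fun n => (S n)%:R).

Lemma null_density_or S C : null_density S -> null_density C ->
  null_density (fun n => S n || C n).
Proof.
move=> nS nC; apply: null_mean_le (null_meanD nS nC) _; exists 0%N => n _.
by rewrite normr_nat -natrD ler_nat; case: (S n); case: (C n).
Qed.

(** The bounded potential W gains d at each time of S and loses at most c at each time of C, so S is
    at most c / d times as frequent as C. *)
Lemma null_density_potential S C W (M d c : R) : 0 < d -> null_density C ->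
  (forall n, `|W n| <= M) ->
  eventually_nat (fun n => d * (S n)%:R - c * (C n)%:R <= W n.+1 - W n) ->
  null_density S.
Proof.
move=> d0 nC WM [n0 h] e e0.
pose q := `|c| / d + 1.
have q0 : 0 < q by rewrite ltr_wpDl // divr_ge0 // ltW.
have e2 : 0 < e / (2 * q) by rewrite divr_gt0 // mulr_gt0.
have [n1 h1] := nC _ e2.
pose b := `|\sum_(j < n0) (d * (S j)%:R - c * (C j)%:R)| + 2 * M.
have [n2 h2] := eventually_ge (b / d / (e / 2)).
exists (maxn n0 (maxn n1 n2)) => n; rewrite !geq_max => /and3P[l0 l1 l2].
have := sum_le_drift h l0; rewrite sumrB -!mulr_sumr => acc.
have := h1 n l1; have := h2 n l2.
have S0 : 0 <= \sum_(j < n) (S j)%:R :> R by apply: sumr_ge0.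
have C0 : 0 <= \sum_(j < n) (C j)%:R :> R by apply: sumr_ge0.
rewrite !ger0_norm //.
rewrite ler_pdivrMr ?divr_gt0 // ler_pdivrMr // => hb hC.
have := WM n; have := WM n0; rewrite !ler_norml => /andP[w1 w2] /andP[w3 w4].
have hs := ler_norm (\sum_(j < n0) (d * (S j)%:R - c * (C j)%:R)).
rewrite -(ler_pM2l d0).
have hc : c * \sum_(j < n) (C j)%:R <= d * (e / 2 * n%:R).
  apply: (@le_trans _ _ (`|c| * (e / (2 * q) * n%:R))).
    apply: (@le_trans _ _ (`|c| * \sum_(j < n) (C j)%:R)).
      by rewrite ler_wpM2r // ler_norm.
    by rewrite ler_wpM2l.
  have -> : `|c| * (e / (2 * q) * n%:R) = (`|c| / q) * (e / 2 * n%:R).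
    by field; rewrite gt_eqF.
  rewrite ler_wpM2r ?mulr_ge0 //; first by lra.
  rewrite ler_pdivrMr // /q mulrDr mulr1 mulrC divfK ?gt_eqF //; lra.
move: hb; rewrite /b; lra.
Qed.

End averages.

(** * Logarithmic clocks and their change in one step *)

Section one_step.
Variables (R : realType) (kap : R).
Implicit Types (p q : R * R) (t L K : R).

(* The number of steps since the last crossing between the half planes and until
   the next one, up to a bounded error. *)
Definition age t p : R :=
  if p.1 <= 0 then - t * ln (al p) else - (1 - t) * ln (be p).
Definition wait t p : R :=
  if p.1 <= 0 then - t * ln (be p) else - (1 - t) * ln (al p).
Definition crosses L K p : bool :=
  (p.1 <= 0) != ((bowen kap L K p).1 <= 0).
Definition height p : R := - ln (theta p).

Lemma push_fst p : 1 < kap -> ((push kap p).1 <= 0) = (p.1 <= 0).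
Proof.
move=> k1; have := pushf_ge1 kap p => f1.
by rewrite /push /scale /= pmulr_rle0 //; lra.
Qed.

Lemma ln_half (x y : R) : 0 < x -> x / 2 <= y -> y <= x ->
  ln x - ln 2 <= ln y <= ln x.
Proof.
move=> x0 xy yx; have y0 : 0 < y by lra.
rewrite ler_ln ?posrE // yx andbT -ln_div ?posrE // ler_ln ?posrE //.
by rewrite divr_gt0.
Qed.

(** Between crossings [step] lowers the wait by 1 and [push] raises it by at most ln 2, so this
    inequality is what makes a passage advance. *)
Lemma ln2_lt1 : ln (2 : R) < 1.
Proof.
rewrite -[X in _ < X]expRK ltr_ln ?posrE ?expR_gt0 //.
by have := @expR_gt1Dx R 1; lra.
Qed.

Lemma ln2_ge0 : 0 <= ln (2 : R).
Proof. by rewrite ln_ge0 //; lra. Qed.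

Lemma left_step t L K p : 1 < L -> 1 < K -> L * K = kap ->
  t * ln L = 1 -> 0 < t < 1 -> gauge p < 1 -> 2 * kap ^+ 2 * theta p <= 1 ->
  p.1 <= 0 ->
  let q := push kap p in let p' := bowen kap L K p in
  [/\ 0 < al q <= al p, 0 < be q <= be p,
      ln (al p) - ln 2 <= ln (al q), ln (be p) - ln 2 <= ln (be q) &
   ([/\ p'.1 <= 0, L * be q <= 1, al p' = al q / L & be p' = be q * L] \/
    [/\ 0 < p'.1, 1 < L * be q, K^-1 <= be p' & be p' <= 1])].
Proof.
move=> L1 K1 LK tL /andP[t0 t1] g1 z1 p0 q p'.
have k1 : 1 < kap by exact: (kap_gt1 L1 K1 LK).
have [a0 b0] : 0 < al p /\ 0 < be p.
  by move: (g1); rewrite gauge_lt1 => /andP[].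
have := push_gauge_lt1 L1 K1 LK g1; rewrite gauge_lt1 => /andP[aq bq].
have a2 := push_al_ge k1 (ltW g1); have b2 := push_be_ge k1 (ltW g1).
have a3 := push_al_le kap p; have b3 := push_be_le kap p.
have /andP[la _] := ln_half a0 a2 a3; have /andP[lb _] := ln_half b0 b2 b3.
have zq : 2 * kap ^+ 2 * theta q <= 1.
  have kk : 0 <= 2 * kap ^+ 2 by rewrite mulr_ge0 // exprn_ge0 //; lra.
  by apply: le_trans z1; rewrite ler_wpM2l // (push_theta_le k1 (ltW g1)).
have sL : speed kap L (theta q) = L by exact: speedE.
have sK : speed kap K (theta q) = K by exact: speedE.
have q0 : q.1 <= 0 by rewrite /q push_fst.
split; rewrite ?aq ?bq //; rewrite /p' /bowen /step -/q q0.
case: (leP (L * be q) 1) => h; [left|right].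
- have a1 : al q / L <= 1.
    by rewrite ler_pdivrMr ?(le_trans (al_le1 _)) //; lra.
  have b1 : be q * L <= 1 by rewrite mulrC.
  by rewrite half_stay sL // pt_false_fst // al_pt // be_pt.
- have h' : 1 < speed kap L (theta q) * be q by rewrite sL.
  have xs : speed kap L (theta q) * be q <= speed kap L (theta q).
    by rewrite ler_piMr ?be_le1 // sL; lra.
  have := land_ge L1 K1 xs; have := cross_al L1 K1 LK h'.
  have := land_lt1 kap L1 K1 (theta q) h'.
  rewrite (half_cross L1 K1) //; set j := land _ _ _ _ _ => j1 aj jK.
  rewrite pt_true_fst // be_pt ?(ltW j1) ?(ltW aj) //.
  by split=> //; rewrite -sK.
Qed.

Lemma age_ge0 t p : 0 < t < 1 -> gauge p < 1 -> 0 <= age t p.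
Proof.
move=> /andP[t0 t1] g1; rewrite /age; have := ln_le0 (al_le1 p).
by have := ln_le0 (be_le1 p); case: ifP => _; nra.
Qed.

Lemma wait_ge0 t p : 0 < t < 1 -> gauge p < 1 -> 0 <= wait t p.
Proof.
move=> /andP[t0 t1] g1; rewrite /wait; have := ln_le0 (al_le1 p).
by have := ln_le0 (be_le1 p); case: ifP => _; nra.
Qed.

Lemma heightE p : gauge p < 1 -> height p = - ln (al p) - ln (be p).
Proof.
rewrite gauge_lt1 => /andP[a0 b0]; rewrite /height /theta lnM ?posrE //.
by rewrite opprD.
Qed.

Lemma age_wait t p : gauge p < 1 ->
  age t p + wait t p = (if p.1 <= 0 then t else 1 - t) * height p.
Proof.
by move=> g1; rewrite heightE // /age /wait; case: ifP => _; ring.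
Qed.

Lemma bowen_same_left t L K p : 1 < L -> 1 < K -> L * K = kap ->
  t * ln L = 1 -> 0 < t < 1 -> gauge p < 1 -> 2 * kap ^+ 2 * theta p <= 1 ->
  p.1 <= 0 ->
  let q := push kap p in let p' := bowen kap L K p in
  [/\ 0 < al q <= al p, 0 < be q <= be p,
      ln (al p) - ln 2 <= ln (al q), ln (be p) - ln 2 <= ln (be q) &
   ([/\ p'.1 <= 0, L * be q <= 1, t * ln (al p') = t * ln (al q) - 1 &
       t * ln (be p') = t * ln (be q) + 1] \/
    [/\ 0 < p'.1, -1 <= t * ln (be p) & - ln K <= ln (be p')])].
Proof.
move=> L1 K1 LK tL t01 g1 z1 p0 q p'.
have [/andP[aq aqp] /andP[bq bqp] la lb H] := left_step L1 K1 LK tL t01 g1 z1 p0.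
have L0 : 0 < L by lra.
have K0 : 0 < K by lra.
rewrite -/q -/p' in aq aqp bq bqp la lb H.
split; rewrite ?aq ?bq //; case: H => [[h1 h2 -> ->]|[h1 h2 h3 h4]]; [left|right].
  split=> //; first by rewrite ln_div ?posrE // mulrBr tL.
  by rewrite lnM ?posrE // mulrDr tL.
have /andP[t0 _] := t01.
split=> //; last first.
  by rewrite -lnV ?posrE // ler_ln ?posrE ?invr_gt0 // (lt_le_trans _ h3) ?invr_gt0.
have : ln 1 <= ln (L * be q) by rewrite ler_ln ?posrE ?ltW // mulr_gt0.
rewrite ln1 lnM ?posrE // => h5.
have : ln (be q) <= ln (be p) by rewrite ler_ln ?posrE // (lt_le_trans bq).
move=> h6; have : t * 0 <= t * (ln L + ln (be p)) by rewrite ler_pM2l //; lra.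
by rewrite mulr0 mulrDr tL; lra.
Qed.

Definition coboundary t p : R := t * (1 - t) * ln (be p).

Lemma push_rot p : push kap (rot p) = rot (push kap p).
Proof.
rewrite /push /scale /pushf /bound /gauge' /gauge depth_rot /rot /= normrN.
by rewrite !mulrN.
Qed.

Lemma gauge_rot p : gauge (rot p) = gauge p.
Proof. by rewrite /gauge depth_rot /= normrN. Qed.

Lemma bowen_same_right t L K p : 1 < L -> 1 < K -> L * K = kap ->
  (1 - t) * ln K = 1 -> 0 < t < 1 -> gauge p < 1 ->
  2 * kap ^+ 2 * theta p <= 1 -> 0 < p.1 ->
  let q := push kap p in let p' := bowen kap L K p in
  [/\ 0 < al q <= al p, 0 < be q <= be p,
      ln (al p) - ln 2 <= ln (al q), ln (be p) - ln 2 <= ln (be q) &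
   ([/\ 0 < p'.1, (1 - t) * ln (be p') = (1 - t) * ln (be q) - 1 &
       (1 - t) * ln (al p') = (1 - t) * ln (al q) + 1] \/
    [/\ p'.1 <= 0, -1 <= (1 - t) * ln (al p) & - ln L <= ln (al p')])].
Proof.
move=> L1 K1 LK tK /andP[t0 t1] g1 z1 p0 q p'.
have KL : K * L = kap by rewrite mulrC.
have t01 : 0 < 1 - t < 1 by apply/andP; split; lra.
have g1' : gauge (rot p) < 1 by rewrite gauge_rot.
have z1' : 2 * kap ^+ 2 * theta (rot p) <= 1 by rewrite theta_rot.
have p0' : (rot p).1 <= 0 by rewrite /=; lra.
have := bowen_same_left K1 L1 KL tK t01 g1' z1' p0'.
rewrite /= push_rot (bowen_rot _ L1 K1 LK) !al_rot !be_rot /= -/q -/p'.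
move=> [hb ha lb la H]; have /andP[aq aqp] := ha; have /andP[bq bqp] := hb.
split=> //; case: H => [[h1 h2 h3 h4]|[h1 h2 h3]]; last by right; split=> //; lra.
case: (ltP 0 p'.1) => px; [by left|right].
(* The y-axis counts as left, so a point of the right half plane that lands on it crosses, although
   its rotated copy does not. There al is 1, because be p' < 1. *)
have px0 : p'.1 = 0 by lra.
have bq1 : ln (be q) <= 0 by apply: ln_le0; rewrite (le_trans bqp) ?be_le1.
have b1 : be p' < 1.
  rewrite lt_neqAle be_le1 andbT; apply/eqP => b1.
  by move: h3; rewrite b1 ln1 mulr0; nra.
have a1 : al p' = 1.
  by have := axis_max px0; case: (leP (al p') (be p')) => // _ e; lra.
have L0 : 0 <= ln L by rewrite ln_ge0 // ltW.
split=> //; last by rewrite a1 ln1; lra.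
have : ln (al q) <= ln (al p) by rewrite ler_ln ?posrE // (lt_le_trans aq).
by move: h4; rewrite a1 ln1 mulr0; nra.
Qed.

(** Only [push] changes theta, and it costs at most ln 2 in each of ln al and ln be. *)
Lemma height_step t L K p : 1 < L -> 1 < K -> L * K = kap -> gauge p < 1 ->
  height p <= height (bowen kap L K p) <= height p + 2 * ln 2 /\
  (push kap p = p -> height (bowen kap L K p) = height p).
Proof.
move=> L1 K1 LK g1; have k1 : 1 < kap by exact: (kap_gt1 L1 K1 LK).
split; last by move=> e; rewrite /height (bowen_theta L1 K1 LK) e.
have gq := push_gauge_lt1 L1 K1 LK g1.
have -> : height (bowen kap L K p) = height (push kap p).
  by rewrite /height (bowen_theta L1 K1 LK).
have [a0 b0] : 0 < al p /\ 0 < be p by move: (g1); rewrite gauge_lt1 => /andP[].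
have := ln_half a0 (push_al_ge k1 (ltW g1)) (push_al_le kap p).
have := ln_half b0 (push_be_ge k1 (ltW g1)) (push_be_le kap p).
by rewrite !heightE // => /andP[? ?] /andP[? ?]; apply/andP; split; lra.
Qed.

Lemma scaled_close (c x y : R) : 0 < c < 1 -> x - ln 2 <= y -> y <= x ->
  c * x - ln 2 <= c * y <= c * x.
Proof.
move=> /andP[c0 c1] h1 h2; rewrite (ler_pM2l c0) h2 andbT.
have : c * (x - y) <= 1 * ln 2 by rewrite ler_pM //; lra.
lra.
Qed.

(** By the choice of L and K, [step] alone moves both clocks by exactly 1 between crossings, and the
    remaining slack is due to [push]. The bound 4 is crude; it will only be used at times of density
    zero. *)
Lemma orbit_step t L K p : 1 < L -> 1 < K -> L * K = kap ->
  t * ln L = 1 -> (1 - t) * ln K = 1 -> 0 < t < 1 -> gauge p < 1 ->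
  2 * kap ^+ 2 * theta p <= 1 ->
  let p' := bowen kap L K p in
  [/\ ~~ crosses L K p -> age t p + 1 <= age t p' <= age t p + 2 /\
        wait t p' <= wait t p - (1 - ln 2),
      crosses L K p -> age t p' <= 1 /\ wait t p <= 1,
      `|coboundary t p' - coboundary t p - ((p.1 <= 0)%R%:R - t)| <= 4 &
      ~~ crosses L K p -> push kap p = p ->
        coboundary t p' - coboundary t p = (p.1 <= 0)%R%:R - t].
Proof.
move=> L1 K1 LK tL tK t01 g1 z1 p'; have /andP[t0 t1] := t01.
have [/andP[hh1 hh2] _] := height_step t L1 K1 LK g1; rewrite -/p' in hh1 hh2.
have l2 := ln2_lt1; have l0 := ln2_ge0.
have g1' : gauge p' < 1 by exact: (bowen_gauge_lt1 L1 K1 LK).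
have lap := ln_le0 (al_le1 p); have lbp := ln_le0 (be_le1 p).
have lap' := ln_le0 (al_le1 p'); have lbp' := ln_le0 (be_le1 p').
have t01' : 0 < 1 - t < 1 by apply/andP; split; lra.
have u01 : 0 < t * (1 - t) < 1 by apply/andP; split; nra.
rewrite /crosses -/p' /coboundary /age /wait; case: (leP p.1 0) => px /=.
- have [/andP[aq aqp] /andP[bq bqp] la lb H] :=
    bowen_same_left L1 K1 LK tL t01 g1 z1 px.
  rewrite -/p' in H; set q := push kap p in aq aqp bq bqp la lb H *.
  have la' : ln (al q) <= ln (al p) by rewrite ler_ln ?posrE // (lt_le_trans aq).
  have lb' : ln (be q) <= ln (be p) by rewrite ler_ln ?posrE // (lt_le_trans bq).
  case: H => [[h1 h2 h3 h4]|[h1 h2 h3]].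
  + rewrite h1 /=; split=> //.
    * have /andP[? ?] := scaled_close t01 la la'.
      have /andP[? ?] := scaled_close t01 lb lb'.
      move=> _; rewrite !mulNr h3 h4; split; last lra.
      by apply/andP; split; lra.
    * have /andP[? ?] := scaled_close u01 lb lb'.
      rewrite -!mulrA (mulrCA t) h4.
      by rewrite ler_norml; apply/andP; split; lra.
    * move=> _ e; rewrite e in h4; rewrite -!mulrA (mulrCA t) h4; lra.
  + rewrite leNgt h1 /=; split=> //.
    * by move=> _; split; nra.
    * have h4 : - t <= t * (1 - t) * ln (be p') by nra.
      have h5 : - (1 - t) <= t * (1 - t) * ln (be p) by nra.
      have h6 : t * (1 - t) * ln (be p') <= 0 by nra.
      have h7 : t * (1 - t) * ln (be p) <= 0 by nra.
      by rewrite ler_norml; apply/andP; split; lra.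
- have [/andP[aq aqp] /andP[bq bqp] la lb H] :=
    bowen_same_right L1 K1 LK tK t01 g1 z1 px.
  rewrite -/p' in H; set q := push kap p in aq aqp bq bqp la lb H *.
  have la' : ln (al q) <= ln (al p) by rewrite ler_ln ?posrE // (lt_le_trans aq).
  have lb' : ln (be q) <= ln (be p) by rewrite ler_ln ?posrE // (lt_le_trans bq).
  case: H => [[h1 h3 h4]|[h1 h2 h3]].
  + rewrite leNgt h1 /=; split=> //.
    * have /andP[? ?] := scaled_close t01' la la'.
      have /andP[? ?] := scaled_close t01' lb lb'.
      move=> _; rewrite !mulNr h3 h4; split; last lra.
      by apply/andP; split; lra.
    * have /andP[? ?] := scaled_close u01 lb lb'.
      rewrite -!mulrA h3.
      by rewrite ler_norml; apply/andP; split; lra.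
    * by move=> _ e; rewrite e in h3; rewrite -!mulrA h3; lra.
  + rewrite h1 /=; split=> //.
    * have : t * (- ln L) <= t * ln (al p') by rewrite ler_pM2l.
      by move=> h _; split; lra.
    (* This crossing controls ln al only; the change of ln be is recovered from that of the height,
       which is at most 2 ln 2. *)
    * rewrite !heightE // in hh1 hh2.
      have h4 : - (1 - t) <= t * (1 - t) * ln (al p') by nra.
      have h5 : - t <= t * (1 - t) * ln (al p) by nra.
      have h6 : t * (1 - t) * ln (al p') <= 0 by nra.
      have h7 : t * (1 - t) * ln (al p) <= 0 by nra.
      have u0 : 0 <= t * (1 - t) by nra.
      have u1 : t * (1 - t) <= 1 by nra.
      have h8 : 0 <= t * (1 - t) * ((ln (al p) + ln (be p)) -
          (ln (al p') + ln (be p'))) by rewrite mulr_ge0 //; lra.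
      have h9 : t * (1 - t) * ((ln (al p) + ln (be p)) -
          (ln (al p') + ln (be p'))) <= 2.
        by rewrite -[X in _ <= X]mul1r ler_pM //; lra.
      by rewrite ler_norml; apply/andP; split; lra.
Qed.

End one_step.

(** * Closeness to the saddles in terms of the clocks *)

Section near_saddles.
Variable R : realType.
Implicit Types (p q : R * R) (t : R).

Lemma pt_continuous (r : bool) : continuous (fun ab : R * R => pt r ab.1 ab.2).
Proof. by rewrite /pt; cont. Qed.

Lemma pt00 (r : bool) : pt r (0 : R) 0 = ((if r then 1 else -1), 0).
Proof.
rewrite /pt maxxx addr0 !mul0r !subr0 mulr1; congr pair; last by rewrite mul0r.
by rewrite min_l ?mulr1 //; lra.
Qed.

Lemma near_pt (r : bool) (U : set (R * R)) :
  nbhs ((if r then 1 else -1, 0) : R * R) U ->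
  exists2 e : R, 0 < e & forall a b, 0 < a < e -> 0 < b < e -> U (pt r a b).
Proof.
rewrite -(pt00 r) => nU; have := @pt_continuous r (0, 0) U nU.
move=> /nbhs_ballP[e e0 he]; exists e => // a b /andP[a0 ae] /andP[b0 be'].
apply: (he (a, b)); split=> /=; rewrite /ball /= sub0r normrN gtr0_norm //.
Qed.

Lemma small_of_log (c x e K : R) : 0 < c < 1 -> 0 < x <= 1 -> 0 < e ->
  `|ln e| <= K -> K < - c * ln x -> x < e.
Proof.
move=> /andP[c0 c1] /andP[x0 x1] e0 hK hx; rewrite -ltr_ln ?posrE //.
have := ln_le0 x1; have := ler_norm (- ln e); rewrite normrN; nra.
Qed.

(** When age and wait are both large, al and be are both small, and a saddle is the point of its
    half plane with coordinates (0, 0). *)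
Lemma near_saddles t (U1 U2 : set (R * R)) : 0 < t < 1 ->
  nbhs ((-1, 0) : R * R) U1 -> nbhs ((1, 0) : R * R) U2 ->
  exists K : R, forall p, gauge p < 1 -> K < age t p -> K < wait t p ->
    if p.1 <= 0 then U1 p else U2 p.
Proof.
move=> t01 n1 n2; have [e1 e10 h1] := @near_pt false _ n1.
have [e2 e20 h2] := @near_pt true _ n2.
have t01' : 0 < 1 - t < 1 by case/andP: t01 => ? ?; apply/andP; split; lra.
exists (Num.max `|ln e1| `|ln e2|) => p g1.
have [a0 b0] : 0 < al p /\ 0 < be p by move: g1; rewrite gauge_lt1 => /andP[].
have ha : 0 < al p <= 1 by rewrite a0 al_le1.
have hb : 0 < be p <= 1 by rewrite b0 be_le1.
have m1 : `|ln e1| <= Num.max `|ln e1| `|ln e2| by rewrite le_max lexx.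
have m2 : `|ln e2| <= Num.max `|ln e1| `|ln e2| by rewrite le_max lexx orbT.
rewrite /age /wait; case: (leP p.1 0) => px ka kw.
- rewrite -(@pt_coord _ false p) //; apply: h1.
    by rewrite a0 (small_of_log t01 ha e10 m1 ka).
  by rewrite b0 (small_of_log t01 hb e10 m1 kw).
- rewrite -(@pt_coord _ true p) ?ltW //; apply: h2.
    by rewrite a0 (small_of_log t01' ha e20 m2 kw).
  by rewrite b0 (small_of_log t01' hb e20 m2 ka).
Qed.

Lemma gauge_saddle (r : bool) : gauge ((if r then 1 else -1, 0) : R * R) = 1.
Proof.
rewrite /gauge /depth /= normr0 !addr0.
by case: r; rewrite ?normrN normr1 max_l //; lra.
Qed.

(** At a saddle the bound is 1 - 1 / (2 kap^2) and the gauge is 1; the strict inequality persists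
    nearby. *)
Lemma push_near_saddle (kap : R) (r : bool) : 1 < kap ->
  \forall p \near ((if r then 1 else -1, 0) : R * R), push kap p = p.
Proof.
move=> k1; set x := ((if r then 1 else -1, 0) : R * R).
have gx := gauge_saddle r; rewrite -/x in gx.
have bx : bound kap x < gauge x.
  rewrite gx /bound /= normr0 mulr0 mul0r subr0 max_r // mulr1.
  by have /andP[] := kap2_inv k1; lra.
have cx : {for x, continuous (fun p => gauge p - bound kap p)}.
  have h1 := @gauge_continuous R; have h2 := @bound_continuous R kap.
  by move: x {gx bx}; rewrite /prop_for; cont.
have := @cvgr_gt _ _ (nbhs x) (nbhs_filter x) _ _ cx 0; rewrite subr_gt0 => /(_ bx).
apply: filterS => p; rewrite subr_gt0 => h; apply: push_id => //; exact: ltW.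
Qed.

End near_saddles.

(** * Frequencies along an orbit of V *)

Section orbit_averages.
Variable R : realType.

(* The potential for w bounds the density of C by 2 / w. *)
Lemma null_density_growth (C : nat -> bool) :
  (forall w : R, 0 < w -> exists W (M : R), (forall n, `|W n| <= M) /\
    eventually_nat (fun n => w * (C n)%:R - 2 <= W n.+1 - W n)) ->
  @null_density R C.
Proof.
move=> h e e0; have [w w0 ew] : exists2 w, 0 < w & w * e = 4.
  by exists (4 / e); rewrite ?divr_gt0 // divfK // gt_eqF.
have [W [M [WM [n0 hn]]]] := h _ w0.
pose c := `|\sum_(j < n0) (w * (C j)%:R - 2)| + 2 * M.
have [n1 h1] := eventually_ge (c / 2).
exists (maxn n0 n1) => n; rewrite geq_max => /andP[l0 l1].
have := sum_le_drift hn l0; rewrite sumrB sumr_const card_ord -mulr_sumr.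
rewrite -[_ *+ n]mulr_natr => acc.
have C0 : 0 <= \sum_(j < n) (C j)%:R :> R by apply: sumr_ge0.
rewrite ger0_norm //.
have := h1 n l1; rewrite ler_pdivrMr // => hc.
have := WM n; have := WM n0; rewrite !ler_norml => /andP[w1 w2] /andP[w3 w4].
have hs := ler_norm (\sum_(j < n0) (w * (C j)%:R - 2)).
rewrite -(ler_pM2l w0) mulrA ew; move: acc hc; rewrite /c; lra.
Qed.

Variables (kap L K t : R).
Hypotheses (L1 : 1 < L) (K1 : 1 < K) (LK : L * K = kap).
Hypotheses (tL : t * ln L = 1) (tK : (1 - t) * ln K = 1) (t01 : 0 < t < 1).
Variable y : R * R.
Hypotheses (gy : gauge y < 1) (y0 : y <> (0, 0)).
Let f := bowen kap L K.
Let p n := iter n f y.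

Let k1 : 1 < kap. Proof. exact: (kap_gt1 L1 K1 LK). Qed.
Let gp n : gauge (p n) < 1. Proof. exact: iter_bowen_gauge. Qed.

Lemma eventually_theta (e : R) : 0 < e -> eventually_nat (fun n => theta (p n) < e).
Proof.
move=> e0; have := theta_cvg0 L1 K1 LK gy y0.
move=> /cvgrPdist_lt /(_ _ e0) [N _ hN]; exists N => n hn.
have := hN n hn; rewrite /= sub0r normrN gtr0_norm //.
exact: (theta_gt0 (gp n)).
Qed.

Lemma eventually_full : eventually_nat (fun n => 2 * kap ^+ 2 * theta (p n) <= 1).
Proof.
have /andP[e0 _] := kap2_inv k1; have k2 : 0 < 2 * kap ^+ 2.
  by rewrite -invr_gt0.
apply: eventually_impl (eventually_theta e0) => n h.
by rewrite mulrC -ler_pdivlMr // div1r ltW.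
Qed.

Lemma eventually_height (M : R) : eventually_nat (fun n => M <= height (p n)).
Proof.
apply: eventually_impl (eventually_theta (expR_gt0 (- M))) => n h.
have z0 := theta_gt0 (gp n).
rewrite /height lerNr -[X in _ <= X]expRK ler_ln ?posrE ?expR_gt0 //.
exact: ltW.
Qed.

Let step_at n : 2 * kap ^+ 2 * theta (p n) <= 1 -> _ :=
  fun h => orbit_step L1 K1 LK tL tK t01 (gp n) h.

(** At a crossing the wait is at most 1, so by [age_wait] a large height means a large age, which
    the crossing resets to at most 1. The age grows by at most 2 per step, so truncating it at w + 2
    and changing its sign gives a potential that gains at least w at each crossing. *)
Lemma cross_density : @null_density R (fun n => crosses kap L K (p n)).
Proof.
apply: null_density_growth => w w0.
have /andP[t0 t1] := t01.
pose W n := - Num.min (age t (p n)) (w + 2).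
exists W, (w + 2); split.
  move=> n; rewrite /W normrN ger0_norm; first by rewrite ge_min lexx orbT.
  by rewrite le_min age_ge0 //=; lra.
pose m := Num.min t (1 - t).
have m0 : 0 < m by rewrite lt_min; apply/andP; split; lra.
have := eventually_and eventually_full (eventually_height ((w + 3) / m)).
apply: eventually_impl => n [/step_at[nc c _ _] hh]; rewrite /W.
have a0 := age_ge0 t01 (gp n); have a0' := age_ge0 t01 (gp n.+1).
have aw := age_wait t (gp n).
have hm : w + 3 <= (if (p n).1 <= 0 then t else 1 - t) * height (p n).
  rewrite ler_pdivrMr // in hh; apply: (le_trans hh); rewrite mulrC.
  rewrite ler_wpM2r //.
    rewrite -oppr_le0 opprK; apply: ln_le0; apply: theta_le1; exact: ltW.
  by rewrite /m; case: ifP => _; rewrite ge_min lexx ?orbT.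
case: (boolP (crosses kap L K (p n))) => hc.
- have [c1 c2] := c hc; rewrite mulr1.
  rewrite [Num.min (age t (p n)) _]min_r; last by lra.
  have : Num.min (age t (p n.+1)) (w + 2) <= age t (p n.+1).
    by rewrite ge_min lexx.
  by rewrite /p /= in c1 *; lra.
- have [/andP[_ c1] _] := nc hc; rewrite mulr0.
  have : Num.min (age t (p n.+1)) (w + 2) <= Num.min (age t (p n)) (w + 2) + 2.
    case: (leP (age t (p n)) (w + 2)) => h; rewrite ge_min; apply/orP.
      by left; rewrite /p /= in c1 *; lra.
    by right; lra.
  lra.
Qed.

(** A passage contains boundedly many steps of age at most M and boundedly many of wait at most M,
    and passages have density zero. The potentials are the two clocks truncated slightly above M. *)
Lemma transit_density (M : R) :
  @null_density R (fun n => (age t (p n) <= M) || (wait t (p n) <= M)).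
Proof.
have l2 := @ln2_lt1 R; pose M' := `|M| + 1.
have M0 : 0 < M' by rewrite ltr_wpDl.
have MM : M <= M' - 1 by rewrite /M' addrK ler_norm.
apply: null_density_or.
- pose W n := Num.min (age t (p n)) M'.
  apply: (@null_density_potential _ _ _ W M' 1 (M' + 1) _ cross_density) => //.
    move=> n; rewrite /W ger0_norm; first by rewrite ge_min lexx orbT.
    by rewrite le_min age_ge0 //= ltW.
  apply: eventually_impl eventually_full => n /step_at[nc c _ _]; rewrite /W.
  have a0 := age_ge0 t01 (gp n); have a0' := age_ge0 t01 (gp n.+1).
  have W1 : 0 <= Num.min (age t (p n.+1)) M' by rewrite le_min a0' ltW.
  have W2 : Num.min (age t (p n)) M' <= M' by rewrite ge_min lexx orbT.
  case: (boolP (crosses kap L K (p n))) => hc.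
    by case: (_ <= M) => /=; lra.
  have [/andP[c1 _] _] := nc hc; rewrite mulr0 subr0.
  rewrite -/(p n.+1) in c1; have {}c1 : age t (p n) + 1 <= age t (p n.+1) by [].
  case: (leP (age t (p n)) M) => h /=.
    rewrite [X in _ <= _ - X]min_l; last by lra.
    suff : age t (p n) + 1 <= Num.min (age t (p n.+1)) M' by lra.
    by rewrite le_min c1; lra.
  suff : Num.min (age t (p n)) M' <= Num.min (age t (p n.+1)) M' by lra.
  by rewrite le_min W2 andbT ge_min; apply/orP; left; lra.
- pose W n := - Num.min (wait t (p n)) M'.
  apply: (@null_density_potential _ _ _ W M' (1 - ln 2) (M' + 1) _ cross_density).
  + lra.
  + move=> n; rewrite /W normrN ger0_norm; first by rewrite ge_min lexx orbT.
    by rewrite le_min wait_ge0 //= ltW.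
  apply: eventually_impl eventually_full => n /step_at[nc c _ _]; rewrite /W.
  have l0 := @ln2_ge0 R.
  have a0 := wait_ge0 t01 (gp n); have a0' := wait_ge0 t01 (gp n.+1).
  have W1 : 0 <= Num.min (wait t (p n)) M' by rewrite le_min a0 ltW.
  have W2 : Num.min (wait t (p n.+1)) M' <= M' by rewrite ge_min lexx orbT.
  case: (boolP (crosses kap L K (p n))) => hc.
    by case: (_ <= M) => /=; lra.
  have [_ c1] := nc hc; rewrite mulr0 subr0.
  have {}c1 : wait t (p n.+1) <= wait t (p n) - (1 - ln 2) by [].
  case: (leP (wait t (p n)) M) => h /=.
    rewrite [X in _ <= _ - - X]min_l; last by lra.
    suff : Num.min (wait t (p n.+1)) M' <= wait t (p n) - (1 - ln 2) by lra.
    by rewrite ge_min c1.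
  suff : Num.min (wait t (p n.+1)) M' <= Num.min (wait t (p n)) M' by lra.
  by rewrite le_min W2 andbT ge_min; apply/orP; left; lra.
Qed.

(** The height grows only where [push] acts, which is away from the saddles and hence at times of
    density zero. *)
Lemma height_sublinear : sublinear (fun n => height (p n)).
Proof.
have [M HM] := near_saddles t01 (@push_near_saddle R kap false k1)
  (@push_near_saddle R kap true k1).
apply: sublinear_drift (null_meanZ (2 * ln 2) (transit_density M)) _.
  move=> n; rewrite /height -oppr_le0 opprK; apply: ln_le0.
  by apply: theta_le1; exact: ltW.
exists 0%N => n _.
have [/andP[_ h1] h2] := height_step t L1 K1 LK (gp n).
rewrite -/f -/(p n.+1) in h1 h2.
have {}h1 : height (p n.+1) <= height (p n) + 2 * ln 2 := h1.
case: (leP (age t (p n)) M) => ha /=; first by lra.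
case: (leP (wait t (p n)) M) => hw /=; first by lra.
have e : push kap (p n) = p n by have := HM _ (gp n) ha hw; case: ifP.
have {}h2 : height (p n.+1) = height (p n) := h2 e.
by lra.
Qed.

Lemma coboundary_sublinear : sublinear (fun n => coboundary t (p n)).
Proof.
move=> e e0; apply: eventually_impl (height_sublinear e0) => n.
have /andP[t0 t1] := t01.
have := ln_le0 (al_le1 (p n)); have := ln_le0 (be_le1 (p n)).
have := gp n; move=> /heightE ->; rewrite /coboundary => lb la h.
apply: le_trans h; rewrite [X in _ <= X]ger0_norm; last lra.
rewrite normrM (ler0_norm lb) ger0_norm; last by nra.
have u1 : t * (1 - t) <= 1 by nra.
have u0 : 0 <= t * (1 - t) by nra.
by nra.
Qed.

Lemma left_frequency : null_mean (fun n => ((p n).1 <= 0)%R%:R - t).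
Proof.
have [M HM] := near_saddles t01 (@push_near_saddle R kap false k1)
  (@push_near_saddle R kap true k1).
pose S n := (age t (p n) <= M) || (wait t (p n) <= M).
have nS : @null_density R (fun n => S n || crosses kap L K (p n)).
  by apply: null_density_or cross_density; exact: transit_density.
pose W n := coboundary t (p n).
have nW : null_mean (fun n => W n.+1 - W n).
  exact: null_mean_telescope coboundary_sublinear.
pose err n := ((p n).1 <= 0)%R%:R - t - (W n.+1 - W n).
have nE : null_mean err.
  apply: null_mean_le (null_meanZ 4 nS) _.
  apply: eventually_impl eventually_full => n /step_at[_ _ h1 h2].
  rewrite /err -normrN opprB; case: (boolP (S n || _)) => [|hS].
    by rewrite mulr1.
  move: hS; rewrite negb_or => /andP[hS hc]; rewrite mulr0.
  rewrite negb_or -!ltNge in hS; have /andP[ha hw] := hS.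
  have e : push kap (p n) = p n by have := HM _ (gp n) ha hw; case: ifP.
  have {}h2 : W n.+1 - W n = ((p n).1 <= 0)%R%:R - t := h2 hc e.
  by rewrite h2 subrr normr0.
have -> : (fun n => ((p n).1 <= 0)%R%:R - t) =
    (fun n => err n + (W n.+1 - W n)).
  by apply/funext => n; rewrite /err subrK.
exact: null_meanD.
Qed.

(** Outside a set of times of density zero, phi is within e of its value at the saddle of the
    current half plane, which reduces the mean to [left_frequency]. *)
Lemma observable_mean (phi : R * R -> R) (C : R) :
  (forall x, `|phi x| <= C) -> continuous phi ->
  null_mean (fun n => phi (p n) - (t * phi (-1, 0) + (1 - t) * phi (1, 0))).
Proof.
move=> phiC cphi; set v1 := phi (-1, 0); set v2 := phi (1, 0).
pose v n := if (p n).1 <= 0 then v1 else v2.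
have C0 : 0 <= C := le_trans (normr_ge0 _) (phiC (0, 0)).
have /choice[M HM] : forall e : R, exists M : R, 0 < e -> forall q,
    gauge q < 1 -> M < age t q -> M < wait t q ->
    if q.1 <= 0 then `|v1 - phi q| < e else `|v2 - phi q| < e.
  move=> e; case: (ltP 0 e) => e0; last by exists 0 => e0'; lra.
  have d1 := @cvgr_dist_lt _ _ _ _ (nbhs_filter _) _ _ (cphi (-1, 0)) _ e0.
  have d2 := @cvgr_dist_lt _ _ _ _ (nbhs_filter _) _ _ (cphi (1, 0)) _ e0.
  have [M HM] := near_saddles t01 d1 d2; exists M => _ q gq h1 h2.
  have := HM q gq h1 h2. by case: ifP.
have n1 : null_mean (fun n => phi (p n) - v n).
  pose b (e : R) n : R := 2 * C *
    ((age t (p n) <= M e) || (wait t (p n) <= M e))%:R.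
  apply: (@null_mean_bound _ _ b).
    by move=> e _; apply: null_meanZ; exact: transit_density.
  move=> e e0; exists 0%N => n _; rewrite /b.
  case: (leP (age t (p n)) (M e)) => ha /=.
    rewrite mulr1; apply: (le_trans (ler_normB _ _)).
    have := phiC (p n); have : `|v n| <= C by rewrite /v; case: ifP => _; exact: phiC.
    by lra.
  case: (leP (wait t (p n)) (M e)) => hw /=.
    rewrite mulr1; apply: (le_trans (ler_normB _ _)).
    have := phiC (p n); have : `|v n| <= C by rewrite /v; case: ifP => _; exact: phiC.
    by lra.
  rewrite mulr0 addr0; have := HM e e0 _ (gp n) ha hw.
  by rewrite /v; case: ifP => _ /ltW; rewrite distrC.
have n2 := null_meanZ (v1 - v2) left_frequency.
have -> : (fun n => phi (p n) - (t * v1 + (1 - t) * v2)) =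
    (fun n => (phi (p n) - v n) + (v1 - v2) * (((p n).1 <= 0)%R%:R - t)).
  by apply/funext => n; rewrite /v; case: ifP => _ /=; ring.
exact: null_meanD.
Qed.

End orbit_averages.

(** * The plane as a Riemannian surface *)

Section rational_boxes.
Variable R : realType.
Implicit Types (p : R * R) (U : set (R * R)).

Definition rbox (q : (rat * rat) * (rat * rat)) : set (R * R) :=
  [set p | (ratr q.1.1 < p.1 < ratr q.1.2) /\ (ratr q.2.1 < p.2 < ratr q.2.2)].

Lemma rbox_nbhs p U : nbhs p U -> exists2 q, rbox q p & rbox q `<=` U.
Proof.
move=> /nbhs_ballP[e /= e0 he].
have pick x : exists q : rat * rat, (ratr q.1 < x < ratr q.2) /\
    x - e < ratr q.1 :> R /\ ratr q.2 < x + e :> R.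
  have [a /[!in_itv]/= /andP[a1 a2]] := @rat_in_itvoo R (x - e) x (ltac:(lra)).
  have [b /[!in_itv]/= /andP[b1 b2]] := @rat_in_itvoo R x (x + e) (ltac:(lra)).
  by exists (a, b); rewrite /= a2 b1.
have [q1 [h1 [h2 h3]]] := pick p.1; have [q2 [h4 [h5 h6]]] := pick p.2.
exists (q1, q2); first by split.
move=> x [/andP[x1 x2] /andP[x3 x4]]; apply: he.
by split; rewrite /ball /= ltr_norml; apply/andP; rewrite /= in x1 x2 x3 x4;
  split; lra.
Qed.

Lemma rbox_open q : open (rbox q).
Proof.
have -> : rbox q = (fst @^-1` [set` `](ratr q.1.1 : R), (ratr q.1.2 : R)[]) `&`
    (snd @^-1` [set` `](ratr q.2.1 : R), (ratr q.2.2 : R)[]).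
  by apply/seteqP; split=> p; rewrite /rbox /= !in_itv.
apply: openI; apply: open_comp => [p _|]; try exact: interval_open.
  exact: cvg_fst.
exact: cvg_snd.
Qed.

Lemma plane_second_countable : @second_countable (R * R)%type.
Proof.
exists (range rbox).
  by apply: (card_le_trans (card_image_le _ _)); exact: countableP.
split; first by move=> _ [q _ <-]; exact: rbox_open.
move=> p U /rbox_nbhs[q qp qU]; exists (rbox q) => //=; split=> //.
by exists q.
Qed.

Lemma open_rboxE U : open U -> U = \bigcup_(q in [set q | rbox q `<=` U]) rbox q.
Proof.
move=> oU; apply/seteqP; split=> [p Up|p [q qU qp]]; last exact: qU.
have [q qp qU] := rbox_nbhs (open_nbhs_nbhs (conj oU Up)).
by exists q.
Qed.

Lemma rbox_measurable q :
  measurable (rbox q : set (measurableTypeR R * measurableTypeR R)).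
Proof.
have -> : rbox q = [set` `](ratr q.1.1 : R), (ratr q.1.2 : R)[] `*`
    [set` `](ratr q.2.1 : R), (ratr q.2.2 : R)[].
  by apply/seteqP; split=> p; rewrite /rbox /= !in_itv.
by apply: measurableX; exact: measurable_itv.
Qed.

(** There are countably many rational boxes, so open sets of the plane belong to the product
    sigma-algebra. *)
Lemma open_measurable2 U : open U ->
  measurable (U : set (measurableTypeR R * measurableTypeR R)).
Proof.
move=> /open_rboxE ->; rewrite bigcup_mkcond.
apply: countable_bigcupT_measurable; first exact: countableP.
by move=> q; case: ifP => _ //; exact: rbox_measurable.
Qed.

Definition planeT : ptopologicalType :=
  HB.pack (R * R)%type (Pointed.class (R * R)%type) (Topological.class (R * R)%type).

Local Notation lebesgue2 := (@lebesgue_measure R \x @lebesgue_measure R)%E.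

Lemma borel_measurable2 (B : set (borel planeT)) : measurable B ->
  measurable (B : set (measurableTypeR R * measurableTypeR R)).
Proof.
apply: smallest_sub; last exact: open_measurable2.
split=> [|C mC|F mF].
- exact: measurable0.
- by rewrite setTD; exact: measurableC.
- exact: bigcupT_measurable.
Qed.

(** The product measure restricted to the Borel sets, which are measurable for the product by
    [borel_measurable2]. *)
Definition plane_vol (B : set (borel planeT)) : \bar R := lebesgue2 B.

Let plane_vol0 : plane_vol set0 = 0%E.
Proof. exact: measure0. Qed.

Let plane_vol_ge0 B : (0 <= plane_vol B)%E.
Proof. exact: measure_ge0. Qed.

Let plane_vol_sigma_additive : semi_sigma_additive plane_vol.
Proof.
move=> F mF tF mU; apply: measure_semi_sigma_additive => //.
  by move=> n; exact: borel_measurable2.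
exact: borel_measurable2.
Qed.

HB.instance Definition _ := isMeasure.Build _ _ _ plane_vol
  plane_vol0 plane_vol_ge0 plane_vol_sigma_additive.

Lemma derive_aff (u v w : R) (p d : R * R) :
  is_derive p d (fun q : R * R => u + v * q.1 + w * q.2) (v * d.1 + w * d.2).
Proof.
have e : (fun h : R => h^-1 *: ((u + v * (h *: d + p).1 + w * (h *: d + p).2) -
   (u + v * p.1 + w * p.2))) @ 0^' --> v * d.1 + w * d.2.
  apply: cvg_near_cst; near=> h.
  have h0 : h != 0 by near: h; exact: nbhs_dnbhs_neq.
  rewrite /= !mulrDr /GRing.scale /=.
  by field.
by split; [apply/cvg_ex; eexists; exact: e | exact: cvg_lim].
Unshelve. all: by end_near. Qed.

Lemma Ck_cst k (D : set (R * R)) (c : R) : Ck k D (fun _ => c).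
Proof.
elim: k c => [|k IH] c /=; split=> //; try by move=> p _; exact: cvg_cst.
move=> b; split=> [q _|]; first exact: derivable_cst.
have -> : partial b (fun=> c) = fun _ => 0.
  by apply/funext => q; rewrite /partial derive_cst.
exact: IH.
Qed.

Lemma partial_near (f g : R * R -> R) (p d : R * R) :
  (\forall q \near p, f q = g q) -> derivable g p d ->
  derivable f p d /\ 'D_d f p = 'D_d g p.
Proof.
move=> fg dg; split; last by apply: near_eq_derive.
by apply: near_eq_derivable dg; apply: filterS fg => q.
Qed.

Lemma Ck_coord k (D : set (R * R)) (a : 'I_2) : Ck k D (@Defs.coord R a).
Proof.
have aff q : Defs.coord a q = 0 + (a == 0)%:R * q.1 + (a != 0)%:R * q.2.
  by rewrite /Defs.coord add0r; case: eqP => _ /=; rewrite ?mul1r ?mul0r ?addr0 ?add0r.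
have E : @Defs.coord R a = fun q => 0 + (a == 0)%:R * q.1 + (a != 0)%:R * q.2.
  by apply/funext.
have cg : continuous (fun q : R * R => 0 + (a == 0)%:R * q.1 + (a != 0)%:R * q.2).
  by cont.
case: k => [|k]; rewrite E; first by split=> // p _; exact: cg.
split; first by move=> p _; exact: cg.
move=> b; split=> [p _|]; first by have [] := derive_aff 0 (a == 0)%:R (a != 0)%:R p (basis_vector R b).
have -> : partial b (fun q : R * R => 0 + (a == 0)%:R * q.1 + (a != 0)%:R * q.2) =
   fun _ => (a == 0)%:R * (basis_vector R b).1 + (a != 0)%:R * (basis_vector R b).2.
  apply/funext => p; rewrite /partial.
  by have d := derive_aff 0 (a == 0)%:R (a != 0)%:R p (basis_vector R b); rewrite derive_val.
exact: Ck_cst.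
Qed.

Lemma jacobian_aff (F : R * R -> R * R) (u v w : 'I_2 -> R) (p : R * R) :
  (\forall q \near p, forall a, Defs.coord a (F q) = u a + v a * q.1 + w a * q.2) ->
  jacobian2 F p = \matrix_(a, b) (if b == 0 then v a else w a).
Proof.
move=> FE; apply/matrixP => a b; rewrite !mxE /partial.
have d := derive_aff (u a) (v a) (w a) p (basis_vector R b).
have [_ ->] := @partial_near (Defs.coord a \o F)
  (fun q => u a + v a * q.1 + w a * q.2) p (basis_vector R b)
  (filterS (fun q h => h a) FE) ex_derive.
rewrite derive_val /basis_vector; case: eqP => _ /=;
  by rewrite ?mulr1 ?mulr0 ?addr0 ?add0r.
Qed.

Lemma jacobian_id (p : R * R) : jacobian2 (@id (R * R)) p = 1%:M.
Proof.
rewrite (@jacobian_aff _ (fun _ => 0) (fun a => (a == 0)%:R) (fun a => (a != 0)%:R)).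
  apply/matrixP => a b; rewrite !mxE.
  by case: a => [[|[|//]] ?]; case: b => [[|[|//]] ?].
apply: filterE => q a; rewrite /Defs.coord add0r.
by case: eqP => _ /=; rewrite ?mul1r ?mul0r ?addr0 ?add0r.
Qed.

Lemma plane_hausdorff : hausdorff_space planeT.
Proof. exact: (@norm_hausdorff R (R * R)%type). Qed.

Lemma plane_metric_pos (p : R * R) (v : 'rV[R]_2) : v != 0 ->
  0 < (v *m (1%:M : 'M[R]_2) *m v^T) 0 0.
Proof.
move=> v0; rewrite mulmx1 mxE !big_ord_recl big_ord0 addr0 !mxE.
set x := v 0 _; set y := v 0 _; rewrite -!expr2.
rewrite lt_neqAle addr_ge0 ?sqr_ge0 // andbT eq_sym paddr_eq0 ?sqr_ge0 //.
rewrite !expf_eq0 /=; apply: contra v0 => /andP[/eqP x0 /eqP y0].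
apply/eqP/matrixP => i j; rewrite mxE (ord1 i).
by case: j => [[|[|//]] ij]; [rewrite -x0 | rewrite -y0]; congr (v _ _);
  apply: val_inj.
Qed.

Lemma plane_volE (B : set (borel planeT)) : measurable B ->
  plane_vol B = (\int[lebesgue2]_(p in id @` B)
    (Num.sqrt (\det (1%:M : 'M[R]_2)))%:E)%E.
Proof.
move=> mB; rewrite det1 sqrtr1 image_id.
by rewrite integral_cst ?mul1e //; exact: borel_measurable2.
Qed.

(** One global chart and the Euclidean metric. The definition is transparent, so that charts and
    local expressions reduce by computation later on. *)
Definition plane : riemannian_surface R.
Proof.
refine (@RiemannianSurface R planeT plane_hausdorff plane_second_countable
  unit (fun _ => setT) (fun _ => id) (fun _ => id) _ _ _ _ _ _ _
  (fun _ _ => 1%:M) _ _ _ _ plane_vol _).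
- by move=> _; exact: openT.
- by move=> x; exists tt.
- by move=> _; rewrite image_id; exact: openT.
- by [].
- by move=> _; apply: continuous_subspaceT => x; exact: cvg_id.
- by move=> _; apply: continuous_subspaceT => x; exact: cvg_id.
- by move=> _ _ k a; exact: Ck_coord.
- by move=> _ k a b; exact: Ck_cst.
- by move=> _ p _; rewrite trmx1.
- by move=> _ p v _; exact: plane_metric_pos.
- by move=> _ _ p _; rewrite /= jacobian_id trmx1 !mul1mx.
- by move=> _ B mB _; exact: plane_volE.
Defined.

End rational_boxes.

(** * Null sets and Lipschitz maps *)

Section grid_cells.
Variable R : realType.
Implicit Types (p q : R * R) (c : nat * (int * int)) (W : set (R * R)).
Local Notation T2 := (measurableTypeR R * measurableTypeR R)%type.
Local Notation leb2 := (@lebesgue_measure R \x @lebesgue_measure R)%E.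

Definition grid n (x : R) : int := Num.floor (2 ^+ n * x).
Definition cell c : set (R * R) :=
  [set q | grid c.1 q.1 = c.2.1 /\ grid c.1 q.2 = c.2.2].
Definition cell_of n p : nat * (int * int) := (n, (grid n p.1, grid n p.2)).
(** Open for the topology of dyadic squares. As the squares are half-open, they are also closed in
    it, any two are nested or disjoint, and a fine set is a disjoint union of maximal squares whose
    areas add up. *)
Definition fine W : Prop := forall p, W p -> exists n, cell (cell_of n p) `<=` W.

Lemma gridP n x i :
  (grid n x = i) <-> (i%:~R / 2 ^+ n <= x < (i%:~R + 1) / 2 ^+ n).
Proof.
have t0 : 0 < 2 ^+ n :> R by rewrite exprn_gt0.
rewrite ler_pdivrMr // ltr_pdivlMr // ![x * _]mulrC /grid; split=> [<-|h].
  by rewrite floor_le /= -[X in _ + X]/(1%:~R) -intrD floorD1_gt.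
by apply: floor_def; rewrite intrD.
Qed.

Lemma cellE c : cell c =
  [set` `[c.2.1%:~R / 2 ^+ c.1, (c.2.1%:~R + 1) / 2 ^+ c.1 : R[] `*`
  [set` `[c.2.2%:~R / 2 ^+ c.1, (c.2.2%:~R + 1) / 2 ^+ c.1 : R[].
Proof.
by apply/seteqP; split=> p /= [h1 h2]; split; rewrite /= ?in_itv;
  move: h1 h2; rewrite ?in_itv => /gridP ? /gridP ?.
Qed.

Lemma cell_measurable c : measurable (cell c : set T2).
Proof. by rewrite cellE; apply: measurableX; exact: measurable_itv. Qed.

Lemma cell_area c : leb2 (cell c) = ((2 ^+ c.1)^-1 ^+ 2)%:E.
Proof.
have t0 : 0 < 2 ^+ c.1 :> R by rewrite exprn_gt0.
have w i : @lebesgue_measure R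
    [set` `[(i : int)%:~R / 2 ^+ c.1, (i%:~R + 1) / 2 ^+ c.1 : R[] =
    ((2 ^+ c.1)^-1)%:E.
  rewrite lebesgue_measure_itv /= lte_fin ltr_pM2r ?invr_gt0 // ltrDl ltr01.
  by rewrite -EFinB -mulrBl addrAC subrr add0r mul1r.
rewrite cellE product_measure1E; try exact: measurable_itv.
transitivity (((2 ^+ c.1)^-1)%:E * ((2 ^+ c.1)^-1)%:E : \bar R)%E.
  by congr (_ * _)%E; exact: w.
by rewrite -EFinM expr2.
Qed.

(** A dyadic number of level m that separates x from y is also one of level n. *)
Lemma grid_coarse m n x y : (m <= n)%N -> grid n x = grid n y ->
  grid m x = grid m y.
Proof.
move=> mn.
have key u v : grid m u < grid m v -> grid n u < grid n v.
  rewrite {1}/grid floor_lt_int => h.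
  pose z : int := 2 ^+ (n - m) * grid m v.
  have t0 : 0 < 2 ^+ (n - m) :> R by rewrite exprn_gt0.
  have e w : 2 ^+ n * w = 2 ^+ (n - m) * (2 ^+ m * w) :> R.
    by rewrite mulrA -exprD subnK.
  have zE : z%:~R = 2 ^+ (n - m) * (grid m v)%:~R :> R.
    by rewrite /z intrM rmorphXn.
  apply: (@lt_le_trans _ _ z); first by rewrite /grid floor_lt_int e zE ltr_pM2l.
  by rewrite /grid floor_ge_int e zE ler_pM2l // floor_le.
by move=> e; case: (ltgtP (grid m x) (grid m y)) => // /key; rewrite e ltxx.
Qed.

Lemma cell_coarse m n p q : (m <= n)%N -> cell (cell_of n p) q ->
  cell_of m p = cell_of m q.
Proof.
move=> mn [/= h1 h2]; rewrite /cell_of (grid_coarse mn (esym h1)).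
by rewrite (grid_coarse mn (esym h2)).
Qed.

Lemma cell_self n p : cell (cell_of n p) p.
Proof. by []. Qed.

Lemma cell_ofE c p : cell c p -> c = cell_of c.1 p.
Proof. by case: c => n [i j] [/= <- <-]. Qed.

Lemma fine_bigcup (I : Type) (F : I -> set (R * R)) (D : set I) :
  (forall i, fine (F i)) -> fine (\bigcup_(i in D) F i).
Proof.
move=> h p [i Di Fi]; have [n hn] := h i p Fi; exists n => q /hn.
by exists i.
Qed.

Lemma fineI W W' : fine W -> fine W' -> fine (W `&` W').
Proof.
move=> h h' p [/h[n hn] /h'[m hm]]; exists (maxn n m) => q hq; split.
  by apply: hn; rewrite (cell_coarse (leq_maxl n m) hq).
by apply: hm; rewrite (cell_coarse (leq_maxr n m) hq).
Qed.

Lemma fineT : fine setT.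
Proof. by move=> p _; exists 0%N. Qed.

Lemma fine_cell c : fine (cell c).
Proof. by move=> p cp; exists c.1; rewrite -cell_ofE. Qed.

Lemma fine_cellC c : fine (~` cell c).
Proof.
move=> p cp; exists c.1 => q hq cq; apply: cp.
by rewrite (cell_ofE cq) -(cell_coarse (leqnn _) hq).
Qed.

Lemma cell_dist n p q r : cell (cell_of n p) q -> cell (cell_of n p) r ->
  `|q.1 - r.1| <= (2 ^+ n)^-1 /\ `|q.2 - r.2| <= (2 ^+ n)^-1.
Proof.
rewrite /cell /= => -[/gridP/andP[? ?] /gridP/andP[? ?]].
move=> [/gridP/andP[? ?] /gridP/andP[? ?]].
by split; rewrite ler_norml; apply/andP; split; lra.
Qed.

Lemma fine_open W : open W -> fine W.
Proof.
move=> oW p Wp; have /nbhs_ballP[e /= e0 he] := open_nbhs_nbhs (conj oW Wp).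
have [n hn] : exists n, (2 ^+ n)^-1 < e.
  have [n hn] := @exprn_unbounded R 2 e^-1 (ltac:(lra)).
  exists n; rewrite -[e]invrK ltf_pV2 ?posrE ?invr_gt0 ?exprn_gt0 //.
exists n => q hq; apply: he.
have [d1 d2] := cell_dist (cell_self n p) hq.
by split; rewrite /ball /=; lra.
Qed.

Lemma fineE W : fine W -> W = \bigcup_(c in [set c | cell c `<=` W]) cell c.
Proof.
move=> fW; apply/seteqP; split=> [p Wp|p [c cW cp]]; last exact: cW.
by have [n hn] := fW p Wp; exists (cell_of n p).
Qed.

Lemma fine_measurable W : fine W -> measurable (W : set T2).
Proof.
move=> /fineE ->; rewrite bigcup_mkcond.
apply: countable_bigcupT_measurable; first exact: countableP.
by move=> c; case: ifP => _ //; exact: cell_measurable.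
Qed.

Section regularity.
Variable E : set (R * R).
Hypotheses (fE : fine E) (Eoo : (leb2 E < +oo)%E).

(** A form of regularity on E: A and its complement have fine covers with a small overlap. The
    symmetry of the condition makes complements immediate, and the squeezed sets form a
    sigma-algebra that contains the open sets. *)
Definition squeezed (A : set (R * R)) : Prop := forall e : R, 0 < e ->
  exists W W', [/\ fine W /\ fine W', A `<=` W, ~` A `<=` W' &
    (leb2 (W `&` W' `&` E) <= e%:E)%E].

Lemma squeezedC A : squeezed A -> squeezed (~` A).
Proof.
move=> h e /h[W [W' [[f1 f2] s1 s2 hm]]]; exists W', W; split=> //.
  by rewrite setCK.
by rewrite (setIC W').
Qed.

Lemma squeezed_cell c : squeezed (cell c).
Proof.
move=> e e0; exists (cell c), (~` cell c); split=> //.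
  by split; [exact: fine_cell | exact: fine_cellC].
by rewrite setICr set0I measure0 lee_fin ltW.
Qed.

Lemma squeezed0 : squeezed set0.
Proof.
move=> e e0; exists set0, setT; split=> //; last first.
  by rewrite !set0I measure0 lee_fin ltW.
by split; [move=> p | exact: fineT].
Qed.

Lemma fine_bigcap (F : nat -> set (R * R)) n : (forall i, fine (F i)) ->
  fine (\bigcap_(i < n) F i).
Proof.
move=> fF; elim: n => [|n IH].
  have -> : \bigcap_(i < 0%N) F i = setT by apply/seteqP; split=> p.
  exact: fineT.
have -> : \bigcap_(i < n.+1) F i = (\bigcap_(i < n) F i) `&` F n.
  apply/seteqP; split=> p h; first by split=> [i /= /ltnW|]; apply: h => /=.
  move=> i /=; rewrite ltnS leq_eqVlt => /orP[/eqP ->|]; first by case: h.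
  by case: h => h _; exact: h.
exact: fineI.
Qed.

(* The intersections of the unions of the [W n] with the first [N] of the
   [W' n] decrease to a set of measure at most [e / 2]. *)
Lemma squeezed_bigcup (A : nat -> set (R * R)) :
  (forall n, squeezed (A n)) -> squeezed (\bigcup_n A n).
Proof.
move=> h e e0.
have e20 : 0 < e / 2 by rewrite divr_gt0.
have /choice[W /choice[W' hW]] n := h n (e / 2 / (2 ^ n.+1)%:R)
  (ltac:(by rewrite divr_gt0 // ltr0n expn_gt0)).
have fW n : fine (W n) by case: (hW n) => -[].
have fW' n : fine (W' n) by case: (hW n) => -[].
pose U := \bigcup_n W n.
have fU : fine U by exact: fine_bigcup.
pose X N := U `&` \bigcap_(i < N) W' i `&` E.
have fX N : fine (X N) by apply: fineI => //; apply: fineI => //; exact: fine_bigcap.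
have mX N := fine_measurable (fX N).
have mcap : measurable (\bigcap_N X N : set T2) by exact: bigcapT_measurable.
have X0 : (leb2 (X 0%N) < +oo)%E.
  apply: le_lt_trans Eoo; apply: le_measure; rewrite ?inE //.
    exact: fine_measurable.
  by move=> p [].
have Xdec : {homo X : n m / (n <= m)%N >-> (m <= n)%O}.
  move=> n m nm; apply/subsetPset => p [[Up hp] Ep]; split=> //; split=> //.
  by move=> i /= im; apply: hp => /=; exact: leq_trans im nm.
have lim := nonincreasing_cvg_mu X0 mX mcap Xdec.
have small : (leb2 (\bigcap_N X N) <= (e / 2)%:E)%E.
  pose Y n := W n `&` W' n `&` E.
  have mY n : measurable (Y n : set T2).
    by apply: fine_measurable; apply: fineI => //; exact: fineI.
  apply: (le_trans (measure_sigma_subadditive leb2 mY mcap _)).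
    move=> p hp; have [[[n _ Wn] _] Ep] := hp 0%N I.
    exists n => //; split=> //; split=> //.
    by have [[_ hn] _] := hp n.+1 I; exact: (hn n (ltnSn n)).
  apply: (@le_trans _ _ (\sum_(0 <= n <oo) (0 + (e / 2 / (2 ^ n.+1)%:R)%:E))%E).
    apply: lee_nneseries => [n _ _|n _]; first exact: measure_ge0.
    by rewrite add0e; case: (hW n).
  apply: (le_trans (epsilon_trick xpredT _ _)) => //; first exact: ltW.
  by rewrite eseries0 ?add0e.
have [N hN] : exists N, (leb2 (X N) <= e%:E)%E.
  have lt : (leb2 (\bigcap_N X N) < e%:E)%E.
    by apply: (le_lt_trans small); rewrite lte_fin; lra.
  have [N _ hN] := lim _ (open_nbhs_nbhs (conj (@open_ereal_lt_ereal R e%:E) lt)).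
  by exists N; apply: ltW; exact: (hN N (leqnn N)).
exists U, (\bigcap_(i < N) W' i); split=> //.
- by split=> //; exact: fine_bigcap.
- by move=> p [n _ Ap]; exists n => //; case: (hW n) => _ + _ _; apply.
- move=> p nA i _; case: (hW i) => _ _ + _; apply => Ap.
  by apply: nA; exists i.
Qed.

Lemma squeezed_borel (B : set (borel (planeT R))) : measurable B -> squeezed B.
Proof.
apply: smallest_sub => [|U oU].
  split=> [|A hA|F hF]; first exact: squeezed0.
  - by rewrite setTD; exact: squeezedC.
  - exact: squeezed_bigcup.
rewrite (fineE (fine_open oU)) bigcup_mkcond.
pose F k := if @pickle_inv (nat * (int * int))%type k is Some c then
  (if c \in [set c | cell c `<=` U] then cell c else set0) else set0.
have -> : \bigcup_c (if c \in [set c | cell c `<=` U] then cell c else set0) =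
    \bigcup_k F k.
  apply/seteqP; split=> [p [c _ cp]|p [k _]].
    by exists (pickle c) => //; rewrite /F pickleK_inv.
  by rewrite /F; case: pickle_inv => // c cp; exists c.
apply: squeezed_bigcup => k; rewrite /F; case: pickle_inv => [c|].
  by case: ifP => _; [exact: squeezed_cell | exact: squeezed0].
exact: squeezed0.
Qed.

(** Inside E, the cover of B exceeds B only by points of its overlap with the cover of the
    complement. *)
Lemma null_fine_cover (B : set (borel (planeT R))) (e : R) : measurable B ->
  leb2 B = 0%E -> 0 < e ->
  exists W, [/\ fine W, B `<=` W & (leb2 (W `&` E) <= e%:E)%E].
Proof.
move=> mB B0 e0; have [W [W' [[fW fW'] BW BW' hm]]] := squeezed_borel mB e0.
exists W; split=> //.
have mB2 := borel_measurable2 mB.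
have mW := fine_measurable (fineI (fineI fW fW') fE).
have : (leb2 (W `&` E) <= leb2 (B `|` (W `&` W' `&` E)))%E.
  apply: le_measure; rewrite ?inE.
  - by apply: fine_measurable; exact: fineI.
  - exact: measurableU.
  - move=> p [Wp Ep]; case: (pselect (B p)) => Bp; [by left|right].
    by split=> //; split=> //; exact: BW'.
move=> /le_trans; apply; apply: (le_trans (measureU2 leb2 _ _)) => //.
by rewrite -[e%:E]add0e; apply: leeD => //; rewrite -B0.
Qed.

End regularity.

(** Outer measure zero, stated for arbitrary sets so that it applies to images before their
    measurability is known. *)
Definition thin (A : set (R * R)) : Prop := forall e : R, 0 < e ->
  exists X : set T2, [/\ measurable X, A `<=` X & (leb2 X <= e%:E)%E].

Lemma thin_sub A B : A `<=` B -> thin B -> thin A.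
Proof.
move=> AB h e /h[X [mX BX hX]]; exists X; split=> //.
exact: subset_trans BX.
Qed.

Lemma thin0 : thin set0.
Proof. by move=> e e0; exists set0; split; rewrite ?measure0 ?lee_fin ?ltW //; exact: measurable0. Qed.

Lemma thin_bigcup (I : countType) (F : I -> set (R * R)) :
  (forall i, thin (F i)) -> thin (\bigcup_i F i).
Proof.
move=> h e e0.
have hX k : exists X : set T2, [/\ measurable X,
    (forall i, @pickle_inv I k = Some i -> F i `<=` X) &
    (leb2 X <= (e / (2 ^ k.+1)%:R)%:E)%E].
  have ek : 0 < e / (2 ^ k.+1)%:R by rewrite divr_gt0 // ltr0n expn_gt0.
  case: (@pickle_inv I k) => [i|].
    by have [X [mX FX lX]] := h i _ ek; exists X; split=> // j [<-].
  by exists set0; split; rewrite ?measure0 ?lee_fin ?ltW //; exact: measurable0.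
have [X hX'] := choice hX.
have mX k : measurable (X k) by case: (hX' k).
have mU : measurable (\bigcup_k X k) by exact: bigcupT_measurable.
exists (\bigcup_k X k); split=> //.
  move=> p [i _ Fp]; exists (pickle i) => //.
  by case: (hX' (pickle i)) => _ + _; apply; first exact: pickleK_inv.
apply: (le_trans (measure_sigma_subadditive leb2 mX mU _)) => //.
apply: (@le_trans _ _ (\sum_(0 <= n <oo) (0 + (e / (2 ^ n.+1)%:R)%:E))%E).
  apply: lee_nneseries => [n _ _|n _]; first exact: measure_ge0.
  by rewrite add0e; case: (hX' n).
apply: (le_trans (epsilon_trick xpredT _ _)) => //; first exact: ltW.
by rewrite eseries0 ?add0e.
Qed.

Lemma thinU A B : thin A -> thin B -> thin (A `|` B).
Proof.
move=> hA hB; have -> : A `|` B = \bigcup_(b : bool) (if b then A else B).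
  apply/seteqP; split=> p; first by case=> h; [exists true|exists false].
  by move=> [[] _ h]; [left|right].
by apply: thin_bigcup => -[].
Qed.

Lemma thin_null (A : set T2) : measurable A -> thin A -> leb2 A = 0%E.
Proof.
move=> mA h; apply/eqP; rewrite eq_le measure_ge0 andbT.
apply/lee_addgt0Pr => e /h[X [mX AX hX]]; rewrite add0e.
by apply: le_trans hX; apply: le_measure; rewrite ?inE.
Qed.

Definition dist1 p q : R := `|p.1 - q.1| + `|p.2 - q.2|.

(* [B] is covered by a small disjoint union of grid squares, whose images are
   contained in squares of comparable size. *)
Lemma lipschitz_thin (G : R * R -> R * R) (E : set (R * R)) (k : R)
    (B : set (borel (planeT R))) :
  fine E -> (leb2 E < +oo)%E -> 0 < k ->
  (forall p q, E p -> E q -> `|(G p).1 - (G q).1| <= k * dist1 p q /\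
                             `|(G p).2 - (G q).2| <= k * dist1 p q) ->
  measurable B -> leb2 B = 0%E -> thin (G @` (B `&` E)).
Proof.
move=> fE Eoo k0 hG mB B0 e e0.
(* Two points of a cell of side h have images within 2 k h in each coordinate. The image thus fits
   in a square of side 4 k h, whence the factor 16 k^2 on areas. *)
have C0 : 0 < 16 * k ^+ 2 by rewrite mulr_gt0 // exprn_gt0.
have [W0 [fW0 BW0 lW0]] := null_fine_cover fE Eoo mB B0 (divr_gt0 e0 C0).
pose W := W0 `&` E; have fW : fine W by exact: fineI.
(* [D c] is [cell c] when this cell is maximal among those contained in W, and is empty otherwise.
   Distinct [D c] are therefore disjoint and their total area is at most that of W. *)
pose D c := [set p | [/\ cell c p, cell c `<=` W &
  forall m, (m < c.1)%N -> ~ cell (cell_of m p) `<=` W]].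
have Dcell c p : D c p -> D c = cell c.
  move=> [cp cW hm]; apply/seteqP; split=> [q []//|q cq]; split=> // m mc.
  have : cell (cell_of c.1 p) q by rewrite -(cell_ofE cp).
  by move=> /(cell_coarse (ltnW mc)) <-; exact: hm.
have mD c : measurable (D c : set T2).
  have [->|/set0P[p Dp]] := eqVneq (D c) set0; first exact: measurable0.
  by rewrite (Dcell _ _ Dp); exact: cell_measurable.
have hS c : exists S : set T2, [/\ measurable S, G @` D c `<=` S &
    (leb2 S <= (16 * k ^+ 2)%:E * leb2 (D c))%E].
  have [->|/set0P[p Dp]] := eqVneq (D c) set0.
    by exists set0; split; rewrite ?image_set0 ?measure0 ?mule0 //; exact: measurable0.
  have [h hE] : exists h : R, h = (2 ^+ c.1)^-1 by eexists.
  have h0 : 0 < h by rewrite hE invr_gt0 exprn_gt0.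
  have kh : 0 < k * h by exact: mulr_gt0.
  pose J (u : R) : set (measurableTypeR R) := [set` `[u - 2 * (k * h), u + 2 * (k * h)]].
  have lJ u : @lebesgue_measure R (J u) = (4 * (k * h))%:E.
    rewrite /J lebesgue_measure_itv /= lte_fin ifT; last by lra.
    by rewrite -EFinB; congr (_%:E); ring.
  have mJ u : measurable (J u) by exact: measurable_itv.
  exists (J (G p).1 `*` J (G p).2); split; first exact: measurableX.
    move=> _ [q Dq <-]; have [cp cW _] := Dp; have [cq _ _] := Dq.
    have [? ?] := cW _ cp; have [? ?] := cW _ cq.
    have [g1 g2] := hG q p ltac:(by []) ltac:(by []).
    have [d1 d2] : `|q.1 - p.1| <= h /\ `|q.2 - p.2| <= h.
      by rewrite hE; apply: (@cell_dist c.1 p); rewrite -(cell_ofE cp).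
    have dk : k * dist1 q p <= 2 * (k * h).
      rewrite mulrCA; apply: ler_wpM2l; first exact: ltW.
      by move: d1 d2; rewrite /dist1; lra.
    split; rewrite /J /= in_itv /= -ler_distl.
      exact: le_trans g1 dk.
    exact: le_trans g2 dk.
  have eJ u v : (@lebesgue_measure R (J u) * @lebesgue_measure R (J v))%E =
      (4 * (k * h) * (4 * (k * h)))%:E by rewrite !lJ EFinM.
  rewrite product_measure1E // [X in (X <= _)%E](eJ _ _) (Dcell _ _ Dp) cell_area.
  rewrite -hE -EFinM lee_fin.
  by rewrite le_eqVlt; apply/orP; left; apply/eqP; ring.
have [S hS'] := choice hS.
pose S' n := if @pickle_inv (nat * (int * int))%type n is Some c then S c else set0.
pose D' n := if @pickle_inv (nat * (int * int))%type n is Some c then D c else set0.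
have mS' n : measurable (S' n).
  by rewrite /S'; case: pickle_inv => [c|]; [case: (hS' c)|exact: measurable0].
have mD' n : measurable (D' n : set T2).
  by rewrite /D'; case: pickle_inv => [c|]; [exact: mD|exact: measurable0].
have mU : measurable (\bigcup_n S' n) by exact: bigcupT_measurable.
exists (\bigcup_n S' n); split=> //.
  move=> _ [p [Bp Ep] <-]; have Wp : W p by split=> //; exact: BW0.
  have ex : exists n, `[< cell (cell_of n p) `<=` W >].
    by have [n hn] := fW p Wp; exists n; apply/asboolP.
  case: (ex_minnP ex) => n /asboolP hn min.
  exists (pickle (cell_of n p)) => //; rewrite /S' pickleK_inv.
  case: (hS' (cell_of n p)) => _ + _; apply; exists p => //; split=> //= m mn.
  by move=> /asboolP /min; rewrite leqNgt mn.
apply: (le_trans (measure_sigma_subadditive leb2 mS' mU _)) => //.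
apply: (@le_trans _ _ (\sum_(0 <= n <oo) ((16 * k ^+ 2)%:E * leb2 (D' n)))%E).
  apply: lee_nneseries => [n _ _|n _]; first exact: measure_ge0.
  rewrite /S' /D'; case: pickle_inv => [c|]; first by case: (hS' c).
  by rewrite !measure0 mule0.
rewrite nneseriesZl; last by move=> n _; exact: measure_ge0.
have tD : trivIset setT D'.
  apply/trivIsetP => i j _ _ ij; apply/seteqP; split=> // p [].
  rewrite /D'; have := @pickle_invK (nat * (int * int))%type i.
  have := @pickle_invK (nat * (int * int))%type j.
  case: (@pickle_inv _ i) => [c|] //=; case: (@pickle_inv _ j) => [c'|] //= ej ei.
  move=> [cp cW hc] [cp' cW' hc']; case/eqP: ij; rewrite -ei -ej; congr pickle.
  rewrite (cell_ofE cp) (cell_ofE cp'); congr cell_of.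
  case: (ltngtP c.1 c'.1) => // lt.
    by case: (hc' _ lt); rewrite -(cell_ofE cp).
  by case: (hc _ lt); rewrite -(cell_ofE cp').
have mUD : measurable (\bigcup_n D' n : set T2) by exact: bigcupT_measurable.
rewrite -(measure_semi_bigcup leb2 mD' tD mUD).
apply: (@le_trans _ _ ((16 * k ^+ 2)%:E * (e / (16 * k ^+ 2))%:E)%E).
  rewrite lee_wpmul2l ?lee_fin ?(ltW C0) //; apply: le_trans lW0.
  apply: le_measure; rewrite ?inE //; first exact: fine_measurable.
  by move=> p [n _]; rewrite /D'; case: pickle_inv => // c [cp cW _]; exact: cW.
by rewrite -EFinM lee_fin mulrC divfK // gt_eqF.
Qed.

End grid_cells.

(** * Locally Lipschitz functions *)

Section locally_lipschitz.
Variable R : realType.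
Implicit Types (f g : R * R -> R) (F G : R * R -> R * R) (p q : R * R).
Local Notation T2 := (measurableTypeR R * measurableTypeR R)%type.
Local Notation leb2 := (@lebesgue_measure R \x @lebesgue_measure R)%E.

(** A local constant suffices for a cover by countably many boxes and, unlike a global one, survives
    products and inverses. *)
Definition loclip f : Prop := forall p, exists k : R, exists2 A, nbhs p A &
  0 <= k /\ forall x y, A x -> A y -> `|f x - f y| <= k * dist1 x y.

Lemma dist1_ge0 p q : 0 <= dist1 p q.
Proof. by rewrite addr_ge0. Qed.

Lemma near_dist1 p (e : R) : 0 < e -> \forall q \near p, dist1 q p < e.
Proof.
move=> e0; apply/nbhs_ballP; exists (e / 2) => /=; first by rewrite divr_gt0.
by move=> q [/=]; rewrite /ball /= (distrC p.1) (distrC p.2) /dist1; lra.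
Qed.

Lemma loclip_cst (c : R) : loclip (fun _ => c).
Proof.
move=> p; exists 0; exists setT; first exact: filterT.
by split=> // x y _ _; rewrite subrr normr0 mul0r.
Qed.

Lemma loclip_fst : loclip fst.
Proof.
move=> p; exists 1; exists setT; first exact: filterT.
by split=> // x y _ _; rewrite mul1r lerDl.
Qed.

Lemma loclip_snd : loclip snd.
Proof.
move=> p; exists 1; exists setT; first exact: filterT.
by split=> // x y _ _; rewrite mul1r lerDr.
Qed.

(* Covers sums, maxima, minima and all other jointly 1-Lipschitz operations. *)
Lemma loclip_op2 (op : R -> R -> R) f g :
  (forall a b c d, `|op a b - op c d| <= `|a - c| + `|b - d|) ->
  loclip f -> loclip g -> loclip (fun p => op (f p) (g p)).
Proof.
move=> hop hf hg p; have [k [A nA [k0 hk]]] := hf p.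
have [l [B nB [l0 hl]]] := hg p.
exists (k + l); exists (A `&` B); first exact: filterI.
split=> [|x y [Ax Bx] [Ay By]]; first exact: addr_ge0.
by apply: (le_trans (hop _ _ _ _)); rewrite mulrDl lerD ?hk ?hl.
Qed.

Lemma loclip_add f g : loclip f -> loclip g -> loclip (fun p => f p + g p).
Proof.
apply: (@loclip_op2 +%R) => a b c d.
by rewrite opprD addrACA ler_normD.
Qed.

Lemma loclip_max f g : loclip f -> loclip g -> loclip (fun p => Num.max (f p) (g p)).
Proof.
apply: (@loclip_op2 Num.max) => a b c d.
rewrite ler_norml; case: (leP a b); case: (leP c d); case: (ger0P (a - c));
  case: (ger0P (b - d)) => *; apply/andP; split; lra.
Qed.

Lemma loclip_min f g : loclip f -> loclip g -> loclip (fun p => Num.min (f p) (g p)).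
Proof.
apply: (@loclip_op2 Num.min) => a b c d.
rewrite ler_norml; case: (leP a b); case: (leP c d); case: (ger0P (a - c));
  case: (ger0P (b - d)) => *; apply/andP; split; lra.
Qed.

Lemma loclip_opp f : loclip f -> loclip (fun p => - f p).
Proof.
move=> hf p; have [k [A nA [k0 hk]]] := hf p.
exists k; exists A => //; split=> // x y Ax Ay.
by rewrite -opprD normrN hk.
Qed.

Lemma loclip_norm f : loclip f -> loclip (fun p => `|f p|).
Proof.
move=> hf p; have [k [A nA [k0 hk]]] := hf p.
exists k; exists A => //; split=> // x y Ax Ay.
exact: le_trans (ler_dist_dist _ _) (hk _ _ Ax Ay).
Qed.

Lemma loclip_bound f p : loclip f -> exists2 C : R, 0 <= C &
  \forall q \near p, `|f q| <= C.
Proof.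
move=> /(_ p)[k [A nA [k0 hk]]]; exists (`|f p| + k); first exact: addr_ge0.
near=> q; have Ap : A p by exact: nbhs_singleton.
have : `|f q - f p| <= k * dist1 q p by apply: hk => //; near: q.
have d : dist1 q p < 1 by near: q; exact: near_dist1.
have : k * dist1 q p <= k by rewrite ler_piMr // ltW.
have := ler_normD (f q - f p) (f p); rewrite subrK; lra.
Unshelve. all: by end_near. Qed.

Lemma loclip_mul f g : loclip f -> loclip g -> loclip (fun p => f p * g p).
Proof.
move=> hf hg p; have [C C0 hC] := loclip_bound p hf.
have [D D0 hD] := loclip_bound p hg.
have [k [A nA [k0 hk]]] := hf p; have [l [B nB [l0 hl]]] := hg p.
exists (C * l + D * k).
exists ((A `&` B) `&` ([set q | `|f q| <= C] `&` [set q | `|g q| <= D])).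
  by apply: filterI; exact: filterI.
split=> [|x y [[Ax Bx] [Cx Dx]] [[Ay By] [Cy Dy]]].
  by rewrite addr_ge0 // mulr_ge0.
have -> : f x * g x - f y * g y = f x * (g x - g y) + (f x - f y) * g y by ring.
apply: (le_trans (ler_normD _ _)); rewrite !normrM mulrDl lerD //.
  by rewrite -mulrA ler_pM // hl.
by rewrite mulrC -mulrA ler_pM // hk.
Qed.

Lemma loclip_inv f : loclip f -> (forall p, f p != 0) -> loclip (fun p => (f p)^-1).
Proof.
move=> hf f0 p; have [k [A nA [k0 hk]]] := hf p.
have c0 : 0 < `|f p| by rewrite normr_gt0.
have Ap : A p by exact: nbhs_singleton.
pose B := [set q | `|f p| / 2 <= `|f q|].
have nB : nbhs p B.
  near=> q; rewrite /B /=.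
  have h1 : `|f q - f p| <= k * dist1 q p by apply: hk => //; near: q.
  have d : dist1 q p < `|f p| / (2 * (k + 1)).
    by near: q; apply: near_dist1; rewrite divr_gt0 //; lra.
  have : k * dist1 q p <= `|f p| / 2.
    have : (k + 1) * dist1 q p <= (k + 1) * (`|f p| / (2 * (k + 1))).
      by rewrite ler_pM2l ?ltW //; lra.
    have -> : (k + 1) * (`|f p| / (2 * (k + 1))) = `|f p| / 2 by field; lra.
    by have := dist1_ge0 q p; lra.
  have := ler_distD (f q) (f p) 0; rewrite !subr0 distrC; lra.
exists (k * (`|f p| / 2) ^- 2); exists (A `&` B); first exact: filterI.
split=> [|x y [Ax Bx] [Ay By]].
  by rewrite mulr_ge0 // invr_ge0 exprn_ge0 // divr_ge0 // ltW.
have -> : (f x)^-1 - (f y)^-1 = (f y - f x) * ((f x)^-1 * (f y)^-1).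
  by field; rewrite !f0.
rewrite normrM distrC mulrAC ler_pM ?hk // normrM !normfV expr2 invfM.
have c2 : 0 < `|f p| / 2 by rewrite divr_gt0.
by rewrite ler_pM ?invr_ge0 // lef_pV2 // posrE // (lt_le_trans c2).
Unshelve. all: by end_near. Qed.

Lemma loclip_comp f F : loclip (fst \o F) -> loclip (snd \o F) -> continuous F ->
  loclip f -> loclip (f \o F).
Proof.
move=> h1 h2 cF hf p; have [k [A nA [k0 hk]]] := hf (F p).
have [l [B nB [l0 hl]]] := h1 p; have [m [C nC [m0 hm]]] := h2 p.
exists (k * (l + m)); exists (F @^-1` A `&` (B `&` C)).
  by apply: filterI; [exact: cF | exact: filterI].
split=> [|x y [Ax [Bx Cx]] [Ay [By Cy]]]; first by rewrite mulr_ge0 // addr_ge0.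
apply: (le_trans (hk _ _ Ax Ay)); rewrite -mulrA ler_wpM2l // mulrDl.
by apply: lerD; [exact: hl | exact: hm].
Qed.

Lemma rbox_finite (q : (rat * rat) * (rat * rat)) : (leb2 (@rbox R q) < +oo)%E.
Proof.
have -> : @rbox R q = [set` `](ratr q.1.1 : R), (ratr q.1.2 : R)[] `*`
    [set` `](ratr q.2.1 : R), (ratr q.2.2 : R)[].
  by apply/seteqP; split=> p; rewrite /rbox /= !in_itv.
rewrite product_measure1E; try exact: measurable_itv.
have w (a b : R) : exists2 c : R, 0 <= c &
    @lebesgue_measure R [set` `]a, b[] = c%:E.
  rewrite lebesgue_measure_itv /= lte_fin; case: ifP => [ab|_]; last by exists 0.
  by exists (b - a); rewrite ?EFinB // subr_ge0 ltW.
have [c _ ec] := w (ratr q.1.1) (ratr q.1.2).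
have [d _ ed] := w (ratr q.2.1) (ratr q.2.2).
have -> : (@lebesgue_measure R [set` `](ratr q.1.1 : R), (ratr q.1.2 : R)[] *
  @lebesgue_measure R [set` `](ratr q.2.1 : R), (ratr q.2.2 : R)[] = (c * d)%:E)%E.
  by rewrite EFinM; congr (_ * _)%E; [exact: ec|exact: ed].
exact: ltry.
Qed.

(** The rational boxes on which G is Lipschitz cover the plane; they are countably many and of
    finite area. *)
Lemma loclip_thin G (B : set (borel (planeT R))) :
  loclip (fst \o G) -> loclip (snd \o G) ->
  measurable B -> leb2 B = 0%E -> thin (G @` B).
Proof.
move=> h1 h2 mB B0.
pose good (q : (rat * rat) * (rat * rat)) := exists2 k : R, 0 < k & forall x y, @rbox R q x -> @rbox R q y ->
  `|(G x).1 - (G y).1| <= k * dist1 x y /\ `|(G x).2 - (G y).2| <= k * dist1 x y.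
pose F (q : (rat * rat) * (rat * rat)) := if `[< good q >] then G @` (B `&` @rbox R q) else set0.
apply: (@thin_sub _ _ (\bigcup_q F q)); last first.
  apply: thin_bigcup => q; rewrite /F; case: asboolP => [[k k0 hk]|_].
    apply: (lipschitz_thin _ _ k0) => //; last exact: rbox_finite.
    by apply: fine_open; exact: rbox_open.
  exact: thin0.
move=> _ [p Bp <-].
have [k [A nA [k0 hk]]] := h1 p; have [l [C nC [l0 hl]]] := h2 p.
have [q qp hq] := rbox_nbhs (filterI nA nC).
exists q => //; rewrite /F asboolT; first by exists p.
exists (k + l + 1) => [|x y /hq[Ax Cx] /hq[Ay Cy]]; first by lra.
have := hk _ _ Ax Ay; have := hl _ _ Cx Cy; have := dist1_ge0 x y => /=.
by move=> d u v; split; nra.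
Qed.

End locally_lipschitz.

Ltac loclip := lazymatch goal with
  | |- @loclip _ (fun _ => ?c) => exact: (@loclip_cst _ c)
  | |- @loclip _ (fun p => @?F p + @?G p) => apply: (@loclip_add _ F G); loclip
  | |- @loclip _ (fun p => - @?F p) => apply: (@loclip_opp _ F); loclip
  | |- @loclip _ (fun p => @?F p * @?G p) => apply: (@loclip_mul _ F G); loclip
  | |- @loclip _ (fun p => Num.max (@?F p) (@?G p)) =>
      apply: (@loclip_max _ F G); loclip
  | |- @loclip _ (fun p => Num.min (@?F p) (@?G p)) =>
      apply: (@loclip_min _ F G); loclip
  | |- @loclip _ (fun p => Num.norm (@?F p)) => apply: (@loclip_norm _ F); loclip
  | |- @loclip _ (fun p => p.1) => exact: loclip_fst
  | |- @loclip _ (fun p => p.2) => exact: loclip_snd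
  | |- _ => try assumption
  end.

(** * Null sets under the Bowen map and its inverse *)

Section nonsingular_maps.
Variable R : realType.
Implicit Types (p q : R * R) (F G : R * R -> R * R).
Local Notation leb2 := (@lebesgue_measure R \x @lebesgue_measure R)%E.

Definition map_loclip F : Prop := loclip (fst \o F) /\ loclip (snd \o F).

Lemma depth_loclip : loclip (@depth R).
Proof. by rewrite /depth; loclip. Qed.

Lemma al_loclip : loclip (@al R).
Proof. by have h := depth_loclip; rewrite /al; loclip. Qed.

Lemma be_loclip : loclip (@be R).
Proof. by have h := depth_loclip; rewrite /be; loclip. Qed.

Lemma theta_loclip : loclip (@theta R).
Proof. by have h := al_loclip; have h' := be_loclip; rewrite /theta; loclip. Qed.

Lemma rot_loclip : map_loclip (@rot R).
Proof. by split; rewrite /rot /comp /=; loclip. Qed.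

Lemma refl_loclip : map_loclip (@refl R).
Proof. by split; rewrite /refl /comp /=; loclip. Qed.

Lemma half_piece_loclip kap (J J' : R) c : 1 < J -> 1 < J' -> map_loclip (fun p =>
  pt c (al p * stretch kap J J' (theta p) (be p) / speed kap J (theta p))
       (be p * speed kap J (theta p) / stretch kap J J' (theta p) (be p))).
Proof.
move=> J1 J1'; have cth := theta_loclip; have cbe := be_loclip.
have cal := al_loclip.
have cspeed I : loclip (fun p : R * R => speed kap I (theta p)).
  by rewrite /speed /rate; loclip.
have s0 I p : 1 < I -> speed kap I (theta p) != 0.
  by move=> I1; have := speed_ge1 kap (theta p) I1; lra.
have cJ := cspeed J.
have cJi' : loclip (fun p : R * R => (speed kap J' (theta p))^-1).
  by apply: loclip_inv => // p; exact: s0.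
have cJi : loclip (fun p : R * R => (speed kap J (theta p))^-1).
  by apply: loclip_inv => // p; exact: s0.
pose mx p := Num.max 1 (speed kap J (theta p) * be p).
have cmx : loclip mx by rewrite /mx; loclip.
have cland : loclip (fun p => land kap J J' (theta p) (mx p)).
  by rewrite /land; loclip.
have land0 p : land kap J J' (theta p) (mx p) != 0.
  have := speed_ge1 kap (theta p) J1 => s1.
  by rewrite gt_eqF // (land_gt0 J1 J1') // ge_max s1 ler_piMr ?be_le1 //; lra.
have clandi : loclip (fun p => (land kap J J' (theta p) (mx p))^-1).
  exact: loclip_inv.
have cst : loclip (fun p => stretch kap J J' (theta p) (be p)).
  by rewrite /stretch; loclip.
have csti : loclip (fun p => (stretch kap J J' (theta p) (be p))^-1).
  apply: loclip_inv => // p; rewrite /stretch mulf_neq0 ?invr_eq0 ?land0 //.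
  by rewrite gt_eqF // lt_max ltr01.
by split; rewrite /pt /comp /=; loclip.
Qed.

Lemma push_loclip kap : map_loclip (push kap).
Proof.
have h := depth_loclip.
have hg : loclip (@gauge' R) by rewrite /gauge' /gauge; loclip.
have hi : loclip (fun p : R * R => (gauge' p)^-1).
  by apply: loclip_inv => // p; rewrite gt_eqF // gauge'_gt0.
have hb : loclip (bound kap) by rewrite /bound; loclip.
by split; rewrite /push /scale /pushf /comp /=; loclip.
Qed.

Lemma pull_loclip kap : map_loclip (pull kap).
Proof.
have h := depth_loclip.
have hg : loclip (@gauge' R) by rewrite /gauge' /gauge; loclip.
have hi : loclip (fun p : R * R => (gauge' p)^-1).
  by apply: loclip_inv => // p; rewrite gt_eqF // gauge'_gt0.
have hb : loclip (bound kap) by rewrite /bound; loclip.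
by split; rewrite /pull /scale /pullf /comp /=; loclip.
Qed.

Lemma map_loclip_comp F G : map_loclip F -> continuous F -> map_loclip G ->
  map_loclip (G \o F).
Proof.
by move=> [h1 h2] cF [h3 h4]; split; [exact: (loclip_comp h1 h2 cF h3)|
  exact: (loclip_comp h1 h2 cF h4)].
Qed.

Definition null_image F : Prop := forall B : set (borel (planeT R)),
  measurable B -> leb2 B = 0%E -> thin (F @` B).

Lemma map_loclip_null F : map_loclip F -> null_image F.
Proof. by move=> [h1 h2] B mB B0; exact: loclip_thin. Qed.

Lemma half_piece_null kap (J J' : R) c : 1 < J -> 1 < J' -> null_image (fun p =>
  pt c (al p * stretch kap J J' (theta p) (be p) / speed kap J (theta p))
       (be p * speed kap J (theta p) / stretch kap J J' (theta p) (be p))).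
Proof. by move=> J1 J1'; exact/map_loclip_null/half_piece_loclip. Qed.

(** Each of the four branches of [step] is given by a formula that is locally Lipschitz on the whole
    plane, and the image of B lies in the union of its images under them. *)
Lemma step_null kap (L K : R) : 1 < L -> 1 < K -> null_image (step kap L K).
Proof.
move=> L1 K1 B mB B0.
pose H J J' c p :=
  pt c (al p * stretch kap J J' (theta p) (be p) / speed kap J (theta p))
       (be p * speed kap J (theta p) / stretch kap J J' (theta p) (be p)).
apply: (@thin_sub _ _ ((H L K true @` B `|` H L K false @` B) `|`
    ((@rot R \o (H K L true \o @rot R)) @` B `|`
     (@rot R \o (H K L false \o @rot R)) @` B))).
  move=> _ [p Bp <-]; rewrite /step; case: ifP => _.
    by left; rewrite /half; case: (1 < _); [left|right]; exists p.
  by right; rewrite /half; case: (1 < _); [left|right]; exists p.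
have hL c : thin (H L K c @` B) by exact: half_piece_null.
have hK c : thin ((@rot R \o (H K L c \o @rot R)) @` B).
  have rc := @rot_continuous R; have hp := half_piece_loclip kap c K1 L1.
  have h1 : map_loclip (H K L c \o @rot R).
    exact: (map_loclip_comp rot_loclip rc hp).
  apply: loclip_thin => //.
    by apply: loclip_opp; case: h1.
  by apply: loclip_opp; case: h1.
by apply: thinU; apply: thinU.
Qed.

Lemma preimage_borel F (B : set (borel (planeT R))) : continuous F ->
  measurable B -> measurable (F @^-1` B : set (borel (planeT R))).
Proof.
move=> cF; pose C := [set A : set (borel (planeT R)) |
  measurable (F @^-1` A : set (borel (planeT R)))].
apply: (@smallest_sub _ _ _ C); last first.
  move=> U oU; apply: sub_sigma_algebra.
  by apply: open_comp => // p _; exact: cF.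
split=> [|A mA|A mA]; rewrite /C /=.
- by rewrite preimage_set0; exact: measurable0.
- by rewrite setTD preimage_setC; exact: measurableC.
- by rewrite preimage_bigcup; exact: bigcupT_measurable.
Qed.

(** A preimage under F is an image under its inverse G, and continuity of F makes it Borel, which
    turns thin into null. *)
Lemma null_image_homeo F G (B : set (borel (planeT R))) : null_image G ->
  cancel F G -> cancel G F -> continuous F -> measurable B -> leb2 B = 0%E ->
  measurable (F @^-1` B : set (borel (planeT R))) /\ leb2 (F @^-1` B) = 0%E.
Proof.
move=> nG FK GK cF mB B0; have mF := preimage_borel cF mB; split=> //.
have e : F @^-1` B = G @` B.
  apply/seteqP; split=> [p Bp|_ [p Bp <-]]; last by rewrite /preimage /= GK.
  by exists (F p) => //; rewrite FK.
apply: thin_null; first exact: borel_measurable2.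
by rewrite e; exact: nG.
Qed.

Section bowen_null.
Variables (kap L K : R).
Hypotheses (L1 : 1 < L) (K1 : 1 < K) (LK : L * K = kap).
Let k1 : 1 < kap. Proof. exact: (kap_gt1 L1 K1 LK). Qed.

Lemma refl_preimage_null (B : set (borel (planeT R))) :
  measurable B -> leb2 B = 0%E ->
  measurable (@refl R @^-1` B : set (borel (planeT R))) /\
  leb2 (@refl R @^-1` B) = 0%E.
Proof.
apply: (@null_image_homeo (@refl R) (@refl R)); try exact: reflK.
- exact/map_loclip_null/refl_loclip.
- exact: refl_continuous.
Qed.

Lemma back_preimage_null (B : set (borel (planeT R))) :
  measurable B -> leb2 B = 0%E ->
  measurable (back kap L K @^-1` B : set (borel (planeT R))) /\
  leb2 (back kap L K @^-1` B) = 0%E.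
Proof.
apply: (@null_image_homeo _ (step kap L K)).
- exact: step_null.
- exact: (backK L1 K1 LK).
- exact: (stepK L1 K1 LK).
- exact: (back_continuous L1 K1 LK).
Qed.

(* [step] is the conjugate of its inverse [back] by the reflection [refl]. *)
Lemma step_preimage_null (B : set (borel (planeT R))) :
  measurable B -> leb2 B = 0%E ->
  measurable (step kap L K @^-1` B : set (borel (planeT R))) /\
  leb2 (step kap L K @^-1` B) = 0%E.
Proof.
move=> mB B0; have [m1 n1] := refl_preimage_null mB B0.
have [m2 n2] := back_preimage_null m1 n1.
have [m3 n3] := refl_preimage_null m2 n2.
suff <- : @refl R @^-1` (back kap L K @^-1` (@refl R @^-1` B)) =
    step kap L K @^-1` B by [].
by apply/funext => p; rewrite /preimage /= /back !reflK.
Qed.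

Lemma bowen_preimage_null (B : set (borel (planeT R))) :
  measurable B -> leb2 B = 0%E -> leb2 (bowen kap L K @^-1` B) = 0%E.
Proof.
move=> mB B0; have [m1 n1] := step_preimage_null mB B0.
have [] // := @null_image_homeo (push kap) (pull kap) _ _ _ _ _ m1 n1.
- exact/map_loclip_null/pull_loclip.
- exact: (pushK k1).
- exact: (pullK k1).
- exact: push_continuous.
Qed.

Lemma bowen_inv_preimage_null (B : set (borel (planeT R))) :
  measurable B -> leb2 B = 0%E -> leb2 (bowen_inv kap L K @^-1` B) = 0%E.
Proof.
move=> mB B0.
have [||||m1 n1] // := @null_image_homeo (pull kap) (push kap) _ _ _ _ _ mB B0.
- exact/map_loclip_null/push_loclip.
- exact: (pullK k1).
- exact: (pushK k1).
- exact: pull_continuous.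
by have [_] := back_preimage_null m1 n1.
Qed.

Lemma bowen_nonsingular : @nonsingular R (plane R) (bowen kap L K).
Proof.
move=> B mB; split=> [h|]; last exact: bowen_preimage_null.
have mP := preimage_borel (bowen_continuous L1 K1 LK) mB.
have := bowen_inv_preimage_null mP h.
suff -> : bowen_inv kap L K @^-1` (bowen kap L K @^-1` B) = B by [].
by apply/funext => p; rewrite /preimage /= (bowen_invK L1 K1 LK).
Qed.

End bowen_null.
End nonsingular_maps.

(** * Affine local forms *)

Section local_forms.
Variable R : realType.
Implicit Types (p q : R * R) (F G : R * R -> R * R) (J c : R).

(** Near its three fixed points the map is exactly affine. There its partial derivatives are locally
    constant, so C^1 regularity and Jacobians follow from this predicate. *)
Definition affine_near F p : Prop := exists u v w : 'I_2 -> R,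
  \forall q \near p, forall a, Defs.coord a (F q) = u a + v a * q.1 + w a * q.2.

Lemma near_nbhs (P : R * R -> Prop) p : (\forall q \near p, P q) ->
  \forall q \near p, \forall r \near q, P r.
Proof. by move=> /nbhs_interior. Qed.

Lemma Ck1_affine_near (D : set (R * R)) (f : R * R -> R) : open D ->
  (forall p, D p -> exists u v w : R,
    \forall q \near p, f q = u + v * q.1 + w * q.2) -> Ck 1 D f.
Proof.
move=> oD fE.
have part b p u v w : (\forall q \near p, f q = u + v * q.1 + w * q.2) ->
    derivable f p (basis_vector R b) /\
    partial b f p = v * (basis_vector R b).1 + w * (basis_vector R b).2.
  move=> fp; have d := derive_aff u v w p (basis_vector R b).
  have [h1 h2] := partial_near fp ex_derive.
  by split=> //; rewrite /partial h2 derive_val.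
split=> [p Dp|b].
  have [u [v [w fp]]] := fE p Dp.
  have cg : continuous (fun q : R * R => u + v * q.1 + w * q.2) by cont.
  rewrite /prop_for /continuous_at (nbhs_singleton fp).
  apply: (cvg_trans _ (cg p)); apply: near_eq_cvg.
  by apply: filterS fp => q ->.
split=> [p /fE[u [v [w fp]]]|]; first by have [] := part b p u v w fp.
split=> // p /fE[u [v [w fp]]].
rewrite /prop_for /continuous_at.
have [_ ->] := part b p u v w fp; apply: cvg_near_cst.
by apply: filterS (near_nbhs fp) => q /(part b q u v w)[].
Qed.

Lemma C1_on_affine_near (O : set (plane R)) (F : plane R -> plane R) : open O ->
  (forall p, O p -> affine_near F p) -> C1_on O F.
Proof.
move=> oO FO i j a.
have E : (@chart _ (plane R) i @` (dom i `&` O `&` F @^-1` dom j)) = O.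
  by rewrite image_id; apply/seteqP; split=> [p [[_ Op] _]//|p Op].
rewrite E; apply: Ck1_affine_near => // p /FO[u [v [w h]]].
exists (u a), (v a), (w a); apply: filterS h => q; exact.
Qed.

(** The affine saddle centred at (c, 0) that multiplies the direction (1, 1) by J and the direction
    (1, -1) by 1 / J. Near each saddle of the Bowen map, al and be are affine and each is constant
    along one of these directions. *)
Definition saddle_map c J p : R * R :=
  (c + ((J + J^-1) / 2 * (p.1 - c) + (J - J^-1) / 2 * p.2),
   (J - J^-1) / 2 * (p.1 - c) + (J + J^-1) / 2 * p.2).

Lemma saddle_map_center c J : saddle_map c J (c, 0) = (c, 0).
Proof. by rewrite /saddle_map /= subrr !mulr0 !addr0. Qed.

Lemma saddle_mapK c J : J != 0 -> cancel (saddle_map c J) (saddle_map c J^-1).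
Proof.
move=> J0 [x y]; rewrite /saddle_map /= invrK; congr pair; field; exact: J0.
Qed.

Lemma saddle_map_affine c J p : affine_near (saddle_map c J) p.
Proof.
exists (fun a => if a == 0 then c - (J + J^-1) / 2 * c else - ((J - J^-1) / 2 * c)),
  (fun a => if a == 0 then (J + J^-1) / 2 else (J - J^-1) / 2),
  (fun a => if a == 0 then (J - J^-1) / 2 else (J + J^-1) / 2).
apply: filterE => q a; rewrite /Defs.coord; case: eqP => _ /=; ring.
Qed.

Lemma scale_affine c p : affine_near (scale c) p.
Proof.
exists (fun _ => 0), (fun a => if a == 0 then c else 0),
  (fun a => if a == 0 then 0 else c).
apply: filterE => q a; rewrite /Defs.coord; case: eqP => _ /=; ring.
Qed.

Lemma affine_near_eq F G p : (\forall q \near p, F q = G q) ->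
  affine_near G p -> affine_near F p.
Proof.
move=> FG [u [v [w h]]]; exists u, v, w; near=> q => a.
by rewrite (_ : F q = G q); [move: a; near: q | near: q].
Unshelve. all: by end_near. Qed.

Lemma jacobian_saddle c J p F : (\forall q \near p, F q = saddle_map c J q) ->
  jacobian2 F p = \matrix_(a, b) (if a == b then (J + J^-1) / 2 else (J - J^-1) / 2).
Proof.
move=> FE; rewrite (@jacobian_aff _ F
  (fun a => if a == 0 then c - (J + J^-1) / 2 * c else - ((J - J^-1) / 2 * c))
  (fun a => if a == 0 then (J + J^-1) / 2 else (J - J^-1) / 2)
  (fun a => if a == 0 then (J - J^-1) / 2 else (J + J^-1) / 2)).
  apply/matrixP => a b; rewrite !mxE.
  by case: a => [[|[|//]] ?]; case: b => [[|[|//]] ?].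
apply: filterS FE => q -> a; rewrite /Defs.coord; case: eqP => _ /=; ring.
Qed.

Lemma jacobian_scale c p F : (\forall q \near p, F q = scale c q) ->
  jacobian2 F p = c%:M.
Proof.
move=> FE; rewrite (@jacobian_aff _ F (fun _ => 0)
  (fun a => if a == 0 then c else 0) (fun a => if a == 0 then 0 else c)).
  apply/matrixP => a b; rewrite !mxE.
  by case: a => [[|[|//]] ?]; case: b => [[|[|//]] ?].
apply: filterS FE => q -> a; rewrite /Defs.coord; case: eqP => _ /=; ring.
Qed.

Lemma norm_real (x : R) : `|(x%:C)%C| = (`|x|%:C)%C.
Proof. by rewrite normc_def /= expr0n /= addr0 sqrtr_sqr. Qed.

(** The sum and the difference of the two entries of a row vector diagonalize this symmetric
    matrix. *)
Lemma saddle_eigenvalue J (z : R[i]) : 0 < J ->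
  eigenvalueC (\matrix_(a, b) (if a == b then (J + J^-1) / 2 else (J - J^-1) / 2)) z =
  (z == (J%:C)%C) || (z == (J^-1%:C)%C).
Proof.
move=> J0; have Jn : J != 0 by rewrite gt_eqF.
set A := \matrix_(a, b) _; set ch := ((J + J^-1) / 2); set sh := ((J - J^-1) / 2).
have sE (v : 'rV[R[i]]_2) (j : 'I_2) : (v *m map_mx (real_complex R) A) 0 j =
    v 0 0 * ((if (0 : 'I_2) == j then ch else sh)%:C)%C +
    v 0 1 * ((if (1 : 'I_2) == j then ch else sh)%:C)%C.
  rewrite mxE !big_ord_recl big_ord0 addr0 !mxE.
  by congr (_ + v 0 _ * _); apply: val_inj.
have e1 : ((ch + sh)%:C)%C = (J%:C)%C by congr (_%:C)%C; rewrite /ch /sh; field.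
have e2 : ((ch - sh)%:C)%C = (J^-1%:C)%C by congr (_%:C)%C; rewrite /ch /sh; field.
apply/idP/idP => [/eigenvalueP[v vz v0]|].
  have h0 := congr1 (fun M : 'rV[R[i]]_2 => M 0 0) vz.
  have h1 := congr1 (fun M : 'rV[R[i]]_2 => M 0 1) vz.
  move: h0 h1; rewrite !sE /= !mxE => h0 h1.
  have f1 : (v 0 0 + v 0 1) * ((J%:C)%C - z) = 0.
    rewrite -e1 rmorphD /=; set a := (ch%:C)%C in h0 h1 *; set b := (sh%:C)%C in h0 h1 *.
    transitivity ((v 0 0 * a + v 0 1 * b - z * v 0 0) +
      (v 0 0 * b + v 0 1 * a - z * v 0 1)); first by ring.
    by rewrite h0 h1 !subrr addr0.
  have f2 : (v 0 0 - v 0 1) * ((J^-1%:C)%C - z) = 0.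
    rewrite -e2 rmorphB /=; set a := (ch%:C)%C in h0 h1 *; set b := (sh%:C)%C in h0 h1 *.
    transitivity ((v 0 0 * a + v 0 1 * b - z * v 0 0) -
      (v 0 0 * b + v 0 1 * a - z * v 0 1)); first by ring.
    by rewrite h0 h1 !subrr.
  move: f1 f2 => /eqP + /eqP; rewrite !mulf_eq0 !subr_eq0 ![_ == z]eq_sym.
  case/orP => [/eqP s1|->]; last by [].
  case/orP => [/eqP s2|->]; last by rewrite orbT.
  case/negP: v0; apply/eqP/matrixP => i j; rewrite (ord1 i) mxE.
  have z1 : v 0 1 = 0.
    have : v 0 1 *+ 2 = 0 by rewrite mulr2n -{1}s2 addrC -s1; ring.
    by move/eqP; rewrite mulrn_eq0 /= => /eqP.
  have z0 : v 0 0 = 0 by rewrite s2.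
  by case: j => [[|[|//]] ij]; [rewrite -z0 | rewrite -z1]; congr (v _ _); apply: val_inj.
case/orP => /eqP ->; apply/eigenvalueP.
  exists (const_mx 1).
    apply/matrixP => i j; rewrite (ord1 i) sE !mxE !mul1r mulr1 -rmorphD /= -e1.
    by case: j => [[|[|//]] ij] /=; congr (_%:C)%C; rewrite /= addrC.
  by apply/eqP => /matrixP/(_ 0 0); rewrite !mxE => /eqP; rewrite oner_eq0.
exists (\row_j (if j == 0 then 1 else -1)).
  apply/matrixP => i j; rewrite (ord1 i) sE !mxE /= mul1r mulN1r -rmorphN -rmorphD /=.
  case: j => [[|[|//]] ij] /=; rewrite -e2 ?mulr1 // mulrN1 -rmorphN /=.
  by congr (_%:C)%C; rewrite opprB.
by apply/eqP => /matrixP/(_ 0 0); rewrite !mxE => /eqP; rewrite oner_eq0.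
Qed.

Lemma saddle_hyperbolic J : 1 < J -> hyperbolic_saddle
  (\matrix_(a, b) (if a == b then (J + J^-1) / 2 else (J - J^-1) / 2)).
Proof.
move=> J1; have J0 : 0 < J by lra.
have i1 : J^-1 < 1 by rewrite invf_lt1.
have i0 : 0 < J^-1 by rewrite invr_gt0.
have n1 : `|(J%:C)%C| = (J%:C)%C by rewrite norm_real gtr0_norm.
have n2 : `|(J^-1%:C)%C| = (J^-1%:C)%C by rewrite norm_real gtr0_norm.
split.
- move=> z; rewrite saddle_eigenvalue // => /orP[] /eqP ->; rewrite ?n1 ?n2.
    by rewrite gt_eqF // ltcR.
  by rewrite lt_eqF // ltcR.
- by exists (J^-1%:C)%C; rewrite ?saddle_eigenvalue ?eqxx ?orbT // n2 ltcR.
- by exists (J%:C)%C; rewrite ?saddle_eigenvalue ?eqxx // n1 ltcR.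
Qed.

Lemma scale_hyperbolic : hyperbolic_source (2%:M : 'M[R]_2).
Proof.
move=> z /eigenvalueP[v]; rewrite map_scalar_mx mul_mx_scalar => e v0.
have -> : z = (2%:C)%C.
  apply/eqP; rewrite -subr_eq0; have := scalerBl z (2%:C)%C v.
  rewrite -e subrr => /eqP; rewrite scaler_eq0 (negbTE v0) orbF; exact.
by rewrite norm_real gtr0_norm // ltcR ltr1n.
Qed.

Section bowen_local.
Variables (kap L K : R).
Hypotheses (L1 : 1 < L) (K1 : 1 < K) (LK : L * K = kap).
Let k1 : 1 < kap. Proof. exact: (kap_gt1 L1 K1 LK). Qed.

Lemma step_core p : 1 <= kap ^+ 2 * theta p -> step kap L K p = p.
Proof.
move=> h; have s J : speed kap J (theta p) = 1 by rewrite /speed rate0 ?mulr0 ?addr0.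
have sr J : speed kap J (theta (rot p)) = 1 by rewrite theta_rot.
rewrite /step; case: (leP p.1 0) => p0.
  by rewrite half_stay s ?mul1r ?be_le1 // divr1 mulr1 pt_coord.
rewrite half_stay sr ?mul1r ?be_le1 // divr1 mulr1 pt_coord ?rotK //=.
by rewrite oppr_le0 ltW.
Qed.

Lemma bowen_near_source : \forall p \near ((0, 0) : R * R), bowen kap L K p = scale 2 p.
Proof.
have c1 : continuous (fun p : R * R => kap ^+ 2 * theta (scale 2 p)).
  have c2 : continuous (fun p : R * R => theta (scale 2 p)).
    have cs : continuous (@scale R 2) by rewrite /scale; cont.
    move=> p; apply: (@continuous_comp _ _ _ (scale 2)); first exact: cs.
    exact: theta_continuous.
  by cont.
have k2 : 1 < kap ^+ 2 by rewrite exprn_egt1.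
have h1 : \forall p \near ((0, 0) : R * R), 1 < kap ^+ 2 * theta (scale 2 p).
  apply: (cvgr_gt _ (c1 (0, 0))).
  by rewrite /scale /= mulr0 /theta /al /be /depth /= normr0 mul0r addr0 maxxx; lra.
have h2 : \forall p \near ((0, 0) : R * R), gauge p < 1 / 8.
  apply: (cvgr_lt _ (@gauge_continuous R (0, 0))).
  by rewrite /gauge /depth /= normr0 mul0r !addr0 maxxx; lra.
near=> p; have g : gauge p < 1 / 8 by near: p.
rewrite /bowen /push pushf_small ?ltW // step_core // ltW //.
by near: p.
Unshelve. all: by end_near. Qed.

End bowen_local.

Lemma step_near_saddle (kap L K : R) : 1 < L -> 1 < K -> L * K = kap ->
  \forall p \near ((-1, 0) : R * R), step kap L K p = saddle_map (-1) L p.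
Proof.
move=> L1 K1 LK; have k1 := kap_gt1 L1 K1 LK.
(* Within e of the saddle, |al| and |be| are at most 2 e. So theta is at most 4 e = 1 / (2 kap^2),
   which gives full speed. *)
have [e eE] : exists e : R, e = (8 * kap ^+ 2)^-1 by eexists.
have ke : 8 * kap ^+ 2 * e = 1.
  by rewrite eE mulfV // mulf_neq0 // expf_neq0 // gt_eqF //; lra.
have e0 : 0 < e by rewrite eE invr_gt0 mulr_gt0 // exprn_gt0 //; lra.
have e1 : 8 * kap * e <= 1 by rewrite -ke expr2; nra.
have e2 : 8 * e <= 1 by nra.
have Lk : L <= kap := L_le_kap L1 K1 LK.
apply/nbhs_ballP; exists e => //= -[x y] [/=]; rewrite /ball /= sub0r normrN.
rewrite !ltr_norml => /andP[x1 x2] /andP[y1 y2].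
have dE : depth (x, y) = - x.
  rewrite /depth /= ler0_norm; last by lra.
  by rewrite max_l //; case: (ger0P y); lra.
have aE : al (x, y) = 1 + x - y by rewrite /al dE /=; lra.
have bE : be (x, y) = 1 + x + y by rewrite /be dE /=; lra.
have th : 2 * kap ^+ 2 * theta (x, y) <= 1.
  have t1 : theta (x, y) <= 4 * e by rewrite /theta aE bE; nra.
  by have : kap ^+ 2 * theta (x, y) <= kap ^+ 2 * (4 * e);
    [rewrite ler_wpM2l // sqr_ge0 | lra].
rewrite /step /= ifT; last by lra.
have Lb : L * be (x, y) <= 1 / 4 by rewrite bE; nra.
rewrite half_stay speedE //; last by lra.
have Li : 0 < L^-1 < 1 by rewrite invr_gt0 invf_lt1; lra.
have La : al (x, y) / L <= 1 / 4 by rewrite aE; nra.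
have La' : - (1 / 4) <= al (x, y) / L by rewrite aE; nra.
have Lb' : - (1 / 4) <= L * be (x, y) by rewrite bE; nra.
(* Coordinates this small place the image where depth is |x|, so that [pt] is affine. *)
rewrite /pt min_l; last first.
  by rewrite mulrC in Lb Lb'; case: (leP (al (x, y) / L)); lra.
by rewrite /saddle_map aE bE /=; congr pair; field; lra.
Qed.

Section bowen_local2.
Variables (kap L K : R).
Hypotheses (L1 : 1 < L) (K1 : 1 < K) (LK : L * K = kap).
Let k1 : 1 < kap. Proof. exact: (kap_gt1 L1 K1 LK). Qed.

Lemma bowen_near_left :
  \forall p \near ((-1, 0) : R * R), bowen kap L K p = saddle_map (-1) L p.
Proof.
near=> p; rewrite /bowen (_ : push kap p = p); last first.
  by near: p; exact: (@push_near_saddle R kap false k1).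
by near: p; exact: step_near_saddle.
Unshelve. all: by end_near. Qed.

Lemma bowen_near_right :
  \forall p \near ((1, 0) : R * R), bowen kap L K p = saddle_map 1 K p.
Proof.
have KL : K * L = kap by rewrite mulrC.
have h : \forall p \near rot ((1, 0) : R * R), step kap K L p = saddle_map (-1) K p.
  by rewrite /rot /= oppr0; exact: step_near_saddle.
have h2 : \forall p \near ((1, 0) : R * R),
    step kap K L (rot p) = saddle_map (-1) K (rot p).
  exact: (@rot_continuous R (1, 0)) h.
near=> p; rewrite /bowen (_ : push kap p = p); last first.
  by near: p; exact: (@push_near_saddle R kap true k1).
rewrite -[step _ _ _ _]rotK -(step_rot L1 K1 LK).
rewrite (_ : step kap K L (rot p) = saddle_map (-1) K (rot p)); last by near: p.
by rewrite /rot /saddle_map /=; congr pair; ring.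
Unshelve. all: by end_near. Qed.

End bowen_local2.
End local_forms.

(** * Invariant branches *)

Section branches.
Variable R : realType.
Implicit Types (p q : R * R) (s t : R).

Lemma cvg_le_const (u : nat -> R * R) (h : R * R -> R) c x : continuous h ->
  (forall n, h (u n) <= c) -> u n @[n --> \oo] --> x -> h x <= c.
Proof.
by move=> ch hu; apply: (closed_cvg _ (closed_le ch)); exact: nearW.
Qed.

(** The whole stable manifold of the left saddle, contained in be = 0. Negative t lies outside the
    closure of V; t >= 0 runs along the lower edge of V, meets the y-axis at t = 1 and tends to the
    right saddle as t grows. *)
Definition axis t : R * R := if t <= 1 then pt false t 0 else pt true t^-1 0.

(** The Bowen map read in the parameter of [axis]. On the right al is 1 / t and is multiplied by K;
    when K / t exceeds 1 it is the overshoot of a crossing at theta = 0. *)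
Definition drift kap (L K : R) t : R :=
  if t <= 1 then t / L else if K <= t then t / K else land kap K L 0 (K / t).

Lemma axis0 : axis 0 = (-1, 0).
Proof. by rewrite /axis ler01 pt00. Qed.

Lemma axis_continuous : continuous axis.
Proof.
have -> : axis = fun t => if t - 1 <= 0 then pt false t 0 else
    pt true (Num.max 1 t)^-1 0.
  apply/funext => t; rewrite /axis subr_le0; by case: (leP t 1).
have ci : continuous (fun t : R => (Num.max 1 t)^-1).
  apply: cont_inv; first by move=> t; rewrite gt_eqF // lt_max ltr01.
  have cid : continuous (fun t : R => t) by move=> t; exact: cvg_id.
  by apply: cont_max; [exact: cont_cst | exact: cid].
apply: continuous_if_le; rewrite /pt; cont; try by move=> t; exact: cvg_id.
move=> t /eqP; rewrite subr_eq0 => /eqP ->.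
by rewrite maxxx invr1; apply/esym/pt_glue; rewrite max_l.
Qed.

Lemma axis_pt t : let r := ~~ (t <= 1) in let a := if t <= 1 then t else t^-1 in
  [/\ axis t = pt r a 0, al (axis t) = a & be (axis t) = 0].
Proof.
rewrite /axis; case: (leP t 1) => t1 /=; first by split; rewrite ?al_pt ?be_pt.
by split; rewrite ?al_pt ?be_pt // ltW // invf_lt1 //; lra.
Qed.

Lemma axis_fst t : ((axis t).1 <= 0) = (t <= 1).
Proof.
have [-> _ _] := axis_pt t; case: (leP t 1) => t1; first by rewrite pt_false_fst.
by apply/negbTE; rewrite -ltNge pt_true_fst ?ltr01 // invf_lt1 //; lra.
Qed.

Definition axis_time p : R := if p.1 <= 0 then al p else (al p)^-1.

Lemma axisK : cancel axis axis_time.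
Proof.
move=> t; rewrite /axis_time axis_fst; have [_ -> _] := axis_pt t.
by case: leP => _ //; rewrite invrK.
Qed.

Lemma axis_gauge t : 1 <= gauge (axis t).
Proof.
by have [_ _ b] := axis_pt t; rewrite leNgt gauge_lt1 b ltxx andbF.
Qed.

Lemma axis_onto p : be p = 0 -> (p.1 <= 0) || (0 < al p) -> axis (axis_time p) = p.
Proof.
move=> b0; rewrite /axis_time; case: (leP p.1 0) => p0 /= a0.
  by rewrite /axis al_le1 -b0 pt_coord.
have pE : pt true (al p) 0 = p by rewrite -b0 pt_coord // ltW.
rewrite /axis invrK; case: (leP (al p)^-1 1) => h //.
have a1 : al p = 1 by apply: le_anti; rewrite al_le1 /= -invf_le1.
by rewrite -[RHS]pE a1 invr1 pt_glue // max_l.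
Qed.

Lemma bowen_outside kap L K p : 1 < kap -> 1 <= gauge p ->
  bowen kap L K p = step kap L K p.
Proof. by move=> k1 h; rewrite /bowen push_out. Qed.

Section drift.
Variables (kap L K : R).
Hypotheses (L1 : 1 < L) (K1 : 1 < K) (LK : L * K = kap).
Let k1 : 1 < kap. Proof. exact: (kap_gt1 L1 K1 LK). Qed.
Let speed0 J p : be p = 0 -> speed kap J (theta p) = J.
Proof. by move=> h; rewrite /theta h mulr0 speedE // mulr0. Qed.
Let speed0' J p : al p = 0 -> speed kap J (theta p) = J.
Proof. by move=> h; rewrite /theta h mul0r speedE // mulr0. Qed.

Lemma bowen_axis t : bowen kap L K (axis t) = axis (drift kap L K t).
Proof.
rewrite bowen_outside ?axis_gauge //; have [pE aE bE] := axis_pt t.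
rewrite /step axis_fst /drift; case: (leP t 1) => t1 in pE aE *.
  rewrite half_stay bE ?mulr0 // mul0r aE speed0 // /axis ifT //.
  by rewrite ler_pdivrMr; move: L1; lra.
have t0 : 0 < t by lra.
have bR : be (rot (axis t)) = t^-1 by rewrite be_rot.
have aR : al (rot (axis t)) = 0 by rewrite al_rot.
case: (leP K t) => Kt.
  rewrite half_stay speed0' // bR ?ler_pdivrMr ?mul1r //.
  rewrite aR mul0r rot_pt /= /axis; case: leP => h; last by rewrite invf_div mulrC.
  have -> : t / K = 1.
    by apply: le_anti; rewrite h ler_pdivlMr ?mul1r //; move: K1; lra.
  rewrite (_ : t^-1 * K = 1) ?pt_glue ?max_l //.
  rewrite mulrC; apply: (@mulIf _ t); first by rewrite gt_eqF.
  rewrite divfK ?gt_eqF // mul1r; apply: le_anti; rewrite Kt andTb.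
  by move: h; rewrite ler_pdivrMr; move: K1; lra.
have c : 1 < speed kap K (theta (rot (axis t))) * be (rot (axis t)).
  by rewrite speed0' // bR ltr_pdivlMr // mul1r.
rewrite (half_cross K1 L1 c) speed0' // bR [theta _]/theta aR !mul0r rot_pt /=.
rewrite /axis ifT //; apply/ltW/(land_lt1 kap K1 L1).
by rewrite ltr_pdivlMr // mul1r.
Qed.

(** A crossing only brings the parameter below 1, without contracting it. Hence two estimates: the
    first brings bounded parameters into [-1, 1] in a uniform number of steps, the second contracts
    them to 0. *)
Lemma drift_le m t : 1 < m -> m <= L -> m <= K ->
  `|drift kap L K t| <= Num.max 1 (`|t| / m) /\
  (`|t| <= 1 -> `|drift kap L K t| <= `|t| / m).
Proof.
move=> m1 mL mK; have m0 : 0 < m by lra.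
have le J : m <= J -> `|t / J| <= `|t| / m.
  move=> mJ; rewrite normrM normfV (gtr0_norm (lt_le_trans m0 mJ)) ler_wpM2l //.
  by rewrite lef_pV2 ?posrE //; lra.
rewrite /drift; case: (leP t 1) => t1.
  by split=> *; [rewrite le_max le ?orbT | exact: le].
split=> [|h]; last by have := ler_norm t; lra.
case: (leP K t) => Kt; first by rewrite le_max le // orbT.
have x1 : 1 < K / t by rewrite ltr_pdivlMr ?mul1r //; lra.
have xK : K / t <= speed kap K 0.
  rewrite speedE ?mulr0 // ler_pdivrMr; last lra.
  by move: K1; nra.
have j1 := land_lt1 kap K1 L1 0 x1; have j0 := land_gt0 K1 L1 xK.
by rewrite le_max gtr0_norm // (ltW j1).
Qed.

Lemma iter_drift_le m n t : 1 < m -> m <= L -> m <= K ->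
  `|t| <= m ^+ n -> `|iter n (drift kap L K) t| <= 1.
Proof.
move=> m1 mL mK; have m0 : 0 < m by lra.
suff h : `|iter n (drift kap L K) t| <= Num.max 1 (`|t| / m ^+ n).
  move=> tn; apply: (le_trans h); rewrite ge_max lexx /=.
  by rewrite ler_pdivrMr ?mul1r // exprn_gt0.
elim: n => [|n IH]; first by rewrite expr0 divr1 le_max lexx orbT.
rewrite iterS; have [h _] := drift_le (iter n (drift kap L K) t) m1 mL mK.
apply: (le_trans h); rewrite ge_max le_max lexx /=.
rewrite ler_pdivrMr //; apply: (le_trans IH).
rewrite ge_max; apply/andP; split.
  apply: (@le_trans _ _ (1 * m)); first by lra.
  by rewrite ler_pM2r // le_max lexx.
rewrite (_ : `|t| / m ^+ n = `|t| / m ^+ n.+1 * m).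
  by rewrite ler_pM2r // le_max lexx orbT.
by rewrite exprSr invfM mulrA divfK // gt_eqF.
Qed.

Lemma iter_drift_small m n t : 1 < m -> m <= L -> m <= K ->
  `|t| <= 1 -> `|iter n (drift kap L K) t| <= m ^- n.
Proof.
move=> m1 mL mK t1; have m0 : 0 < m by lra.
elim: n => [|n IH]; first by rewrite expr0 invr1.
rewrite iterS; have [_ h] := drift_le (iter n (drift kap L K) t) m1 mL mK.
apply: (le_trans (h _)).
  by apply: (le_trans IH); rewrite invf_le1 ?exprn_gt0 // exprn_ege1 // ltW.
by rewrite exprSr invfM ler_pM2r ?invr_gt0.
Qed.

Lemma iter_drift_cvg (r e : R) : 0 < e -> exists N, forall n, (N <= n)%N ->
  forall t, `|t| <= r -> `|iter n (drift kap L K) t| < e.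
Proof.
move=> e0; pose m := Num.min L K.
have m1 : 1 < m by rewrite lt_min; apply/andP; split; [exact: L1|exact: K1].
have mL : m <= L by rewrite ge_min lexx.
have mK : m <= K by rewrite ge_min lexx orbT.
have [n1 h1] := exprn_unbounded r m1; have [n2 h2] := exprn_unbounded e^-1 m1.
exists (n1 + n2)%N => n nn t tr.
have -> : n = (n - n1 + n1)%N by rewrite subnK // (leq_trans _ nn) // leq_addr.
rewrite iterD; have t1 : `|iter n1 (drift kap L K) t| <= 1.
  by apply: (iter_drift_le m1) => //; lra.
apply: (le_lt_trans (iter_drift_small (n - n1) m1 mL mK t1)).
have le2 : m ^+ n2 <= m ^+ (n - n1).
  by rewrite ler_eXn2l // leq_subRL ?(leq_trans _ nn) ?leq_addr // addnC.
rewrite -[e]invrK ltf_pV2 ?posrE ?invr_gt0 ?exprn_gt0 //; last by lra.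
exact: lt_le_trans le2.
Qed.

Lemma iter_bowen_axis n t :
  iter n (bowen kap L K) (axis t) = axis (iter n (drift kap L K) t).
Proof. by elim: n => //= n ->; rewrite bowen_axis. Qed.

Lemma axis_uniform_cvg (N : set (R * R)) (r : R) : nbhs ((-1, 0) : R * R) N ->
  \forall n \near \oo, forall t, `|t| <= r ->
    N (iter n (bowen kap L K) (axis t)).
Proof.
rewrite -axis0 => nN; have := axis_continuous (x := 0) nN.
move=> /nbhs_ballP[e /= e0 he]; have [n0 h] := iter_drift_cvg r e0.
exists n0 => // n /= nn t tr; rewrite iter_bowen_axis; apply: he.
by rewrite /ball /= sub0r normrN h.
Qed.

Lemma axis_cvg t :
  iter n (bowen kap L K) (axis t) @[n --> \oo] --> ((-1, 0) : R * R).
Proof.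
move=> N nN; have := axis_uniform_cvg `|t| nN.
by apply: filterS => n; exact.
Qed.

Lemma bowen_outside_gauge p : 1 <= gauge p -> 1 <= gauge (bowen kap L K p).
Proof.
move=> h; rewrite bowen_outside // leNgt (step_gauge_lt1 L1 K1 LK) -leNgt //.
Qed.

Lemma iter_outside_gauge n p : 1 <= gauge p -> 1 <= gauge (iter n (bowen kap L K) p).
Proof. by move=> h; elim: n => //= n; exact: bowen_outside_gauge. Qed.

Lemma iter_outside_theta n p : 1 <= gauge p ->
  theta (iter n (bowen kap L K) p) = theta p.
Proof.
move=> h; elim: n => //= n <-.
by rewrite bowen_outside ?(theta_step L1 K1 LK) // iter_outside_gauge.
Qed.

(* These points form the half of the unstable manifold of the right saddle that
   lies outside V. *)
Lemma escape_right p n : be p = 0 -> al p < 0 -> 0 < p.1 ->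
  let q := iter n (bowen kap L K) p in [/\ be q = 0, al q <= al p & 0 < q.1].
Proof.
move=> b0 a0 x0; elim: n => [|n /=]; first by rewrite /= lexx.
set q := iter n _ _ => -[bq aq xq].
have g : 1 <= gauge q by rewrite leNgt gauge_lt1 bq ltxx andbF.
have br : be (rot q) = al q by rewrite be_rot.
have ar : al (rot q) = 0 by rewrite al_rot.
have qE : bowen kap L K q = pt true (al q * K) 0.
  rewrite bowen_outside // /step leNgt xq /=.
  rewrite half_stay speed0' // br; last by move: K1; nra.
  by rewrite ar mul0r rot_pt.
have aK : al q * K <= al q by move: K1; nra.
have a1 : al q * K <= 1 by lra.
rewrite qE be_pt ?al_pt // (le_trans aK) //; split=> //.
by apply: pt_true_fst; lra.
Qed.

End drift.

Section stable_set.
Variables (kap L K : R).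
Hypotheses (L1 : 1 < L) (K1 : 1 < K) (LK : L * K = kap).
Let KL : K * L = kap. Proof. by rewrite mulrC. Qed.
Local Notation f := (bowen kap L K).
Local Notation f' := (bowen kap K L).

Lemma iter_bowen_rot n p : iter n f' (rot p) = rot (iter n f p).
Proof. by elim: n => //= n ->; rewrite bowen_rot. Qed.

Lemma not_escape_right p x : be p = 0 -> al p < 0 -> 0 < p.1 -> al x = 0 ->
  iter n f p @[n --> \oo] --> x -> False.
Proof.
move=> b0 a0 x0 ax cx.
suff : al x <= al p by rewrite ax leNgt a0.
apply: (cvg_le_const (@al_continuous R) _ cx) => n.
by have [_ h _] := escape_right L1 K1 LK n b0 a0 x0.
Qed.

End stable_set.

Lemma saddle_coord : al ((-1, 0) : R * R) = 0 /\ al ((1, 0) : R * R) = 0 /\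
  theta ((-1, 0) : R * R) = 0.
Proof.
by rewrite -(pt00 R true) -(pt00 R false) /theta !al_pt ?mul0r.
Qed.

Lemma rot_cvg (u : nat -> R * R) x : u n @[n --> \oo] --> x ->
  rot (u n) @[n --> \oo] --> rot x.
Proof. by move=> h; exact: (continuous_cvg _ (@rot_continuous R x) h). Qed.

(** Outside V theta is invariant, and it vanishes at the saddle, so al or be vanishes at p. Such a
    point lies on [axis], or on its rotated copy, whose orbits converge to the other saddle, or on a
    branch that escapes. *)
Lemma axis_stable kap (L K : R) p : 1 < L -> 1 < K -> L * K = kap -> 1 <= gauge p ->
  iter n (bowen kap L K) p @[n --> \oo] --> ((-1, 0) : R * R) ->
  exists t, axis t = p.
Proof.
move=> L1 K1 LK g cx; have KL : K * L = kap by rewrite mulrC.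
have [al0 [al0' th0]] := saddle_coord.
have hR : hausdorff_space (R * R)%type := @norm_hausdorff R (R * R)%type.
have sep : ((1, 0) : R * R) <> (-1, 0) by move=> [] h; lra.
have th : theta p = 0.
  have h1 : theta ((-1, 0) : R * R) <= theta p.
    apply: (cvg_le_const (@theta_continuous R) _ cx) => n.
    by rewrite (iter_outside_theta L1 K1 LK).
  have h2 : - theta ((-1, 0) : R * R) <= - theta p.
    apply: (@cvg_le_const _ (fun q => - theta q) _ _ _ _ cx) => [|n].
      by have h := @theta_continuous R; cont.
    by rewrite (iter_outside_theta L1 K1 LK).
  by move: h1 h2; rewrite th0; lra.
have crot : iter n (bowen kap K L) (rot p) @[n --> \oo] --> ((1, 0) : R * R).
  have := rot_cvg cx; rewrite {2}/rot /= opprK oppr0.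
  by under eq_fun do rewrite -(iter_bowen_rot L1 K1 LK).
have notrot (q : R) : rot p = axis q -> False.
  move=> e; apply: sep; apply: (cvg_unique hR crot).
  by rewrite e; exact: (axis_cvg K1 L1 KL).
have [a0|b0] : al p = 0 \/ be p = 0.
- by move/eqP: th; rewrite /theta mulf_eq0 => /orP[] /eqP; [left|right].
- have bE : be (rot p) = 0 by rewrite be_rot.
  case: (leP (rot p).1 0) => r0.
    by case: (@notrot _ (esym (axis_onto bE _))); rewrite r0.
  case: (ltgtP (al (rot p)) 0) => ar.
  + by case: (not_escape_right K1 L1 KL bE ar r0 al0' crot).
  + by case: (@notrot _ (esym (axis_onto bE _))); rewrite ar orbT.
  + rewrite al_rot in ar; exists (axis_time p); apply: axis_onto => //.
    by move: r0; rewrite /= oppr_gt0 => /ltW ->.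
- case: (leP p.1 0) => p0; first by exists (axis_time p); apply: axis_onto; rewrite ?p0.
  case: (ltgtP (al p) 0) => ar.
  + by case: (not_escape_right L1 K1 LK b0 ar p0 al0 cx).
  + by exists (axis_time p); apply: axis_onto; rewrite ?ar ?orbT.
  + have bE : be (rot p) = 0 by rewrite be_rot.
    case: (@notrot _ (esym (axis_onto bE _))).
    by rewrite /= oppr_le0 ltW.
Qed.
End branches.

Lemma saddles_neq (R : realType) : ((1, 0) : R * R) <> (-1, 0).
Proof. by move=> [] h; lra. Qed.

Lemma saddles_neq0 (R : realType) (x : R * R) : x = (-1, 0) \/ x = (1, 0) ->
  x <> (0, 0).
Proof. by case=> -> [] h; lra. Qed.

(** Here u is the current time, v a time after which the bump vanishes on the orbit, and S the sum
    of its deviations from the limiting mean c. *)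
Lemma bump_mean_absurd (R : realType) (c u v S : R) : 0 <= v ->
  - (c / 2 * u) <= S -> S <= v - c * u -> (v + 1) * 2 <= u * c -> False.
Proof. by lra. Qed.

(** * Saddles in the omega-limit sets *)

Section omega_limits.
Variables (R : realType) (kap L K t : R).
Hypotheses (L1 : 1 < L) (K1 : 1 < K) (LK : L * K = kap).
Hypotheses (tL : t * ln L = 1) (tK : (1 - t) * ln K = 1) (t01 : 0 < t < 1).
Implicit Types p x y : R * R.
Local Notation f := (bowen kap L K).

Definition bump x (e : R) p : R := Num.max 0 (1 - dist1 p x / e).

Lemma bump_ge0 x e p : 0 <= bump x e p.
Proof. by rewrite le_max lexx. Qed.

Lemma bump_le1 x e p : 0 < e -> bump x e p <= 1.
Proof.
move=> e0; rewrite ge_max ler01 gerBl divr_ge0 ?(ltW e0) //.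
exact: dist1_ge0.
Qed.

Lemma bump_center x e : bump x e x = 1.
Proof. by rewrite /bump /dist1 !subrr normr0 addr0 mul0r subr0 max_r. Qed.

Lemma bump_continuous x e : continuous (bump x e).
Proof. by rewrite /bump /dist1; cont. Qed.

Lemma bump_support x e p : 0 < e -> ~ ball x e p -> bump x e p = 0.
Proof.
move=> e0 h; apply/max_l; rewrite subr_le0 ler_pdivlMr // mul1r leNgt.
apply/negP => d; apply: h; split; rewrite /ball /= distrC; move: d; rewrite /dist1.
  by have := normr_ge0 (p.2 - x.2); lra.
by have := normr_ge0 (p.1 - x.1); lra.
Qed.

(** Both weights are positive, so a bump centred at a saddle has a positive limiting mean; this is
    impossible if the orbit eventually leaves its support. *)
Lemma saddle_in_omega x y : x = (-1, 0) \/ x = (1, 0) ->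
  gauge y < 1 -> y <> (0, 0) -> cluster (iter n f y @[n --> \oo]) x.
Proof.
move=> xs gy y0 A B [N _ hA] /nbhs_ballP[e /= e0 hB].
apply/set0P/eqP => AB0.
pose phi := bump x e; pose c := t * phi (-1, 0) + (1 - t) * phi (1, 0).
have /andP[t0 t1] := t01.
have p1 := bump_ge0 x e (-1, 0); have p2 := bump_ge0 x e (1, 0).
have c0 : 0 < c.
  have pc := bump_center x e; rewrite /c /phi.
  by case: xs => xE; rewrite -xE pc mulr1 in p1 p2 *; nra.
have phi0 n : (N <= n)%N -> phi (iter n f y) = 0.
  move=> Nn; apply: bump_support => // /hB Bn.
  have : (A `&` B) (iter n f y) by split=> //; exact: hA.
  by rewrite AB0.
have phi1 p : `|phi p| <= 1 by rewrite ger0_norm ?bump_ge0 // bump_le1.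
have [n0 h0] := observable_mean L1 K1 LK tL tK t01 gy y0 phi1
  (@bump_continuous x e) (divr_gt0 c0 (ltr0n R 2)).
have [n1 h1] := eventually_ge ((N%:R + 1) * 2 / c).
pose n := (n0 + n1 + N)%N.
have := h0 n (leq_trans (leq_addr _ _) (leq_addr _ _)); rewrite -/c.
have := h1 n (leq_trans (leq_addl _ _) (leq_addr _ _)).
rewrite ler_pdivrMr // => nc.
have : \sum_(j < n) (phi (iter j f y) - c) <= N%:R - c * n%:R.
  rewrite sumrB sumr_const card_ord -[c *+ n]mulr_natr lerD2r.
  rewrite -(big_mkord xpredT (fun j => phi (iter j f y))).
  rewrite (@big_cat_nat _ _ _ N) //=; last by rewrite leq_addl.
  rewrite [X in _ + X]big_nat_cond [X in _ + X]big1 ?addr0; last first.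
    by move=> i /andP[/andP[Ni _] _]; exact: phi0.
  have -> : N%:R = \sum_(0 <= i < N) (1 : R) by rewrite sumr_const_nat subn0.
  apply: ler_sum => i _.
  by have := phi1 (iter i f y); rewrite ler_norml => /andP[].
move=> up; rewrite ler_norml => /andP[lo _]; move: lo up nc.
set S := \sum_(_ < _) _; set u := n%:R; set v := N%:R.
exact: (bump_mean_absurd (ler0n R N)).
Qed.

(** An orbit of V other than the source accumulates at both saddles. This keeps the stable sets of
    the saddles out of V. *)
Lemma not_cvg_saddle x y : x = (-1, 0) \/ x = (1, 0) -> gauge y < 1 ->
  ~ (iter n f y @[n --> \oo] --> x).
Proof.
move=> xs gy cx; have hR := @norm_hausdorff R (R * R)%type.
have sep := @saddles_neq R.
have [y0|y0] := pselect (y = (0, 0)).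
  have fix0 n : iter n f y = (0, 0).
    by elim: n => //= n ->; rewrite bowen0.
  have c0 : iter n f y @[n --> \oo] --> ((0, 0) : R * R).
    by under eq_fun do rewrite fix0; exact: cvg_cst.
  exact: saddles_neq0 xs (cvg_unique hR cx c0).
have key z : z = (-1, 0) \/ z = (1, 0) -> x = z.
  by move=> zs; apply: hR; apply: (cvg_cluster cx); exact: saddle_in_omega.
by apply: sep; rewrite -(key (1, 0)) ?(key (-1, 0)); [|left|right].
Qed.

Lemma not_cvg_saddle_inv x y : x = (-1, 0) \/ x = (1, 0) -> gauge y < 1 ->
  ~ (iter n (bowen_inv kap L K) y @[n --> \oo] --> x).
Proof.
move=> xs gy cx.
have : cluster (iter n (bowen_inv kap L K) y @[n --> \oo]) x.
  by move=> A B hA nB; have [z Az] := filter_ex (filterI hA (cx _ nB)); exists z.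
rewrite (cluster_bowen_inv L1 K1 LK gy) /= => x0; exact: saddles_neq0 xs x0.
Qed.

End omega_limits.

(** * Half-branches and their images under the symmetries *)

Section half_branches.
Variable R : realType.
Implicit Types (p q : R * R) (s : R) (T : R * R -> R * R).

Definition ray : set (R * R) := @axis R @` [set s | 0 <= s].

Lemma rayE : ray = [set p | [/\ be p = 0, 0 <= al p & p <> (1, 0)]].
Proof.
have [al1 [al1' _]] := saddle_coord R.
apply/seteqP; split=> [_ [s /= s0 <-]|p [b0 a0 p1]].
  have [_ aE bE] := axis_pt s; rewrite aE bE; split=> //.
    by case: ifP; rewrite ?invr_ge0.
  move=> e; have := axis_fst s; rewrite e /=.
  case: (leP s 1) => s1 h; first by move: h; lra.
  move: aE; rewrite e al1' leNgt s1 /= => /esym/eqP; rewrite invr_eq0; lra.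
have h : (p.1 <= 0) || (0 < al p).
  case: (leP p.1 0) => //= p0; rewrite lt_neqAle a0 andbT eq_sym.
  apply/eqP => a00; apply: p1; rewrite -(@pt_coord R true p) ?(ltW p0) //.
  by rewrite a00 b0 pt00.
exists (axis_time p); last exact: axis_onto.
by rewrite /= /axis_time; case: ifP; rewrite ?invr_ge0.
Qed.

(** The excluded endpoint (1, 0) is where the inverse of al would blow up; on the y-axis both
    formulas give 1. *)
Lemma axis_time_continuous p : ray p -> {for p, continuous (@axis_time R)}.
Proof.
rewrite rayE => -[b0 a0 p1]; have cal := @al_continuous R p.
case: (ltgtP p.1 0) => p0.
- have n : nbhs p [set q : R * R | q.1 < 0].
    exact: (@cvgr_lt _ _ (nbhs p) (nbhs_filter p) fst p.1 cvg_fst 0 p0).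
  rewrite /prop_for /continuous_at {2}/axis_time (ltW p0).
  apply: (cvg_trans _ cal); apply: near_eq_cvg.
  by apply: filterS n => q q0; rewrite /axis_time (ltW q0).
- have n : nbhs p [set q : R * R | 0 < q.1].
    exact: (@cvgr_gt _ _ (nbhs p) (nbhs_filter p) fst p.1 cvg_fst 0 p0).
  have an : al p != 0.
    apply/eqP => a00; apply: p1; rewrite -(@pt_coord R true p) ?(ltW p0) //.
    by rewrite a00 b0 pt00.
  rewrite /prop_for /continuous_at {2}/axis_time leNgt p0 /=.
  apply: (cvg_trans _ (cvgV an cal)); apply: near_eq_cvg.
  by apply: filterS n => q q0; rewrite /axis_time leNgt q0.
- have a1 : al p = 1 by have := axis_max p0; rewrite b0 max_l.
  have an : al p != 0 by rewrite a1 oner_neq0.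
  move=> A; rewrite /axis_time p0 lexx => nA.
  have n1 : nbhs p (@al R @^-1` A) by exact: cal.
  have n2 : nbhs p ((fun q => (al q)^-1) @^-1` A).
    by apply: (cvgV an cal); rewrite a1 invr1 -a1.
  by apply: filterS2 n1 n2 => q q1 q2; rewrite /preimage /=; case: ifP.
Qed.

Lemma line_derive (h : R -> R) (u v s : R) : (\forall r \near s, h r = u + v * r) ->
  derivable h s 1 /\ derive1 h s = v.
Proof.
move=> hn; pose g := fun r : R => u + v * r.
have e : (fun d : R => d^-1 *: ((g (d *: (1 : R) + s)) - g s)) @ 0^' --> v.
  apply: cvg_near_cst; near=> d.
  have d0 : d != 0 by near: d; exact: nbhs_dnbhs_neq.
  rewrite /g /GRing.scale /=; field; exact: d0.
have dg : derivable g s 1 by apply/cvg_ex; exists v; exact: e.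
split; first by apply: near_eq_derivable dg => //; apply: filterS hn => r ->.
rewrite derive1E (@near_eq_derive _ _ _ h g s 1 hn).
exact: (cvg_lim (@norm_hausdorff _ _) e).
Unshelve. all: by end_near. Qed.

Lemma axis_near0 s : `|s| < 1 / 2 -> axis s = (s / 2 - 1, - (s / 2)).
Proof.
rewrite ltr_norml => /andP[s1 s2]; rewrite /axis ifT; last by lra.
rewrite /pt addr0; congr pair; last by lra.
by case: (leP s 0) => s0; rewrite min_l; lra.
Qed.

Lemma C1_curve_axis (e1 e2 : R) (c : R -> plane R) : e1 != 0 ->
  (forall s, c s = (e1 * (axis s).1, e2 * (axis s).2)) -> C1_curve_near0 c.
Proof.
move=> e10 cE i _; exists (1 / 2) => [|s s2]; first by lra.
pose u (a : 'I_2) := if a == 0 then - e1 else 0.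
pose v (a : 'I_2) := if a == 0 then e1 / 2 else - (e2 / 2).
have nr (r : R) : `|r| < 1 / 2 -> \forall r' \near r, `|r'| < 1 / 2.
  move=> h; apply/nbhs_ballP; exists (1 / 2 - `|r|); first by rewrite /= subr_gt0.
  move=> r'; rewrite /ball /= => d; have := ler_distD r r' 0.
  by rewrite !subr0 distrC; lra.
have lin a r : `|r| < 1 / 2 ->
    \forall r' \near r, (Defs.coord a \o chart i \o c) r' = u a + v a * r'.
  move=> /nr; apply: filterS => r' h; rewrite /= /Defs.coord cE axis_near0 // /u /v.
  by case: eqP => _ /=; lra.
split=> //.
- by move=> a; have [] := line_derive (lin a s s2).
- move=> a; rewrite /prop_for /continuous_at (proj2 (line_derive (lin a s s2))).
  apply: cvg_near_cst; apply: filterS (nr s s2) => r /lin/line_derive.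
  by move=> /(_ a)[].
- exists 0; rewrite (proj2 (line_derive (lin 0 s s2))) /v eqxx.
  by rewrite mulf_neq0 // invr_neq0.
Qed.

Section symmetric_branch.
Variables (kap L K : R) (S T : R * R -> R * R) (e1 e2 : R).
Hypotheses (L1 : 1 < L) (K1 : 1 < K) (LK : L * K = kap).
Hypotheses (e10 : e1 != 0) (SE : forall p, S p = (e1 * p.1, e2 * p.2)).
Hypothesis SK : involutive S.
Hypothesis ST : forall p, 1 <= gauge p -> T (S p) = S (bowen kap L K p).
Hypothesis inT : forall p, gauge p < 1 ->
  ~ (iter n T (S p) @[n --> \oo] --> S (-1, 0)).

Let S_continuous : continuous S.
Proof.
have -> : S = fun p => (e1 * p.1, e2 * p.2) by apply/funext.
by cont.
Qed.

Let S_cvg (u : nat -> R * R) x : u n @[n --> \oo] --> x ->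
  S (u n) @[n --> \oo] --> S x.
Proof. by move=> h; exact: (continuous_cvg _ (S_continuous (x:=x)) h). Qed.

Let iter_S n p : 1 <= gauge p -> iter n T (S p) = S (iter n (bowen kap L K) p).
Proof.
move=> g; elim: n => //= n ->; apply: ST.
exact: iter_outside_gauge.
Qed.

(** All four half-branches are obtained with S among id, [rot], [refl] and their composition, and T
    the Bowen map or its inverse. The conjugacy is required only outside V, because [refl] does not
    reverse [push] inside; there [inT] excludes convergence to the saddle. *)
Lemma symmetric_half_branch :
  @stable_half_branch R (plane R) T (S (-1, 0)) (S @` ray).
Proof.
exists (S \o @axis R); split.
- split; first by rewrite /= axis0.
  move=> s; apply: (@continuous_comp _ _ _ (@axis R) S); last exact: S_continuous.
  exact: axis_continuous.
- split; first exact: (inj_comp (can_inj SK) (can_inj (@axisK R))).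
  apply/seteqP; split=> [_ [s _ <-]|y cy].
    rewrite /stable_set /=.
    rewrite (_ : (fun n => iter n T (S (axis s))) =
      fun n => S (iter n (bowen kap L K) (axis s))).
      exact: (S_cvg (axis_cvg L1 K1 LK s)).
    by apply/funext => n; rewrite iter_S // axis_gauge.
  have yE : y = S (S y) by rewrite SK.
  have g : 1 <= gauge (S y).
    by rewrite leNgt; apply/negP => /inT; rewrite -yE; exact.
  have c2 : iter n (bowen kap L K) (S y) @[n --> \oo] --> ((-1, 0) : R * R).
    have := S_cvg cy; rewrite SK.
    rewrite (_ : (fun n => S (iter n T y)) = fun n => iter n (bowen kap L K) (S y)) //.
    by apply/funext => n; rewrite {1}yE iter_S // SK.
  have [s es] := axis_stable L1 K1 LK g c2.
  by exists s => //=; rewrite es SK.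
- move=> N r nN.
  have := axis_uniform_cvg L1 K1 LK r (S_continuous nN).
  apply: filterS => n h s sr; rewrite /= iter_S ?axis_gauge //; exact: h.
- by apply: (@C1_curve_axis e1 e2) => // s; rewrite /= SE.
- by rewrite /ray image_comp.
Qed.

Lemma symmetric_arc : @embedded_arc R (plane R) (S @` ray).
Proof.
exists (S \o @axis R), (@axis_time R \o S); split.
- apply: continuous_subspaceT => s.
  apply: (@continuous_comp _ _ _ (@axis R) S); last exact: S_continuous.
  exact: axis_continuous.
- apply: continuous_in_subspaceT => p; rewrite inE => -[q rq <-].
  apply: (@continuous_comp _ _ _ S (@axis_time R)); first exact: S_continuous.
  by rewrite SK; exact: axis_time_continuous.
- by rewrite image_comp.
- apply/seteqP; split=> [_ [_ [_ [s s0 <-] <-] <-]|s s0].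
    by rewrite /= SK axisK.
  exists (S (axis s)); last by rewrite /= SK axisK.
  by exists (axis s) => //; exists s.
- by move=> s _; rewrite /= SK axisK.
Qed.

End symmetric_branch.
End half_branches.

Section bowen_branches.
Variables (R : realType) (kap L K t : R).
Hypotheses (L1 : 1 < L) (K1 : 1 < K) (LK : L * K = kap).
Hypotheses (tL : t * ln L = 1) (tK : (1 - t) * ln K = 1) (t01 : 0 < t < 1).
Implicit Types p : R * R.
Let KL : K * L = kap. Proof. by rewrite mulrC. Qed.
Let k1 : 1 < kap. Proof. exact: (kap_gt1 L1 K1 LK). Qed.
Local Notation f := (bowen kap L K).
Local Notation g := (bowen_inv kap L K).
Local Notation x1 := ((-1, 0) : R * R).
Local Notation x2 := ((1, 0) : R * R).
Let half_branch := @stable_half_branch R (plane R).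

Lemma gauge_refl p : gauge (refl p) = gauge p.
Proof. by rewrite /gauge depth_refl /= normrN. Qed.

Lemma bowen_inv_refl p : 1 <= gauge p -> g (refl p) = refl (f p).
Proof.
move=> gp; have := bowen_outside_gauge L1 K1 LK gp.
rewrite (bowen_outside _ _ k1 gp) /bowen_inv /back reflK => gq.
have e : push kap (refl (step kap L K p)) = refl (step kap L K p).
  by rewrite push_out // gauge_refl.
by rewrite -{1}e (pushK k1).
Qed.

Lemma stable_left : half_branch f x1 (id @` @ray R).
Proof.
apply: (@symmetric_half_branch R kap L K id f 1 1) => //; try exact: oner_neq0.
- by move=> [x y] /=; rewrite !mul1r.
- by move=> p gp; apply: (not_cvg_saddle L1 K1 LK tL tK t01) => //; left.
Qed.

Lemma stable_right : half_branch f x2 (@rot R @` @ray R).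
Proof.
have e : rot x1 = x2 by rewrite /rot /= opprK oppr0.
rewrite -e; apply: (@symmetric_half_branch R kap K L (@rot R) f (-1) (-1)) => //; try by rewrite oppr_eq0 oner_neq0.
- by move=> [x y]; rewrite /rot /= !mulN1r.
- exact: rotK.
- by move=> p _; rewrite (bowen_rot _ K1 L1 KL).
- move=> p gp; apply: (not_cvg_saddle L1 K1 LK tL tK t01); last by rewrite gauge_rot.
  by right.
Qed.

Lemma unstable_left : half_branch g x1 (@refl R @` @ray R).
Proof.
have e : refl x1 = x1 by rewrite /refl /= oppr0.
rewrite -{1}e; apply: (@symmetric_half_branch R kap L K (@refl R) g 1 (-1)) => //; try exact: oner_neq0.
- by move=> [x y]; rewrite /refl /= mul1r mulN1r.
- exact: reflK.
- exact: bowen_inv_refl.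
- move=> p gp; apply: (not_cvg_saddle_inv L1 K1 LK); last by rewrite gauge_refl.
  by left; rewrite e.
Qed.

Lemma unstable_right : half_branch g x2 ((fun p => refl (rot p)) @` @ray R).
Proof.
have e : refl (rot x1) = x2 by rewrite /refl /rot /= !opprK.
rewrite -{1}e.
apply: (@symmetric_half_branch R kap K L (fun p => refl (rot p)) g (-1) 1) => //; try by rewrite oppr_eq0 oner_neq0.
- by move=> [x y]; rewrite /refl /rot /= mul1r mulN1r opprK.
- by move=> [x y]; rewrite /refl /rot /= !opprK.
- by move=> p gp; rewrite bowen_inv_refl ?gauge_rot // (bowen_rot _ K1 L1 KL).
- move=> p gp; apply: (not_cvg_saddle_inv L1 K1 LK).
    by right; rewrite e.
  by rewrite gauge_refl gauge_rot.
Qed.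

End bowen_branches.

(** * The boundary of V as a union of half-branches *)

Section boundary.
Variable R : realType.
Implicit Types p : R * R.

Lemma rot_ray : @rot R @` @ray R =
  [set p | [/\ al p = 0, 0 <= be p & p <> (-1, 0)]].
Proof.
rewrite rayE; apply/seteqP; split=> [_ [p [b0 a0 p1] <-]|p [a0 b0 p1]].
  split; rewrite ?al_rot ?be_rot // => e; apply: p1; rewrite -[p]rotK e.
  by rewrite /rot /= opprK oppr0.
exists (rot p); last exact: rotK.
split; rewrite ?al_rot ?be_rot // => e; apply: p1; rewrite -[p]rotK e.
by rewrite /rot /= oppr0.
Qed.

Lemma refl_ray : @refl R @` @ray R =
  [set p | [/\ al p = 0, 0 <= be p & p <> (1, 0)]].
Proof.
rewrite rayE; apply/seteqP; split=> [_ [p [b0 a0 p1] <-]|p [a0 b0 p1]].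
  split; rewrite ?al_refl ?be_refl // => e; apply: p1; rewrite -[p]reflK e.
  by rewrite /refl /= oppr0.
exists (refl p); last exact: reflK.
split; rewrite ?al_refl ?be_refl // => e; apply: p1; rewrite -[p]reflK e.
by rewrite /refl /= oppr0.
Qed.

Lemma refl_rot_ray : (fun p => refl (rot p)) @` @ray R =
  [set p | [/\ be p = 0, 0 <= al p & p <> (-1, 0)]].
Proof.
rewrite -(image_comp (@rot R) (@refl R)) rot_ray.
apply/seteqP; split=> [_ [p [a0 b0 p1] <-]|p [b0 a0 p1]].
  split; rewrite ?al_refl ?be_refl // => e; apply: p1; rewrite -[p]reflK e.
  by rewrite /refl /= oppr0.
exists (refl p); last exact: reflK.
split; rewrite ?al_refl ?be_refl // => e; apply: p1; rewrite -[p]reflK e.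
by rewrite /refl /= oppr0.
Qed.

(** Each ray misses only the saddle at its far end, which is the starting point of the other ray. *)
Lemma ray_union : id @` @ray R `|` @rot R @` @ray R = [set p : R * R | gauge p = 1].
Proof.
have [al1 [al1' _]] := saddle_coord R.
have be1 (r : bool) : be (((if r then 1 else -1), 0) : R * R) = 0.
  by rewrite -pt00 be_pt.
have sep := @saddles_neq R.
have gE p : gauge p = 1 <-> (al p = 0 /\ 0 <= be p) \/ (be p = 0 /\ 0 <= al p).
  rewrite gauge_al_be; case: (leP (al p) (be p)) => h; split.
  - by move=> e; left; split; lra.
  - by case=> -[]; lra.
  - by move=> e; right; split; lra.
  - by case=> -[]; lra.
rewrite image_id rot_ray rayE; apply/seteqP; split=> p.
  by case=> -[h1 h2 _]; apply/gE; [right|left].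
move=> /gE[] [h1 h2].
  have [->|pn] := pselect (p = (-1, 0)); last by right.
  by left; split; [exact: (be1 false)|rewrite al1|move=> e; apply: sep].
have [->|pn] := pselect (p = (1, 0)); last by left.
by right; split; [exact: al1'|rewrite (be1 true)|].
Qed.

Lemma rays_glue1 : (id @` @ray R) `\ ((-1, 0) : R * R) =
  ((fun p => refl (rot p)) @` @ray R) `\ ((1, 0) : R * R).
Proof.
rewrite image_id refl_rot_ray rayE; apply/seteqP.
by split=> p [[h1 h2 h3] /= h4].
Qed.

Lemma rays_glue2 : (@refl R @` @ray R) `\ ((-1, 0) : R * R) =
  (@rot R @` @ray R) `\ ((1, 0) : R * R).
Proof.
rewrite refl_ray rot_ray; apply/seteqP.
by split=> p [[h1 h2 h3] /= h4].
Qed.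

End boundary.

(** * Topology of the region *)

Section radial_homeomorphisms.
Variable R : realType.
Implicit Types (p q : R * R) (N : R * R -> R).

(** Enough of a norm to carry the round disc and circle onto V and its boundary along rays. *)
Record radial_norm N : Prop := RadialNorm {
  radial_continuous : continuous N;
  radial_scale : forall c p, 0 <= c -> N (scale c p) = c * N p;
  radial_fst : forall p, `|p.1| <= N p;
  radial_snd : forall p, `|p.2| <= N p }.

Definition hypot p : R := Num.sqrt (p.1 ^+ 2 + p.2 ^+ 2).

Lemma hypot_radial : radial_norm hypot.
Proof.
split=> [p|c p c0|p|p].
- apply: (@continuous_comp _ _ _ (fun p : R * R => p.1 ^+ 2 + p.2 ^+ 2)).
    have c : continuous (fun q : R * R => q.1 * q.1 + q.2 * q.2) by cont.
    exact: c.
  exact: sqrt_continuous.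
- rewrite /hypot /scale /= !exprMn -mulrDr sqrtrM ?sqr_ge0 // sqrtr_sqr.
  by rewrite ger0_norm.
- rewrite -sqrtr_sqr ler_wsqrtr // lerDl sqr_ge0 //.
- rewrite -sqrtr_sqr ler_wsqrtr // lerDr sqr_ge0 //.
Qed.

Lemma gauge_radial : radial_norm (@gauge R).
Proof.
split; [exact: gauge_continuous | | exact: fst_gauge | exact: snd_gauge].
by move=> c p c0; rewrite gauge_scale.
Qed.

Lemma radial_ge0 N p : radial_norm N -> 0 <= N p.
Proof. by move=> h; exact: le_trans (radial_fst h p). Qed.

Lemma radial_eq0 N p : radial_norm N -> N p = 0 -> p = (0, 0).
Proof.
move=> h e; have := radial_fst h p; have := radial_snd h p.
by rewrite e !normr_le0 => /eqP p2 /eqP p1; rewrite [p]surjective_pairing p1 p2.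
Qed.

Lemma radial0 N : radial_norm N -> N (0, 0) = 0.
Proof.
move=> h; have := radial_scale h (0, 0) (lexx 0).
by rewrite mul0r /scale /= mulr0.
Qed.

Definition rescale N N' p : R * R := scale (N p / N' p) p.

Lemma rescale_norm N N' p : radial_norm N -> radial_norm N' ->
  N' (rescale N N' p) = N p.
Proof.
move=> h h'; rewrite /rescale radial_scale //; last first.
  by rewrite divr_ge0 // radial_ge0.
have [e|e] := eqVneq (N' p) 0; last by rewrite divfK.
by rewrite (radial_eq0 h' e) !radial0 // mulr0.
Qed.

Lemma rescaleK N N' p : radial_norm N -> radial_norm N' ->
  rescale N' N (rescale N N' p) = p.
Proof.
move=> h h'; have [e|e] := eqVneq (N p) 0.
  by rewrite (radial_eq0 h e) /rescale /scale /= !mulr0.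
have e' : N' p != 0.
  by apply: contra e => /eqP /(radial_eq0 h') ->; rewrite radial0.
rewrite {1}/rescale rescale_norm // {1}/rescale radial_scale //; last first.
  by rewrite divr_ge0 // radial_ge0.
rewrite /rescale scaleM (_ : _ * _ = 1) ?scale1 //.
by field; rewrite e e'.
Qed.

Lemma rescale_continuous N N' : radial_norm N -> radial_norm N' ->
  continuous (rescale N N').
Proof.
move=> h h' p; have [e|e] := eqVneq (N' p) 0.
  (* At the origin the ratio of the two norms need not converge, but the image of q has N'-size N q,
     which tends to 0. *)
  have p0 := radial_eq0 h' e; rewrite p0 /continuous_at.
  have -> : rescale N N' (0, 0) = (0, 0) by rewrite /rescale /scale /= !mulr0.
  move=> A /nbhs_ballP[d /= d0 hd].
  pose z : R * R := (0, 0); have zd : N z < d by rewrite radial0.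
  have n := @cvgr_lt _ _ (nbhs z) (nbhs_filter z) N _ (@radial_continuous N h z) d zd.
  apply: filterS n => q /= qd; apply: hd.
  have e1 := radial_fst h' (rescale N N' q); have e2 := radial_snd h' (rescale N N' q).
  rewrite rescale_norm // in e1 e2.
  by split; rewrite /ball /= sub0r normrN; [exact: le_lt_trans e1 qd | exact: le_lt_trans e2 qd].
have c : {for p, continuous (fun q => N q / N' q)}.
  by apply: cvgM; [exact: radial_continuous h p | apply: cvgV => //; exact: radial_continuous h' p].
have c1 : {for p, continuous (fun q : R * R => N q / N' q * q.1)}.
  by apply: (cvgM c); exact: cvg_fst.
have c2 : {for p, continuous (fun q : R * R => N q / N' q * q.2)}.
  by apply: (cvgM c); exact: cvg_snd.
exact: (cvg_pair c1 c2).
Qed.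

Lemma rescale_homeomorphic N N' (P : set R) : radial_norm N -> radial_norm N' ->
  homeomorphic [set p | P (N p)] [set p | P (N' p)].
Proof.
move=> h h'; exists (rescale N N'), (rescale N' N); split.
- by apply: continuous_subspaceT; exact: rescale_continuous.
- by apply: continuous_subspaceT; exact: rescale_continuous.
- apply/seteqP; split=> [_ [p Pp <-]|p Pp]; first by rewrite /= rescale_norm.
  by exists (rescale N' N p); rewrite ?rescaleK //= rescale_norm.
- apply/seteqP; split=> [_ [p Pp <-]|p Pp]; first by rewrite /= rescale_norm.
  by exists (rescale N N' p); rewrite ?rescaleK //= rescale_norm.
- by move=> p _; rewrite rescaleK.
Qed.

Lemma open_disc_homeomorphic :
  homeomorphic (@open_disc R) [set p : R * R | gauge p < 1].
Proof.
have -> : @open_disc R = [set p | hypot p < 1].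
  apply/seteqP; split=> p; rewrite /open_disc /hypot /= => h.
    by rewrite -sqrtr1 ltr_sqrt.
  by move: h; rewrite -{1}sqrtr1 ltr_sqrt.
exact: (@rescale_homeomorphic hypot (@gauge R) [set x | x < 1] hypot_radial gauge_radial).
Qed.

Lemma unit_circle_homeomorphic :
  homeomorphic (@unit_circle R) [set p : R * R | gauge p = 1].
Proof.
have -> : @unit_circle R = [set p | hypot p = 1].
  apply/seteqP; split=> p; rewrite /unit_circle /hypot /= => h.
    by rewrite h sqrtr1.
  by rewrite -[LHS]sqr_sqrtr ?h ?expr1n // addr_ge0 ?sqr_ge0.
exact: (@rescale_homeomorphic hypot (@gauge R) [set x | x = 1] hypot_radial gauge_radial).
Qed.

Lemma open_gauge : open [set p : R * R | gauge p < 1].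
Proof.
rewrite openE => p gp.
exact: (@cvgr_lt _ _ (nbhs p) (nbhs_filter p) (@gauge R) _ (@gauge_continuous R p) 1 gp).
Qed.

Lemma closure_gauge : closure [set p : R * R | gauge p < 1] = [set p | gauge p <= 1].
Proof.
apply/seteqP; split.
  have c := closed_le (c := 1) (@gauge_continuous R).
  apply: (@subset_trans _ (closure [set p : R * R | gauge p <= 1])) => [|p].
    by apply: closure_subset => p /= /ltW.
  by move=> h; exact: c h.
move=> p /= gp B nB.
have cs : continuous (fun c : R => scale c p).
  by have cid : continuous (fun c : R => c) by [move=> c; exact: cvg_id]; rewrite /scale; cont.
have n1 : nbhs (1 : R) [set c | B (scale c p)].
  by apply: cs; rewrite /= scale1.
have /nbhs_ballP[e /= e0 he] := n1.
(* A factor slightly below 1 moves p into V without leaving the given neighbourhood. *)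
pose c := 1 - Num.min (e / 2) (1 / 2).
have m0 : 0 < Num.min (e / 2) (1 / 2) by rewrite lt_min; apply/andP; split; lra.
have m1 : Num.min (e / 2) (1 / 2) <= 1 / 2 by rewrite ge_min lexx orbT.
have m2 : Num.min (e / 2) (1 / 2) <= e / 2 by rewrite ge_min lexx.
have c0 : 0 <= c by rewrite /c; lra.
exists (scale c p); split.
  rewrite /= gauge_scale //; have := gauge_ge0 p.
  by rewrite /c; nra.
apply: he; rewrite /ball /= /c opprB addrC subrK gtr0_norm //; lra.
Qed.

Lemma gauge_boundary : closure [set p : R * R | gauge p < 1] `\`
  interior [set p : R * R | gauge p < 1] = [set p | gauge p = 1].
Proof.
have /interior_id -> := open_gauge; rewrite closure_gauge.
apply/seteqP; split=> p /=; first by move=> [h1 /negP h2]; apply: le_anti; rewrite h1 leNgt.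
by move=> ->; split; rewrite ?lexx ?ltxx.
Qed.

Lemma compact_gauge_sphere : compact [set p : R * R | gauge p = 1].
Proof.
apply: (subclosed_compact _ (@compact_gauge_theta R 0)); last first.
  move=> p /= g1; rewrite g1 lexx; split=> //.
  have : gauge p <= 1 by rewrite g1.
  by rewrite gauge_le1 => /andP[*]; exact: mulr_ge0.
have -> : [set p : R * R | gauge p = 1] =
    [set p | gauge p <= 1] `&` [set p | 1 <= gauge p].
  apply/seteqP; split=> p /=; first by move=> ->.
  by move=> [h1 h2]; apply: le_anti; rewrite h1.
by apply: closedI; [apply: closed_le | apply: closed_ge]; exact: gauge_continuous.
Qed.

Lemma small_box p (A : set (R * R)) : nbhs p A ->
  exists U, [/\ compact U, nbhs p U & U `<=` A].
Proof.
move=> /nbhs_ballP[e /= e0 he].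
exists ([set` `[p.1 - e / 2, p.1 + e / 2]] `*` [set` `[p.2 - e / 2, p.2 + e / 2]]).
split; first by apply: compact_setX; exact: segment_compact.
  apply/nbhs_ballP; exists (e / 2) => [/=|q [/=]]; first by lra.
  rewrite /ball /= !ltr_norml => /andP[? ?] /andP[? ?].
  by split; rewrite /= in_itv /=; apply/andP; split; lra.
move=> q [/=]; rewrite !in_itv /= => /andP[? ?] /andP[? ?]; apply: he.
by split; rewrite /ball /= ltr_norml; apply/andP; split; lra.
Qed.

(** * Affine neighbourhoods of the fixed points *)

Section saddles_and_source.
Variables (kap L K : R).
Hypotheses (L1 : 1 < L) (K1 : 1 < K) (LK : L * K = kap).
Local Notation f := (bowen kap L K).
Local Notation g := (bowen_inv kap L K).

(** Taking interiors makes each affine identity hold on a neighbourhood of the point, and continuity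
    of the inverse transfers it to the inverse map. *)
Definition affine_part : set (R * R) :=
  ([set p | f p = saddle_map (-1) L p]° `|` [set p | f p = saddle_map 1 K p]°) `|`
  [set p | f p = scale 2 p]°.

Lemma affine_part_open : open affine_part.
Proof. by apply: openU; [apply: openU|]; exact: open_interior. Qed.

Lemma affine_part_forward p : affine_part p -> affine_near f p.
Proof.
move=> [[h|h]|h].
- exact: affine_near_eq h (saddle_map_affine _ _ _).
- exact: affine_near_eq h (saddle_map_affine _ _ _).
- exact: affine_near_eq h (scale_affine _ _).
Qed.

Lemma affine_part_backward p : affine_part (g p) -> affine_near g p.
Proof.
have inv (F G : R * R -> R * R) : cancel F G ->
    [set p | f p = F p]° (g p) -> \forall q \near p, g q = G q.
  move=> FG h; have : \forall q \near p, [set p | f p = F p]° (g q).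
    apply: (bowen_inv_continuous L1 K1 LK).
    by apply: open_nbhs_nbhs; split=> //; exact: open_interior.
  apply: filterS => q /interior_subset /= e.
  by rewrite -[in RHS](bowen_invK L1 K1 LK q) e FG.
have L0 : L != 0 by rewrite gt_eqF //; move: L1; lra.
have K0 : K != 0 by rewrite gt_eqF //; move: K1; lra.
have s2 : cancel (@scale R 2) (scale (1 / 2)).
  by move=> q; rewrite scaleM (_ : 1 / 2 * 2 = 1) ?scale1 //; lra.
move=> [[h|h]|h].
- exact: affine_near_eq (inv _ _ (saddle_mapK (-1) L0) h) (saddle_map_affine _ _ _).
- exact: affine_near_eq (inv _ _ (saddle_mapK 1 K0) h) (saddle_map_affine _ _ _).
- exact: affine_near_eq (inv _ _ s2 h) (scale_affine _ _).
Qed.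

Lemma bowen_diffeomorphism (A : set (plane R)) : A `<=` affine_part ->
  @diffeomorphism_on R (plane R) f g A.
Proof.
move=> AO; split.
  exists affine_part; split=> //; first exact: affine_part_open.
  by apply: C1_on_affine_near; [exact: affine_part_open | exact: affine_part_forward].
have oG : open (g @^-1` affine_part).
  apply: open_comp; last exact: affine_part_open.
  by move=> p _; exact: (bowen_inv_continuous L1 K1 LK).
exists (g @^-1` affine_part); split=> //.
  by move=> _ [p Ap <-]; rewrite /preimage /= (bowenK L1 K1 LK); exact: AO.
by apply: C1_on_affine_near => // p; exact: affine_part_backward.
Qed.

Lemma affine_neighbourhoods : exists U1 U2 U3 : set (R * R),
  [/\ [/\ compact U1, compact U2 & compact U3],
      [/\ nbhs ((-1, 0) : R * R) U1, nbhs ((1, 0) : R * R) U2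
        & nbhs ((0, 0) : R * R) U3],
      [/\ U1 `&` U2 = set0, U1 `&` U3 = set0 & U2 `&` U3 = set0]
    & U1 `|` U2 `|` U3 `<=` affine_part].
Proof.
have box (c : R) (A : set (R * R)) : nbhs ((c, 0) : R * R) A ->
    exists U, [/\ compact U, nbhs ((c, 0) : R * R) U,
      U `<=` A & forall p, U p -> `|c - p.1| < 1 / 4].
  (* First coordinates within 1 / 4 of -1, 1 and 0 keep the three neighbourhoods disjoint. *)
  move=> nA; have nb : nbhs ((c, 0) : R * R) (ball ((c, 0) : R * R) (1 / 4 : R)).
    by apply: nbhsx_ballx; lra.
  have [U [cU nU UA]] := small_box (filterI nA nb).
  by exists U; split=> // p /UA[] // _ [].
have int (F : R * R -> R * R) p : (\forall q \near p, f q = F q) ->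
    nbhs p [set p | f p = F p]°.
  by move=> h; apply: open_nbhs_nbhs; split; [exact: open_interior | exact: h].
have [U1 [c1 m1 s1 b1]] := box (-1) _ (int _ _ (bowen_near_left L1 K1 LK)).
have [U2 [c2 m2 s2 b2]] := box 1 _ (int _ _ (bowen_near_right L1 K1 LK)).
have [U3 [c3 m3 s3 b3]] := box 0 _ (int _ _ (bowen_near_source L1 K1 LK)).
exists U1, U2, U3; split=> //.
- by split; apply/seteqP; split=> // p [];
    [move=> /b1 + /b2 | move=> /b1 + /b3 | move=> /b2 + /b3];
    rewrite !ltr_norml => /andP[? ?] /andP[? ?]; lra.
- by move=> p [[/s1|/s2]|/s3] h; [left; left|left; right|right].
Qed.

Lemma bowen_hyperbolic :
  [/\ @saddle_at R (plane R) f ((-1, 0) : R * R),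
      @saddle_at R (plane R) f ((1, 0) : R * R)
    & @source_at R (plane R) f ((0, 0) : R * R)].
Proof.
split=> i _.
- have := jacobian_saddle (bowen_near_left L1 K1 LK) => e.
  by rewrite (_ : jacobian2 _ _ = jacobian2 f (-1, 0)) // e; exact: saddle_hyperbolic.
- have := jacobian_saddle (bowen_near_right L1 K1 LK) => e.
  by rewrite (_ : jacobian2 _ _ = jacobian2 f (1, 0)) // e; exact: saddle_hyperbolic.
- have := jacobian_scale (bowen_near_source L1 K1 LK) => e.
  by rewrite (_ : jacobian2 _ _ = jacobian2 f (0, 0)) // e; exact: scale_hyperbolic.
Qed.

End saddles_and_source.
End radial_homeomorphisms.

(** * Limit measures *)

Section atoms.
Variable R : realType.
Local Notation M := (plane R).
Local Notation bM := (borel M).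
Implicit Types (phi g : M -> R).

Lemma continuous_borel_fun phi : continuous phi ->
  measurable_fun (setT : set bM) (phi : bM -> measurableTypeR R).
Proof.
move=> cphi; apply: (measurability _ (RGenOpens.measurableE R)).
move=> _ [_ [a [b ->]] <-]; rewrite setTI; apply: sub_sigma_algebra.
by apply: open_comp => [p _|]; [exact: cphi | exact: interval_open].
Qed.

(** W is a finite combination of point evaluations; the last hypothesis is its linearity on the
    positive and negative parts of phi, which reduces the integral to nonnegative functions. *)
Lemma Rintegral_linear (m : {measure set bM -> \bar R}) (W : (M -> R) -> R) phi :
  continuous phi ->
  (forall g, continuous g -> (forall x, 0 <= g x) ->
    (\int[m]_(x in setT) (g x)%:E = (W g)%:E)%E) ->
  W (fun x => Num.max (phi x) 0) - W (fun x => Num.max (- phi x) 0) = W phi ->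
  (\int[m]_x phi x)%R = W phi.
Proof.
move=> cphi hW lin; rewrite /Rintegral integralE.
have cP : continuous (fun x => Num.max (phi x) 0).
  by apply: cont_max => //; exact: cont_cst.
have cN : continuous (fun x => Num.max (- phi x) 0).
  by apply: cont_max; [exact: cont_opp | exact: cont_cst].
have eP : (\int[m]_(x in setT) ((fun x => (phi x)%:E)^\+ x) =
    (W (fun x => Num.max (phi x) 0))%:E)%E.
  rewrite -hW // => [|x]; last by rewrite le_max lexx orbT.
  by apply: eq_integral => x _; rewrite funeposE EFin_max.
have eN : (\int[m]_(x in setT) ((fun x => (phi x)%:E)^\- x) =
    (W (fun x => Num.max (- phi x) 0))%:E)%E.
  rewrite -hW // => [|x]; last by rewrite le_max lexx orbT.
  by apply: eq_integral => x _; rewrite funenegE EFin_max.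
by rewrite eP eN -EFinB /= lin.
Qed.

Lemma pos_neg_part (x : R) : Num.max x 0 - Num.max (- x) 0 = x.
Proof. by case: (leP x 0); case: (leP (- x) 0); lra. Qed.

Lemma integral_dirac_fun (x : M) g : continuous g ->
  (\int[\d_(x : bM)]_(y in setT) (g y)%:E = (g x)%:E)%E.
Proof.
move=> cg; rewrite integral_dirac //; first by rewrite diracT mul1e.
by apply/measurable_EFinP; exact: continuous_borel_fun.
Qed.

Lemma integral_empirical (f : M -> M) (x : M) n phi : continuous phi ->
  (\int[empirical f x n]_y phi y)%R = n%:R^-1 * \sum_(j < n) phi (iter j f x).
Proof.
move=> cphi; pose W g := n%:R^-1 * \sum_(j < n) g (iter j f x).
apply: (@Rintegral_linear _ W) => //; last first.
  rewrite /W -mulrBr -sumrB; congr (_ * _); apply: eq_bigr => j _.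
  exact: pos_neg_part.
move=> g cg g0; have mg : measurable_fun (setT : set bM) (fun y => (g y)%:E).
  by apply/measurable_EFinP; exact: continuous_borel_fun.
rewrite ge0_integral_mscale //; last by move=> y _; rewrite lee_fin.
rewrite ge0_integral_measure_sum //; last by move=> y _; rewrite lee_fin.
under eq_bigr do rewrite integral_dirac_fun //.
by rewrite sumEFin -EFinM.
Qed.

Section two_atom_law.
Variables (a b : {nonneg R}) (x1 x2 : M).
Hypothesis ab : a%:num + b%:num = 1.

Definition two_atom_law : set bM -> \bar R :=
  measure_add (mscale a \d_(x1 : bM)) (mscale b \d_(x2 : bM)).

HB.instance Definition _ := Measure.on two_atom_law.

Lemma two_atom_lawE (A : set bM) : two_atom_law A =
  (a%:num%:E * \d_(x1 : bM) A + b%:num%:E * \d_(x2 : bM) A)%E.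
Proof. by rewrite /two_atom_law measure_addE. Qed.

Lemma two_atom_lawT : two_atom_law setT = 1%E.
Proof. by rewrite two_atom_lawE !diracT !mule1 -EFinD ab. Qed.

HB.instance Definition _ := Measure_isProbability.Build _ _ R two_atom_law two_atom_lawT.

Definition two_atom_probability : probability bM R := two_atom_law.

Lemma integral_two_atom phi : continuous phi ->
  (\int[two_atom_probability]_y phi y)%R = a%:num * phi x1 + b%:num * phi x2.
Proof.
move=> cphi; pose W g := a%:num * g x1 + b%:num * g x2.
apply: (@Rintegral_linear _ W) => //; last first.
  rewrite /W -{3}(pos_neg_part (phi x1)) -{3}(pos_neg_part (phi x2)); ring.
move=> g cg g0; have mg : measurable_fun (setT : set bM) (fun y => (g y)%:E).
  by apply/measurable_EFinP; exact: continuous_borel_fun.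
have gE y : [set: bM] y -> (0 <= (g y)%:E)%E by rewrite lee_fin.
rewrite ge0_integral_measure_add //.
by rewrite !ge0_integral_mscale // !integral_dirac_fun.
Qed.

End two_atom_law.
End atoms.

(** * Negligible points of the closure of V *)

Section null_boundary.
Variable R : realType.
Implicit Types p : R * R.
Local Notation leb2 := (@lebesgue_measure R \x @lebesgue_measure R)%E.

(** It contains the boundary of V and, through the line y = 0, the source; the rest of the closure
    of V is covered by the convergence of empirical measures. *)
Definition exceptional : set (R * R) :=
  ([set p | be p = 0] `|` [set p | al p = 0]) `|` [set p | p.2 = 0].

Lemma pt_loclip r : map_loclip (fun p : R * R => pt r p.1 p.2).
Proof. by split; rewrite /pt /comp /=; loclip. Qed.

Lemma closed_borel (A : set (R * R)) : closed A ->
  measurable (A : set (borel (planeT R))).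
Proof.
move=> c; rewrite -[X in measurable X]setCK; apply: measurableC.
by apply: sub_sigma_algebra; exact: closed_openC.
Qed.

Lemma closed_zeros (h : R * R -> R) : continuous h -> closed [set p | h p = 0].
Proof.
move=> ch; have -> : [set p | h p = 0] = [set p | h p <= 0] `&` [set p | 0 <= h p].
  by apply/seteqP; split=> p /=; [move=> -> | move=> [? ?]; apply/le_anti/andP].
by apply: closedI; [apply: closed_le | apply: closed_ge].
Qed.

Lemma line_measurable : measurable ([set p : R * R | p.2 = 0] : set (borel (planeT R))).
Proof. by apply: closed_borel; apply: closed_zeros; exact: cont_snd. Qed.

Lemma line_null : leb2 [set p : R * R | p.2 = 0] = 0%E.
Proof.
have -> : [set p : R * R | p.2 = 0] = setT `*` [set 0].
  by apply/seteqP; split=> p //= [].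
have m0 : measurable ([set 0] : set (measurableTypeR R)) by exact: measurable_set1.
rewrite product_measure1E //.
have e : @lebesgue_measure R [set 0] = 0%E by exact: lebesgue_measure_set1.
by rewrite [X in (_ * X)%E]e mule0.
Qed.

(** The loci be = 0 and al = 0 are covered by images of the line y = 0 under [pt] and its
    composition with [refl], which are locally Lipschitz. *)
Lemma exceptional_thin : thin exceptional.
Proof.
have line : thin [set p : R * R | p.2 = 0].
  by move=> e e0; exists [set p : R * R | p.2 = 0]; split=> //;
    [exact: (borel_measurable2 line_measurable) | rewrite line_null lee_fin ltW].
have img r : thin ((fun p : R * R => pt r p.1 p.2) @` [set p : R * R | p.2 = 0]).
  have [h1 h2] := pt_loclip r.
  by apply: (loclip_thin h1 h2 line_measurable line_null).
have be0 : thin [set p : R * R | be p = 0].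
  apply: thin_sub (thinU (img false) (img true)) => p /= b0.
  case: (leP p.1 0) => p0; [left|right]; exists (al p, 0) => //=.
    by rewrite -b0 pt_coord.
  by rewrite -b0 pt_coord // ltW.
have al0 : thin [set p : R * R | al p = 0].
  have [h1 h2] := @refl_loclip R.
  have sub : [set p : R * R | al p = 0] `<=`
      (((@refl R \o (fun p : R * R => pt false p.1 p.2)) @` [set p : R * R | p.2 = 0]) `|`
       ((@refl R \o (fun p : R * R => pt true p.1 p.2)) @` [set p : R * R | p.2 = 0])).
    move=> p /= a0.
    have e r : (if r then 0 <= p.1 else p.1 <= 0) -> refl (pt r (be p) 0) = p.
      by move=> h; rewrite -a0 -(al_refl p) -(be_refl p) pt_coord ?reflK //; case: r h.
    case: (leP p.1 0) => p0; [left|right]; exists (be p, 0) => //=; apply: e => //.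
    exact: ltW.
  apply: thin_sub sub _; apply: thinU.
    have [g1 g2] := map_loclip_comp (pt_loclip false) (@pt_continuous R false) (conj h1 h2).
    exact: (loclip_thin g1 g2 line_measurable line_null).
  have [g1 g2] := map_loclip_comp (pt_loclip true) (@pt_continuous R true) (conj h1 h2).
  exact: (loclip_thin g1 g2 line_measurable line_null).
by apply: thinU => //; exact: thinU.
Qed.

Lemma exceptional_negligible : (vol (plane R)).-negligible exceptional.
Proof.
have m : measurable (exceptional : set (borel (planeT R))).
  apply: closed_borel; apply: closedU; first apply: closedU; apply: closed_zeros.
  - exact: be_continuous.
  - exact: al_continuous.
  - exact: cont_snd.
exists exceptional; split=> //.
by apply: thin_null; [exact: borel_measurable2 | exact: exceptional_thin].
Qed.

Lemma square_positive (A : set (plane R)) :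
  [set p : R * R | 0 < p.1 < 1 / 4 /\ 0 < p.2 < 1 / 4] `<=` A -> positive_volume A.
Proof.
move=> QA [B [mB B0 AB]].
have e : [set p : R * R | 0 < p.1 < 1 / 4 /\ 0 < p.2 < 1 / 4] =
    [set` `](0 : R), 1 / 4[] `*` [set` `](0 : R), 1 / 4[].
  by apply/seteqP; split=> p /=; rewrite !in_itv.
have w : @lebesgue_measure R [set` `](0 : R), 1 / 4[] = (1 / 4)%:E.
  by rewrite lebesgue_measure_itv /= lte_fin ifT ?sube0 //; lra.
pose Q : set (R * R) := [set p | 0 < p.1 < 1 / 4 /\ 0 < p.2 < 1 / 4].
have : (leb2 Q <= 0)%E.
  rewrite -B0; apply: le_measure; rewrite ?inE.
  - by rewrite /Q e; apply: measurableX; exact: measurable_itv.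
  - exact: borel_measurable2.
  - exact: subset_trans QA AB.
rewrite /Q e product_measure1E; try exact: measurable_itv.
rewrite (_ : (_ * _)%E = (1 / 4 * (1 / 4))%:E); first by rewrite lee_fin; lra.
by rewrite EFinM; congr (_ * _)%E; exact: w.
Qed.

Lemma square_inside (p : R * R) : 0 < p.1 < 1 / 4 /\ 0 < p.2 < 1 / 4 -> gauge p < 1.
Proof.
move=> [/andP[? ?] /andP[? ?]]; rewrite /gauge /depth !gtr0_norm //.
by case: (leP p.1 (p.1 / 2 + p.2)); lra.
Qed.

End null_boundary.

(** * SRB-like measures of the Bowen map *)

Section srb.
Variables (R : realType) (kap L K t : R).
Hypotheses (L1 : 1 < L) (K1 : 1 < K) (LK : L * K = kap).
Hypotheses (tL : t * ln L = 1) (tK : (1 - t) * ln K = 1) (t01 : 0 < t < 1).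
Local Notation M := (plane R).
Local Notation f := (bowen kap L K : M -> M).
Local Notation x1 := ((-1, 0) : R * R).
Local Notation x2 := ((1, 0) : R * R).

Let t0 : 0 <= t. Proof. by case/andP: t01 => /ltW. Qed.
Let s0 : 0 <= 1 - t. Proof. by rewrite subr_ge0; case/andP: t01 => _ /ltW. Qed.

Lemma weights_sum : (NngNum t0)%:num + (NngNum s0)%:num = 1.
Proof. by rewrite /= addrC subrK. Qed.

Definition saddle_law : probability (borel M) R :=
  @two_atom_probability R _ _ x1 x2 weights_sum.

Lemma saddle_lawE (A : set (borel M)) : saddle_law A = two_atoms t (x1 : M) x2 A.
Proof. exact: two_atom_lawE. Qed.

Lemma integral_saddle_law (phi : M -> R) : continuous phi ->
  (\int[saddle_law]_x phi x)%R = t * phi x1 + (1 - t) * phi x2.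
Proof. exact: integral_two_atom. Qed.

Lemma empirical_cvg (y : M) : gauge y < 1 -> y <> (0, 0) ->
  weak_star_cvg (empirical f y) saddle_law.
Proof.
move=> gy y0 phi [cphi [C phiC]]; rewrite integral_saddle_law //.
have nm := observable_mean L1 K1 LK tL tK t01 gy y0 phiC cphi.
apply/cvgrPdist_le => e e0; have [N hN] := nm e e0.
exists N.+1 => // n /= Nn; rewrite integral_empirical // distrC.
have n0 : 0 < n%:R :> R by rewrite ltr0n (leq_trans _ Nn).
have := hN n (ltnW Nn); rewrite sumrB sumr_const card_ord.
set c := t * _ + _; set S := \sum_(_ < _) _ => h.
have -> : n%:R^-1 * S - c = n%:R^-1 * (S - c *+ n).
  by rewrite mulrBr -[c *+ n]mulr_natl mulrA mulVf ?mul1r // gt_eqF.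
rewrite normrM ger0_norm; last by rewrite invr_ge0 ltW.
by rewrite [X in X <= _]mulrC ler_pdivrMr.
Qed.

Section metrizable.
Variable dist : probability (borel M) R -> probability (borel M) R -> R.
Hypothesis hdist : weak_star_metric dist.

(** Were the distance positive, the ball around mu of that radius would be a weak-star
    neighbourhood. It would then contain nu, which has the same integrals as mu, although nu lies at
    exactly that distance. *)
Lemma dist_eq0 (mu nu : probability (borel M) R) : (forall phi : M -> R, test_function phi ->
  (\int[mu]_x phi x = \int[nu]_x phi x)%R) -> dist mu nu = 0.
Proof.
move=> e; have [d0 _ _ _ dN] := hdist.
apply/eqP; rewrite eq_le d0 andbT leNgt; apply/negP => dpos.
have [n [phi [r [r0 hphi hN]]]] : weak_star_nbhs mu [set rho | dist mu rho < dist mu nu].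
  by apply/dN; exists (dist mu nu).
have : dist mu nu < dist mu nu.
  by apply: hN => k; rewrite e ?subrr ?normr0.
by rewrite ltxx.
Qed.

Lemma limit_measures_dist (y : M) nu : gauge y < 1 -> y <> (0, 0) ->
  limit_measures f y nu -> dist nu saddle_law = 0.
Proof.
move=> gy y0 [s [hs cs]]; apply: dist_eq0 => phi tphi.
have sk k : (k <= s k)%N.
  by elim: k => // k IH; exact: leq_ltn_trans IH (hs _ _ (ltnSn k)).
have c1 := cs phi tphi; have c2 := empirical_cvg gy y0 tphi.
have s_oo : s n @[n --> \oo] --> \oo.
  move=> A [N _ hA]; exists N => // n /= Nn; apply: hA => /=.
  exact: leq_trans Nn (sk n).
have c3 := cvg_comp _ _ s_oo c2.
exact: (cvg_unique (@norm_hausdorff _ R^o) c1 c3).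
Qed.

Lemma limit_measures_saddle_law (y : M) : gauge y < 1 -> y <> (0, 0) ->
  limit_measures f y saddle_law.
Proof. by move=> gy y0; exists id; split=> //; exact: empirical_cvg. Qed.

(** The saddle law is a limit measure and every limit measure is at distance 0 from it. *)
Lemma dist_limit_measures (y : M) mu : gauge y < 1 -> y <> (0, 0) ->
  dist_to_set dist (limit_measures f y) mu = (dist saddle_law mu)%:E.
Proof.
move=> gy y0; have [d0 _ sym tri _] := hdist.
apply: le_anti; apply/andP; split.
  apply: ereal_inf_lbound; exists saddle_law => //.
  exact: limit_measures_saddle_law.
apply/ereal_infP => _ [nu lnu <-]; rewrite lee_fin.
apply: (le_trans (tri _ nu _)).
by rewrite sym (limit_measures_dist gy y0 lnu) add0r.
Qed.

(** Outside [exceptional] the distance from mu to the limit measures does not depend on the point.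
    The sets that define SRB-like measures are thus either negligible or contain all of V except the
    source. *)
Lemma SRB_like_saddle_law :
  SRB_like dist f (closure [set p : M | gauge p < 1]) =
  [set mu : probability (borel M) R | eq_on_borel mu (two_atoms t (x1 : M) x2)].
Proof.
have [d0 de sym tri _] := hdist.
apply/seteqP; split=> mu.
  move=> h; have dm : dist saddle_law mu = 0.
    apply/eqP; rewrite eq_le d0 andbT; apply/ler_addgt0Pr => e e0; rewrite add0r.
    rewrite leNgt; apply/negP => ed.
    apply: (h e e0); apply: negligibleS (@exceptional_negligible R) => y [cy hy].
    apply: contrapT => ny.
    have gy : gauge y < 1.
      have : gauge y <= 1 by move: cy; rewrite closure_gauge.
      rewrite gauge_le1 gauge_lt1 !le_eqVlt => /andP[/orP[/eqP a0|->] /orP[/eqP b0|->]] //.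
      - by case: ny; left; right.
      - by case: ny; left; right.
      - by case: ny; left; left.
    have y0 : y <> (0, 0) by move=> y0; apply: ny; right; rewrite /= y0.
    move: hy; rewrite dist_limit_measures // lte_fin => hy.
    by have := lt_trans ed hy; rewrite ltxx.
  by move=> A mA; rewrite -saddle_lawE; apply/esym; exact: (iffLR (de _ _) dm).
move=> h e e0; apply: square_positive => p /[dup] /square_inside gp [p1 p2].
split; first exact: subset_closure.
rewrite dist_limit_measures //; last first.
  by move=> p0; move: p1; rewrite p0 /= ltxx.
rewrite lte_fin (_ : dist saddle_law mu = 0) //.
by apply/de => A mA; rewrite h // saddle_lawE.
Qed.

End metrizable.
End srb.

Theorem mainTheorem6 (R : realType) (t : R) (t_gt0 : 0 < t) (t_lt1 : t < 1) :
  exists (M : riemannian_surface R) (f : M -> M) (x1 x2 x3 : M) (V : set M),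
    [/\ bowen_homeomorphism f x1 x2 x3 V,
        forward_invariant f (closure V),
        positive_volume (closure V)
      & forall dist, weak_star_metric dist ->
          SRB_like dist f (closure V) =
            [set mu : probability (borel M) R |
               eq_on_borel mu (two_atoms t x1 x2)]].
Proof.
pose L := expR t^-1; pose K := expR (1 - t)^-1; pose kap := L * K.
have t01 : 0 < t < 1 by rewrite t_gt0.
have s0 : 0 < 1 - t by rewrite subr_gt0.
have L1 : 1 < L by rewrite expR_gt1 invr_gt0.
have K1 : 1 < K by rewrite expR_gt1 invr_gt0.
have LK : L * K = kap by [].
have tL : t * ln L = 1 by rewrite expRK mulfV // gt_eqF.
have tK : (1 - t) * ln K = 1 by rewrite expRK mulfV // gt_eqF.
pose x1 : plane R := ((-1, 0) : R * R); pose x2 : plane R := ((1, 0) : R * R).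
pose x3 : plane R := ((0, 0) : R * R); pose f : plane R -> plane R := bowen kap L K.
exists (plane R), f, x1, x2, x3, [set p : plane R | gauge p < 1].
split; last 3 first.
- rewrite /forward_invariant closure_gauge => p /= gp.
  exact: bowen_gauge_le1.
- apply: square_positive => p /square_inside gp; exact: subset_closure.
- by move=> dist hdist; exact: (SRB_like_saddle_law L1 K1 LK tL tK t01 hdist).
have [U1 [U2 [U3 [cU nU dU UA]]]] := affine_neighbourhoods L1 K1 LK.
exists (bowen_inv kap L K), U1, U2, U3, (id @` @ray R), (@refl R @` @ray R),
  (@rot R @` @ray R), ((fun p => refl (rot p)) @` @ray R).
have saddle_neq := @saddles_neq R.
split.
- split; last exact: bowen_nonsingular.
  split; [exact: bowen_continuous | exact: bowen_inv_continuous
    | exact: bowenK | exact: bowen_invK].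
- split.
  + by rewrite -[RHS](saddle_map_center (-1) L); exact: (nbhs_singleton (bowen_near_left L1 K1 LK)).
  + by rewrite -[RHS](saddle_map_center 1 K); exact: (nbhs_singleton (bowen_near_right L1 K1 LK)).
  + by rewrite /f /x3 bowen0.
  + split; first by move=> e; apply: saddle_neq.
      by apply: saddles_neq0; left.
    by apply: saddles_neq0; right.
- split=> //; first exact: bowen_diffeomorphism.
  exact: bowen_hyperbolic.
- split.
  + split; [exact: (stable_left L1 K1 LK tL tK t01) | exact: unstable_left
      | exact: (stable_right L1 K1 LK tL tK t01) | exact: unstable_right].
  + split.
    * by apply: (@symmetric_arc R id 1 1) => // -[x y]; rewrite /= !mul1r.
    * apply: (@symmetric_arc R (@refl R) 1 (-1)); last exact: reflK.
      by move=> [x y]; rewrite /refl /= mul1r mulN1r.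
    * apply: (@symmetric_arc R (@rot R) (-1) (-1)); last exact: rotK.
      by move=> [x y]; rewrite /rot /= !mulN1r.
    * apply: (@symmetric_arc R _ (-1) 1).
        by move=> [x y]; rewrite /refl /rot /= mul1r mulN1r opprK.
      by move=> [x y]; rewrite /refl /rot /= !opprK.
  + split; [exact: rays_glue1 | exact: rays_glue2].
  + rewrite ray_union; split; [exact: compact_gauge_sphere|].
    exact: unit_circle_homeomorphic.
  + split; [exact: open_gauge | exact: open_disc_homeomorphic|].
    by rewrite ray_union; exact: gauge_boundary.
- split.
  + by rewrite /= (_ : gauge x3 = 0) //; exact: (radial0 (gauge_radial R)).
  + move=> y gy y3; split.
    * by apply: (saddle_in_omega L1 K1 LK tL tK t01) => //; left.
    * by apply: (saddle_in_omega L1 K1 LK tL tK t01) => //; right.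
    * exact: cluster_bowen_inv.
Qed.
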